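(* Let $\mathbb{P}$ be the forcing poset whose conditions are triples $(a,x,A)$ satisfying: (1) $a$ is a finite subset of $\{\xi<\omega_2:\mathrm{cf}(\xi)=\omega\}$; (2) $x$ is a finite set of triples $\langle\alpha,\gamma,\beta\rangle$, where $\alpha\in\Gamma$ and $\gamma<\beta<\alpha$; (3) $A$ is a finite adequate set; (4) if $\langle\alpha,\gamma,\beta\rangle$ and $\langle\alpha,\gamma',\beta'\rangle$ are distinct triples in $x$, then $[\gamma,\beta)\cap[\gamma',\beta')=\emptyset$; (5) if $\xi\in a$, $M\in A$, $\sup(M\cap\xi)=\xi$, and $M\setminus\xi\neq\emptyset$, then $\xi\in M$; (6) whenever $M\in A$, $\alpha\in M$, and $\langle\alpha,\gamma,\beta\rangle\in x$: if $M\cap[\gamma,\beta]\neq\emptyset$ then $\gamma,\beta\in M$; and if $M\cap[\gamma,\beta]=\emptyset$ then $\sup(M\cap\alpha)<\gamma$; ordered by $(b,y,B)\le(a,x,A)$ iff $a\subseteq b$, $x\subseteq y$ and $A\subseteq B$. Let $\dot S$ be a $\mathbb{P}$-name such that $\mathbb{P}$ forces $\dot S=\{\xi:\exists (a,x,A)\in\dot G\ (\xi\in a)\}$, where $\dot G$ is the canonical name for the generic filter. Then $\mathbb{P}$ is strongly proper on a stationary set, and $\mathbb{P}$ forces that $\dot S$ is stationary (in $\omega_2$).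
   Context: Standing assumptions and notation. Assume $2^{\omega_1}=\omega_2$ and fix a bijection $\pi:\omega_2\to H(\omega_2)$. $P_{\omega_1}(\omega_2)$ is the set of countable subsets of $\omega_2$. Assume there is a stationary set $\mathcal{Y}\subseteq P_{\omega_1}(\omega_2)$ which is thin, i.e. for all $\beta<\omega_2$ the set $\{a\cap\beta: a\in\mathcal{Y}\}$ has size at most $\omega_1$; fix such a $\mathcal{Y}$ which is moreover closed under initial segments ($a\in\mathcal{Y}$, $\beta<\omega_2$ imply $a\cap\beta\in\mathcal{Y}$). Let $\mathcal{A}$ be the structure $(H(\omega_2),\in,\pi,\mathcal{Y})$, which has definable Skolem functions (via the well-ordering induced by $\pi$). For $a\subseteq H(\omega_2)$, $Sk(a)$ is the closure of $a$ under a fixed set of definable Skolem functions for $\mathcal{A}$. Let $C$ be the (club) set of $\beta<\omega_2$ with $Sk(\beta)\cap\omega_2=\beta$, and let $\Lambda$ be the set of $\beta<\omega_2$ of cofinality $\omega_1$ which are limit points of $C$. Let $\mathcal{X}$ be the set of $M\in\mathcal{Y}$ such that $Sk(M)\cap\omega_2=M$ and for all $\gamma\in M$, $\sup(C\cap\gamma)\in M$. Comparison points and adequacy. Fix a set $\Gamma\subseteq\Lambda$ which is stationary in $\omega_2$. For $M\in\mathcal{X}$, $\Gamma_M$ is the set of $\beta\in\Gamma$ such that $\beta=\min(\Gamma\setminus\sup(M\cap\beta))$, i.e. $\Gamma\cap[\sup(M\cap\beta),\beta)=\emptyset$. For $M,N\in\mathcal{X}$, $\Gamma_M\cap\Gamma_N$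 has a largest element, denoted $\beta_{M,N}$. A set $A\subseteq\mathcal{X}$ is adequate if for all $M,N\in A$, either $M\cap\beta_{M,N}=N\cap\beta_{M,N}$, or $M\cap\beta_{M,N}\in Sk(N)$, or $N\cap\beta_{M,N}\in Sk(M)$. Strong properness. For a forcing poset $\mathbb{Q}$, a set $N$ and $q\in\mathbb{Q}$, $q$ is strongly $(N,\mathbb{Q})$-generic if every dense subset $D$ of the poset $N\cap\mathbb{Q}$ is predense in $\mathbb{Q}$ below $q$. $\mathbb{Q}$ is strongly proper on a stationary set if for every sufficiently large regular cardinal $\theta$ with $\mathbb{Q}\subseteq H(\theta)$, there are stationarily many countable $N\prec H(\theta)$ such that every $p\in N\cap\mathbb{Q}$ has an extension $q\le p$ which is strongly $(N,\mathbb{Q})$-generic. *)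

(* Defs.v *)
(* The set-theoretic universe is the type [V] of Aczel's well-founded trees
   modulo bisimulation, so that equality on [V] is Leibniz equality and is
   extensional.  With the classical axioms of [boolp], [V] satisfies ZFC.
   Classes are elements of [set V]; [elts x] is the class of the
   elements of the set [x : V].  Since every class that is the image of an
   index type in [Small] is a set (lemma [setofE]), functions, subsets and
   injections between sets of [V] are represented by Rocq-level ones. *)
From HB Require Import structures.
From mathcomp Require Import all_boot.
From mathcomp Require Import boolp classical_sets functions cardinality.

Set Implicit Arguments.
Unset Strict Implicit.
Unset Printing Implicit Defensive.

Local Open Scope classical_set_scope.
Local Open Scope card_scope.

(** * The universe of sets *)

Definition Small := Type.

Inductive tree := Sup (I : Small) (f : I -> tree).

Definition tidx (t : tree) : Small := match t with Sup T _ => T end.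
Definition tsub (t : tree) : tidx t -> tree :=
  match t with Sup _ f => f end.

Fixpoint teq (s t : tree) : Prop :=
  match s, t with
  | Sup T f, Sup U g =>
      (forall i, exists j, teq (f i) (g j)) /\
      (forall j, exists i, teq (f i) (g j))
  end.

Lemma teq_refl t : teq t t.
Proof. by elim: t => I f IH /=; split=> i; exists i. Qed.

Lemma teq_sym s t : teq s t -> teq t s.
Proof.
elim: s t => I f IH [J g] /= [h1 h2]; split.
- by move=> j; have [i /IH] := h2 j; exists i.
- by move=> i; have [j /IH] := h1 i; exists j.
Qed.

Lemma teq_trans s t u : teq s t -> teq t u -> teq s u.
Proof.
elim: s t u => I f IH [J g] [K k] /= [h1 h2] [h3 h4]; split.
- by move=> i; have [j /IH fg] := h1 i; have [l /fg] := h3 j; exists l.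
- by move=> l; have [j gl] := h4 l; have [i /IH/(_ gl)] := h2 j; exists i.
Qed.

Definition canon (t : tree) : tree :=
  sval (cid (ex_intro (teq t) t (teq_refl t))).

Lemma canonP t : teq t (canon t).
Proof. by rewrite /canon; case: cid. Qed.

Lemma canon_eq s t : teq s t -> canon s = canon t.
Proof.
move=> st; rewrite /canon.
have cidE (P P' : tree -> Prop) (p : ex P) (p' : ex P') :
  P = P' -> sval (cid p) = sval (cid p').
  by move=> e; case: P' / e p' => p'; rewrite (Prop_irrelevance p p').
apply: cidE; apply/funext => u; apply/propext.
by split; [apply: teq_trans; apply: teq_sym | apply: teq_trans].
Qed.

Record V := MkV { repr : tree; reprK : canon repr = repr }.

Lemma canonK t : canon (canon t) = canon t.
Proof. by apply/canon_eq/teq_sym/canonP. Qed.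

Definition class_of (t : tree) : V := MkV (canonK t).

(* The set [x] is [{el i | i : idx x}], possibly with repetitions. *)
Definition idx (x : V) : Small := tidx (repr x).
Definition el (x : V) (i : idx x) : V := class_of (tsub i).

Definition mem (x y : V) : Prop := exists i : idx y, el i = x.
Notation "x ∈ y" := (mem x y) (at level 70, no associativity).

Definition elts (x : V) : set V := [set y | y ∈ x].
Notation "x ⊆ y" := (elts x `<=` elts y) (at level 70, no associativity).

Definition emptyV : V := class_of (Sup (fun e : False => match e with end)).

HB.instance Definition _ := gen_eqMixin V.
HB.instance Definition _ := gen_choiceMixin V.
HB.instance Definition _ := isPointed.Build V emptyV.

(* The set whose elements are the members of the class [C], if there is one. *)
Definition setof (C : set V) : V := get [set s | elts s = C].

Lemma class_of_eq s t : class_of s = class_of t <-> teq s t.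
Proof.
split=> [[e]|st].
  by apply: teq_trans (canonP s) _; rewrite e; apply/teq_sym/canonP.
rewrite /class_of; move: (canonK s) (canonK t); rewrite (canon_eq st) => p q.
by rewrite (Prop_irrelevance p q).
Qed.

Lemma reprE x : class_of (repr x) = x.
Proof.
case: x => t tK; rewrite /class_of /=; move: (canonK t); rewrite tK => p.
by rewrite (Prop_irrelevance p tK).
Qed.

Lemma mem_class_of x I (f : I -> tree) :
  x ∈ class_of (Sup f) <-> exists i, class_of (f i) = x.
Proof.
rewrite /mem /idx /el /=.
case: (canon _) (canonP (Sup f)) => J g /= [h1 h2]; split=> -[].
  by move=> j <-; have [i ij] := h2 j; exists i; apply/class_of_eq.
move=> i <-; have [j ij] := h1 i; exists j.
by apply/class_of_eq/teq_sym.
Qed.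

Lemma elts_inj : injective elts.
Proof.
move=> x y; rewrite -(reprE x) -(reprE y).
case: (repr x) (repr y) => [I f] [J g] exy; apply/class_of_eq.
have {}exy z : elts _ z = elts _ z := congr1 (@^~ z) exy.
split=> [i|j].
  have : elts (class_of (Sup f)) (class_of (f i)).
    by apply/mem_class_of; exists i.
  rewrite exy => /mem_class_of[j /class_of_eq ?]; exists j; exact: teq_sym.
have : elts (class_of (Sup g)) (class_of (g j)).
  by apply/mem_class_of; exists j.
by rewrite -exy => /mem_class_of[i /class_of_eq ?]; exists i.
Qed.

Lemma mem_ind (Q : V -> Prop) :
  (forall x, (forall y, y ∈ x -> Q y) -> Q x) -> forall x, Q x.
Proof.
move=> step x; rewrite -(reprE x); elim: (repr x) => I f IH.
by apply: step => y /mem_class_of[i <-].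
Qed.

(* Replacement: the image of a small type is a set. *)
Lemma setofE (I : Small) (f : I -> V) (C : set V) :
  C `<=` range f -> elts (setof C) = C.
Proof.
move=> Cf; apply: (@getPex _ [set s | elts s = C]).
exists (class_of (Sup (fun i : {i | C (f i)} => repr (f (sval i))))).
apply/seteqP; split=> [x /mem_class_of[[i Ci]] /=|x Cx].
  by rewrite reprE => <-.
have [i _ fi] := Cf _ Cx; apply/mem_class_of.
by exists (exist _ i (eq_ind_r C Cx fi)); rewrite /= reprE.
Qed.

Lemma elts_range x : elts x = range (@el x).
Proof. by apply/seteqP; split=> [y [i]|y [i _]]; exists i. Qed.

Lemma setof_sub (x : V) (C : set V) : C `<=` elts x -> elts (setof C) = C.
Proof. by rewrite elts_range; apply: setofE. Qed.

Lemma setof_subsets (x : V) (C : set V) :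
  C `<=` [set a | a ⊆ x] -> elts (setof C) = C.
Proof.
move=> Cx.
apply: (@setofE (idx x -> Prop)
         (fun P => setof [set y | exists2 i, P i & el i = y])) => a /Cx ax.
exists (fun i => el i ∈ a) => //; apply: elts_inj.
rewrite (@setofE _ (@el x)); last by move=> y [i _ <-]; exists i.
apply/seteqP; split=> y; first by move=> [i ia <-].
by move=> ya; have [i iy] := ax _ ya; exists i; rewrite ?iy.
Qed.

Definition is_set (C : set V) := exists s, elts s = C.
Lemma setofP C : is_set C -> elts (setof C) = C.
Proof. by case=> s <-; exact: (@setof_sub s). Qed.
Lemma is_set_sub C D : C `<=` D -> is_set D -> is_set C.
Proof. by move=> CD [s eD]; exists (setof C); apply: (@setof_sub s); rewrite eD. Qed.
Lemma is_set_pow C : is_set C -> is_set [set a | elts a `<=` C].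
Proof.
case=> s <-; exists (setof [set a | elts a `<=` elts s]).
exact: (@setof_subsets s).
Qed.
Lemma is_set_image2 (h : V -> V -> V) C D : is_set C -> is_set D ->
  is_set [set h c d | c in C & d in D].
Proof.
move=> [s <-] [t <-]; exists (setof [set h c d | c in elts s & d in elts t]).
apply: (@setofE (idx s * idx t)%type (fun ij => h (el ij.1) (el ij.2))).
by move=> _ [c [i <-] [d [j <-] <-]]; exists (i, j).
Qed.
Lemma is_set_elts x : is_set (elts x). Proof. by exists x. Qed.

(** * Basic set-theoretic vocabulary *)

Definition capV (x : V) (A : set V) : V := setof (elts x `&` A).
Definition bigcupV (A : set V) : V := setof [set z | exists2 y, A y & z ∈ y].

Lemma bigcupE (A : set V) : is_set A ->
  elts (bigcupV A) = [set z | exists2 y, A y & z ∈ y].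
Proof.
case=> s <-.
apply: (@setofE {i : idx s & idx (el i)} (fun u => el (tagged u))).
by move=> z [_ [i <-] [j <-]]; exists (Tagged (fun i => idx (el i)) j).
Qed.

Definition upair (x y : V) : V := setof [set z | z = x \/ z = y].
Lemma upairE x y : elts (upair x y) = [set z | z = x \/ z = y].
Proof.
apply: (@setofE bool (fun b => if b then x else y)).
by move=> z [->|->]; [exists true|exists false].
Qed.

Definition opair (x y : V) : V := upair (upair x x) (upair x y).
Definition triple (x y z : V) : V := opair (opair x y) z.

Definition transitive_class (A : set V) : Prop := forall y, A y -> elts y `<=` A.
Definition trcl (x : V) : set V := smallest transitive_class (elts x).

(* Ordinals: [α < β] is [α ∈ β], and [α <= β] is [leO α β]. *)
Definition Ord (x : V) : Prop :=
  transitive_class (elts x) /\ forall y, y ∈ x -> transitive_class (elts y).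
Definition leO (x y : V) : Prop := x ∈ y \/ x = y.

(* The supremum of a set of ordinals is its union, so that the supremum of
   the empty set is 0. *)
Definition supO (A : set V) : V := bigcupV A.

(* A class of ordinals that inject into a fixed small type is a set. *)
Lemma ordinals_set (T : Small) (C : set V) :
  (forall a, C a -> Ord a /\ exists K : V -> T -> Prop,
     (forall x, x ∈ a -> exists i, K x i) /\
     (forall x y i, x ∈ a -> y ∈ a -> K x i -> K y i -> x = y)) ->
  elts (setof C) = C.
Proof.
move=> CK.
pose coded a (RS : (T -> T -> Prop) * (T -> Prop)) :=
  Ord a /\ exists K : V -> T -> Prop,
   [/\ forall x, x ∈ a -> exists i, K x i,
       forall x y i, x ∈ a -> y ∈ a -> K x i -> K y i -> x = y,
       forall i j, RS.1 i j <->
         exists x y, [/\ x ∈ a, y ∈ a, K x i, K y j & x ∈ y] &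
       forall i, RS.2 i <-> exists2 x, x ∈ a & K x i].
have coded_inj a b RS : coded a RS -> coded b RS -> a = b.
  case: RS => R S [[ta _] [K [Kt Ki KR KS]]] [[tb _] [L [Lt Li LR LS]]] /=.
  have key : forall x, x ∈ a -> forall y i, y ∈ b -> K x i -> L y i -> x = y.
    elim/mem_ind => x IH xa y i yb Kx Ly.
    apply: elts_inj; apply/seteqP; split=> z.
      move=> zx; have za := ta _ xa _ zx; have [k Kz] := Kt _ za.
      have /LR[u [v [ub vb Lu Lv uv]]] : R k i.
        by apply/KR; exists z, x; split.
      rewrite (IH _ zx za _ _ ub Kz Lu).
      by rewrite (Li _ _ _ yb vb Ly Lv).
    move=> zy; have zb := tb _ yb _ zy; have [k Lz] := Lt _ zb.
    have /KR[u [v [ua va Ku Kv uv]]] : R k i.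
      by apply/LR; exists z, y; split.
    have vx : v = x := Ki _ _ _ va xa Kv Kx; rewrite vx in uv.
    by rewrite -(IH _ uv ua _ _ zb Ku Lz).
  apply: elts_inj; apply/seteqP; split=> x.
    move=> xa; have [i Kx] := Kt _ xa.
    have /LS[y yb Ly] : S i by apply/KS; exists x.
    by rewrite (key _ xa _ _ yb Kx Ly).
  move=> xb; have [i Lx] := Lt _ xb.
  have /KS[y ya Ky] : S i by apply/LS; exists x.
  by rewrite -(key _ ya _ _ xb Ky Lx).
apply: (@setofE _ (fun RS => get (coded^~ RS))) => a /CK[oa [K [Kt Ki]]].
pose R i j := exists x y, [/\ x ∈ a, y ∈ a, K x i, K y j & x ∈ y].
pose S i := exists2 x, x ∈ a & K x i.
have ca : coded a (R, S).
  by split=> //; exists K; split=> //.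
have cg : coded (get (coded^~ (R, S))) (R, S).
  by apply: (@getPex _ (coded^~ (R, S))); exists a.
by exists (R, S) => //; apply: coded_inj cg ca.
Qed.

(* The least ordinal that does not inject into [x]. *)
Definition hartogs (x : V) : V := setof [set a | Ord a /\ elts a #<= elts x].

Lemma hartogsE x :
  elts (hartogs x) = [set a | Ord a /\ elts a #<= elts x].
Proof.
apply: (@ordinals_set (idx x)) => a [oa /pcard_leP/unsquash f]; split=> //.
exists (fun y i => el i = f y); split=> [y ya|y z i ya za -> fyz].
  by have [i fi] : elts x (f y) by [apply: 'funS_f]; exists i.
by apply: ('inj_f) => //; apply/mem_set.
Qed.

Definition omega : V := setof [set n | Ord n /\ finite_set (elts n)].
Lemma omegaE : elts omega = [set n | Ord n /\ finite_set (elts n)].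
Proof.
apply: (@ordinals_set nat) => a [oa /finite_set_countable].
move=> /pcard_leP/unsquash f; split=> //.
exists (fun y i => i = f y); split=> [y ya|y z i ya za -> fyz]; first by exists (f y).
by apply: ('inj_f) => //; apply/mem_set.
Qed.

Definition omega1 : V := hartogs omega.
Definition omega2 : V := hartogs omega1.

Definition cofinal_map (d a : V) (f : V -> V) : Prop :=
  (forall x, x ∈ d -> f x ∈ a) /\
  (forall y, y ∈ a -> exists2 x, x ∈ d & leO y (f x)).

Definition has_cof (a k : V) : Prop :=
  [/\ Ord a, Ord k, exists f, cofinal_map k a f &
      forall d, d ∈ k -> ~ exists f, cofinal_map d a f].

Definition regular (k : V) : Prop := omega ⊆ k /\ has_cof k k.

(* The class H(k) of sets whose transitive_class closure has cardinality < k. *)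
Definition H (k : V) : set V :=
  [set x | trcl x #<= elts k /\ ~ (elts k #<= trcl x)].

(** * Clubs and stationary sets *)

Definition limit_point (D : set V) (a : V) : Prop :=
  (exists x, x ∈ a) /\
  (forall x, x ∈ a -> exists y, [/\ D y, x ∈ y & y ∈ a]).

Definition club (k : V) (D : set V) : Prop :=
  [/\ D `<=` elts k,
      forall x, x ∈ k -> exists2 y, D y & x ∈ y &
      forall a, a ∈ k -> limit_point D a -> D a].

Definition stationary (k : V) (S : set V) : Prop :=
  S `<=` elts k /\ forall D, club k D -> exists2 x, D x & S x.

(* P_{omega1}(X), for a class [X]. *)
Definition Pomega1 (X : set V) : set V :=
  [set a | elts a `<=` X /\ countable (elts a)].

Definition clubP (X : set V) (D : set V) : Prop :=
  [/\ D `<=` Pomega1 X,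
      forall a, Pomega1 X a -> exists2 b, D b & a ⊆ b &
      forall a : nat -> V, (forall n, D (a n)) -> (forall n, a n ⊆ a n.+1) ->
        D (bigcupV (range a))].

Definition stationaryP (X : set V) (S : set V) : Prop :=
  S `<=` Pomega1 X /\ forall D, clubP X D -> exists2 a, D a & S a.

(** * First-order logic *)

(* [form ar n] is the type of first-order formulas over relation symbols of
   arity [ar], with free variables among ['I_n]; in [FAll p] the bound variable
   is [ord0] and the other variables are shifted by one. *)
Inductive form (L : Type) (ar : L -> nat) : nat -> Type :=
| FEq n (i j : 'I_n) : form ar n
| FRel n (r : L) (v : 'I_(ar r) -> 'I_n) : form ar n
| FNeg n (p : form ar n) : form ar n
| FAnd n (p q : form ar n) : form ar n
| FAll n (p : form ar n.+1) : form ar n.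

Definition scons n (x : V) (e : 'I_n -> V) : 'I_n.+1 -> V :=
  fun i => oapp e x (unlift ord0 i).

Fixpoint sat (L : Type) (ar : L -> nat)
    (D : set V) (R : forall r, ('I_(ar r) -> V) -> Prop)
    (n : nat) (p : form ar n) {struct p} : ('I_n -> V) -> Prop :=
  match p in form _ n return ('I_n -> V) -> Prop with
  | FEq _ i j => fun e => e i = e j
  | FRel _ r v => fun e => R r (fun k => e (v k))
  | FNeg _ p => fun e => ~ sat D R p e
  | FAnd _ p q => fun e => sat D R p e /\ sat D R q e
  | FAll _ p => fun e => forall x, D x -> sat D R p (scons x e)
  end.

Definition arMem (_ : unit) : nat := 2.
Definition relMem (r : unit) (v : 'I_(arMem r) -> V) : Prop :=
  v ord0 ∈ v ord_max.

(* Elementarity in the language of set theory. *)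
Definition elementary (N M : set V) : Prop :=
  N `<=` M /\
  forall n (p : form arMem n) (e : 'I_n -> V), (forall i, N (e i)) ->
    (sat N relMem p e <-> sat M relMem p e).

(** * The structure (H(omega2), ∈, pi, Y) and adequate sets *)

Variant symA := symMem | symPi | symY.
Definition arA (r : symA) : nat :=
  match r with symMem => 2 | symPi => 2 | symY => 1 end.

Definition relA (pi : V -> V) (Y : set V) (r : symA) :
    ('I_(arA r) -> V) -> Prop :=
  match r return ('I_(arA r) -> V) -> Prop with
  | symMem => fun v => v ord0 ∈ v ord_max
  | symPi => fun v => v ord0 ∈ omega2 /\ v ord_max = pi (v ord0)
  | symY => fun v => Y (v ord0)
  end.

Definition satA pi Y n (p : form arA n) (e : 'I_n -> V) : Prop :=
  sat (H omega2) (relA pi Y) p e.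

(* [F p] is a function of [n] arguments that picks a witness for the variable
   [ord0] of [p]. *)
Definition skolem_family : Type :=
  forall n, form arA n.+1 -> ('I_n -> V) -> V.

Definition definable_skolem pi Y (F : skolem_family) : Prop :=
  forall n (p : form arA n.+1),
  [/\ forall e, (forall i, H omega2 (e i)) -> H omega2 (F n p e),
      exists q : form arA n.+1,
        forall e x, (forall i, H omega2 (e i)) -> H omega2 x ->
          (satA pi Y q (scons x e) <-> x = F n p e) &
      forall e, (forall i, H omega2 (e i)) ->
        (exists2 x, H omega2 x & satA pi Y p (scons x e)) ->
        satA pi Y p (scons (F n p e) e)].

Section Adequate.
Variables (F : skolem_family) (Y : set V).

Definition skolem_closed (B : set V) : Prop :=
  forall n (p : form arA n.+1) e, (forall i, B (e i)) -> B (F p e).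
Definition Sk (a : set V) : set V := smallest skolem_closed a.

Definition clubC : set V :=
  [set b | b ∈ omega2 /\ Sk (elts b) `&` elts omega2 = elts b].

Definition Lambda : set V :=
  [set b | [/\ b ∈ omega2, has_cof b omega1 & limit_point clubC b]].

Definition calX : set V :=
  [set M | [/\ Y M, Sk (elts M) `&` elts omega2 = elts M &
               forall g, g ∈ M -> supO (clubC `&` elts g) ∈ M]].

Variable Gamma : set V.

Definition Gamma_of (M : V) : set V :=
  [set b | Gamma b /\
     forall g, Gamma g -> ~ (leO (supO (elts M `&` elts b)) g /\ g ∈ b)].

Definition largest (A : set V) : V :=
  get [set b | A b /\ forall g, A g -> leO g b].

Definition comparison_point (M N : V) : V :=
  largest (Gamma_of M `&` Gamma_of N).

Definition adequate (A : set V) : Prop :=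
  A `<=` calX /\
  forall M N, A M -> A N ->
    let b := comparison_point M N in
    let Mb := capV M (elts b) in
    let Nb := capV N (elts b) in
    [\/ Mb = Nb, Sk (elts N) Mb | Sk (elts M) Nb].

(** * The forcing poset *)

Definition Icc (g b : V) : set V := [set z | leO g z /\ leO z b].
Definition Ico (g b : V) : set V := [set z | leO g z /\ z ∈ b].

Record condition (a x A : V) : Prop := Condition {
  cond_a : finite_set (elts a) /\
    forall xi, xi ∈ a -> xi ∈ omega2 /\ has_cof xi omega;
  cond_x : finite_set (elts x) /\
    forall t, t ∈ x -> exists al g b,
      [/\ t = triple al g b, Gamma al, g ∈ b & b ∈ al];
  cond_A : finite_set (elts A) /\ adequate (elts A);
  cond_disjoint : forall al g b g' b',
    triple al g b ∈ x -> triple al g' b' ∈ x ->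
    triple al g b <> triple al g' b' -> Ico g b `&` Ico g' b' = set0;
  cond_closed : forall xi M, xi ∈ a -> M ∈ A ->
    supO (elts M `&` elts xi) = xi -> elts M `\` elts xi !=set0 -> xi ∈ M;
  cond_interval : forall M al g b, M ∈ A -> al ∈ M -> triple al g b ∈ x ->
    (elts M `&` Icc g b !=set0 -> g ∈ M /\ b ∈ M) /\
    (elts M `&` Icc g b = set0 -> supO (elts M `&` elts al) ∈ g)
}.

Definition poset : V :=
  setof [set p | exists a x A, p = triple a x A /\ condition a x A].

End Adequate.

Lemma posetE F Y Gamma : Gamma `<=` elts omega2 -> Y `<=` Pomega1 (elts omega2) ->
  elts (poset F Y Gamma) = [set p | exists a x A, p = triple a x A /\ condition F Y Gamma a x A].
Proof.
move=> G2 Y2; apply: setofP.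
have w2 := is_set_elts omega2.
have tr : transitive_class (elts omega2).
  move=> b; rewrite hartogsE => -[[tb ob] bw] c cb; split.
    split; first exact: ob.
    by move=> d dc; apply: ob; apply: tb dc.
  by apply: card_le_trans bw; apply: subset_card_le; apply: tb.
pose T := [set opair c d | c in [set opair a b | a in elts omega2 & b in elts omega2]
   & d in elts omega2].
have sT : is_set T by do 2!apply: is_set_image2 => //.
pose U := [set opair c d | c in [set opair a b |
   a in [set a | elts a `<=` elts omega2] & b in [set b | elts b `<=` T]]
   & d in [set A | elts A `<=` [set M | elts M `<=` elts omega2]]].
apply: (@is_set_sub _ U); last first.
  by apply: is_set_image2; [apply: is_set_image2|]; repeat apply: is_set_pow.
move=> p [a [x [A [-> [[_ ca] [_ cx] [_ [cA _]] _ _ _]]]]].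
exists (opair a x); last first.
  by exists A => // M /cA[/Y2[]].
exists a; first by move=> xi /ca[].
exists x => // t /cx[al [g [b [-> /G2 al2 gb bal]]]].
have b2 := tr _ al2 _ bal.
exists (opair al g); last by exists b.
by exists al => //; exists g => //; apply: tr gb.
Qed.

Definition poset_le (q p : V) : Prop :=
  exists b y B a x A, [/\ q = triple b y B, p = triple a x A &
    [/\ a ⊆ b, x ⊆ y & A ⊆ B]].

(** * Strong properness *)

Section StronglyProper.
Variables (Q : V) (le : V -> V -> Prop).

Definition dense_in (P D : set V) : Prop :=
  D `<=` P /\ forall p, P p -> exists2 d, D d & le d p.

Definition compatible (p q : V) : Prop :=
  exists r, [/\ r ∈ Q, le r p & le r q].

Definition predense_below (q : V) (D : set V) : Prop :=
  forall r, r ∈ Q -> le r q -> exists2 d, D d & compatible d r.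

Definition strongly_generic (N : set V) (q : V) : Prop :=
  forall D, dense_in (N `&` elts Q) D -> predense_below q D.

Definition strongly_proper_on_stationary : Prop :=
  exists th0, Ord th0 /\
  forall th, regular th -> leO th0 th -> elts Q `<=` H th ->
  stationaryP (H th) [set N | [/\ Pomega1 (H th) N,
    elementary (elts N) (H th) &
    forall p, p ∈ N -> p ∈ Q -> exists q,
      [/\ q ∈ Q, le q p & strongly_generic (elts N) q]]].

End StronglyProper.

(** * Names and the forcing relation *)

Section Forcing.
Variables (Q : V) (le : V -> V -> Prop).

(* A [Q]-name is a set of pairs (name, condition).  The conditions are given
   through the index type of [Q]. *)
Inductive name := Name (I : Small) (f : I -> name) (c : I -> idx Q).

Notation "q <=Q p" := (le (@el Q q) (@el Q p)) (at level 70).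

(* An element of [fprop] is a formula of the forcing language with names
   substituted for its free variables, represented by the set of conditions
   that force it. *)
Definition fprop := idx Q -> Prop.

Fixpoint feq (s t : name) {struct s} : fprop :=
  match s, t with
  | Name _ f c, Name _ g d => fun p =>
      (forall i q, q <=Q p -> q <=Q c i ->
        exists r j, [/\ r <=Q q, r <=Q d j & feq (f i) (g j) r]) /\
      (forall j q, q <=Q p -> q <=Q d j ->
        exists r i, [/\ r <=Q q, r <=Q c i & feq (f i) (g j) r])
  end.

Definition fmem (s t : name) : fprop :=
  let: Name _ g d := t in fun p =>
    forall q, q <=Q p ->
      exists r j, [/\ r <=Q q, r <=Q d j & feq s (g j) r].

Definition fnot (A : fprop) : fprop := fun p => forall q, q <=Q p -> ~ A q.
Definition fand (A B : fprop) : fprop := fun p => A p /\ B p.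
Definition fall (A : name -> fprop) : fprop := fun p => forall s, A s p.

Definition fdisj (A B : fprop) : fprop := fnot (fand (fnot A) (fnot B)).
Definition fimp (A B : fprop) : fprop := fnot (fand A (fnot B)).
Definition fiff (A B : fprop) : fprop := fand (fimp A B) (fimp B A).
Definition fex (A : name -> fprop) : fprop := fnot (fall (fun s => fnot (A s))).

Definition forced (A : fprop) : Prop := forall p, A p.

(* The check name of [x] is [{(check y, p) | y ∈ x, p ∈ Q}]. *)
Fixpoint check_tree (t : tree) : name :=
  let: Sup T f := t in
  Name (fun ip : T * idx Q => check_tree (f ip.1)) (fun ip => ip.2).
Definition check (x : V) : name := check_tree (repr x).

(* The canonical name for the generic filter. *)
Definition Gdot : name := Name (fun p => check (el p)) (fun p : idx Q => p).

Definition fsub (s t : name) : fprop :=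
  fall (fun z => fimp (fmem z s) (fmem z t)).

Definition fupair (z x y : name) : fprop :=
  fall (fun w => fiff (fmem w z) (fdisj (feq w x) (feq w y))).
Definition fpair (z x y : name) : fprop :=
  fex (fun u => fex (fun v =>
    fand (fupair u x x) (fand (fupair v x y) (fupair z u v)))).
Definition ftriple (t x y z : name) : fprop :=
  fex (fun w => fand (fpair w x y) (fpair t w z)).

Definition flimit_point (D a : name) : fprop :=
  fand (fex (fun x => fmem x a))
    (fall (fun x => fimp (fmem x a)
       (fex (fun y => fand (fmem y D) (fand (fmem x y) (fmem y a)))))).

Definition fclub (k D : name) : fprop :=
  fand (fsub D k)
  (fand (fall (fun x => fimp (fmem x k)
           (fex (fun y => fand (fmem y D) (fmem x y)))))
        (fall (fun a => fimp (fmem a k)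
           (fimp (flimit_point D a) (fmem a D))))).

Definition fstationary (k S : name) : fprop :=
  fand (fsub S k)
    (fall (fun D => fimp (fclub k D)
       (fex (fun x => fand (fmem x D) (fmem x S))))).

(* S = {xi : exists (a, x, A) in the generic filter, xi ∈ a}. *)
Definition fgeneric_set (S : name) : fprop :=
  fall (fun xi => fiff (fmem xi S)
    (fex (fun t => fand (fmem t Gdot)
       (fex (fun a => fex (fun x => fex (fun A =>
          fand (ftriple t a x A) (fmem xi a)))))))).

End Forcing.

(* Main.v *)
(** Let M = N `&` omega2 be in X for a suitable countable N, so that N `&` H(omega2)
    is Sk(M).  A condition (a, x, A) in N extends to
    q = (a `|` {sup M}, x, A `|` {M}), and q is strongly (N, P)-generic: given
    r = (b, y, B) <= q, let v0 consist of the parts of b and y in N, of the models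
    of B in N, and of the initial segments K `&` beta_{K,M} in N for K in B.  Every
    extension s of v0 in N amalgamates with r by taking unions, except that s may
    have put xi = sup (K `&` beta_{K,M}) into its first coordinate although K
    reaches beyond xi and omits it.  As r witnesses that some extension of v0 rules
    out all these finitely many xi, the closure of N yields such an extension
    inside N; below it every s amalgamates with r.

    Strong genericity of q makes q force that N[G] `&` omega2 = M, hence that
    sup M is a limit point of any club with a name in N, while sup M is in S by the
    choice of q.

    The regularity of omega2 and the absorption of countable unions by omega1 are
    derived from the stationarity of Gamma: an unbounded map from a least ordinal
    <= omega1 into omega2 would give a club of points of countable cofinality. *)
Require Import Defs.
From mathcomp Require Import all_boot.
From mathcomp Require Import boolp classical_sets functions cardinality.

Set Implicit Arguments.
Unset Strict Implicit.
Unset Printing Implicit Defensive.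

Local Open Scope classical_set_scope.
Local Open Scope card_scope.

(** * Ordinals *)

(** Two facts carry the combinatorics. For a in Y and beta in Gamma, the trace of a on beta belongs
    to Sk(beta): this is where thinness and cofinality omega1 meet, and it lets membership in a hull
    survive when the model is cut at beta. Moreover every common element or limit point of two
    models lies below their comparison point, so in the mixed cases clauses (5) and (6) need
    checking only where adequacy relates the two models.

    The obstacle on the logical side is that Gamma, hence the forcing, is not part of the structure,
    and that names form a type outside [V]; closure under the Skolem functions says nothing about
    either. Each search that the argument makes inside N is therefore turned into a finitary
    operation with countably many values, and stationarity of Y provides a countable N closed under
    all of them whose trace on omega2 is in Y. *)

Lemma countable_enum (T : Type) (C : set T) :
  countable C -> C !=set0 -> exists f : nat -> T, range f = C.
Proof.
move=> /pfcard_geP[->|[f]] [x Cx]; first by [].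
by exists f; apply/seteqP; split=> [_ [n _ <-]|y /('surj_f)[n _ <-]];
  [apply: 'funS_f | exists n].
Qed.

Lemma countable_range (T : Type) (f : nat -> T) (C : set T) :
  C `<=` range f -> countable C.
Proof.
move=> Cf; apply: card_le_trans (subset_card_le Cf) _; exact: card_image_le.
Qed.

Lemma card_range_inj (T U : Type) (f : T -> U) :
  injective f -> [set: T] #<= range f.
Proof.
by move=> fi; have /card_eqPle[] := @inj_card_eq _ _ [set: T] f (in2W fi).
Qed.

Lemma is_set_countable (C : set V) : countable C -> is_set C.
Proof.
move=> cC; have [->|/set0P C0] := eqVneq C set0.
  by exists (setof set0); apply: (@setof_sub emptyV).
have [f <-] := countable_enum cC C0.
by exists (setof (range f)); apply: (@setofE nat f).
Qed.

Lemma elts_setof_countable (C : set V) : countable C -> elts (setof C) = C.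
Proof. by move=> /is_set_countable/setofP. Qed.

Lemma mem_irr x : ~ x ∈ x.
Proof. by elim/mem_ind: x => x IH xx; exact: (IH x xx xx). Qed.

Lemma mem_asym x y : x ∈ y -> ~ y ∈ x.
Proof. by elim/mem_ind: x y => x IH y xy yx; exact: (IH y yx x yx xy). Qed.

Lemma Ord_mem a b : Ord a -> b ∈ a -> Ord b.
Proof.
move=> [ta ea] ba; split; first exact: ea.
by move=> c cb; apply: ea; apply: ta ba _ cb.
Qed.

Lemma Ord_trans a b c : Ord c -> a ∈ b -> b ∈ c -> a ∈ c.
Proof. by move=> [tc _] ab bc; apply: tc bc _ ab. Qed.

Lemma eqV x y : (forall z, z ∈ x <-> z ∈ y) -> x = y.
Proof. by move=> e; apply: elts_inj; apply/seteqP; split=> z /e. Qed.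

Lemma Ord_total a b : Ord a -> Ord b -> [\/ a ∈ b, a = b | b ∈ a].
Proof.
elim/mem_ind: a b => a IHa b oa; elim/mem_ind: b => b IHb ob.
have [[x xa nxb]|] := pselect (exists2 x, x ∈ a & ~ x ∈ b).
  case: (IHa x xa b (Ord_mem oa xa) ob) => // [<-|bx]; first by constructor 3.
  by constructor 3; apply: Ord_trans oa bx xa.
move=> /forall2NP ab.
have [[x xb nxa]|] := pselect (exists2 x, x ∈ b & ~ x ∈ a).
  case: (IHb x xb (Ord_mem ob xb)) => // [|->]; last by constructor 1.
  by move=> ax; constructor 1; apply: Ord_trans ob ax xb.
move=> /forall2NP ba; constructor 2; apply: eqV => z; split=> zz.
  by have [//|/contrapT] := ab z.
by have [//|/contrapT] := ba z.
Qed.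

Lemma Ord_leO_total a b : Ord a -> Ord b -> leO a b \/ b ∈ a.
Proof. by move=> oa /(Ord_total oa)[?|->|?]; [left; left|left; right|right]. Qed.

Lemma leO_refl a : leO a a. Proof. by right. Qed.
#[local] Hint Resolve leO_refl : core.

Lemma leO_mem a b c : Ord c -> leO a b -> b ∈ c -> a ∈ c.
Proof. by move=> oc [ab|->//]; apply: Ord_trans. Qed.

Lemma mem_leO a b c : Ord c -> a ∈ b -> leO b c -> a ∈ c.
Proof. by move=> oc ab [bc|<-//]; apply: Ord_trans bc. Qed.

Lemma leO_trans a b c : Ord c -> leO a b -> leO b c -> leO a c.
Proof. by move=> oc [ab|->//] bc; left; apply: mem_leO bc. Qed.

Lemma leO_notin a b : leO a b -> ~ b ∈ a.
Proof. by move=> [|->]; [apply: mem_asym|apply: mem_irr]. Qed.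

Lemma Ord_notin a b : Ord a -> Ord b -> ~ b ∈ a -> leO a b.
Proof. by move=> oa ob; case: (Ord_leO_total oa ob). Qed.

Lemma leO_anti a b : leO a b -> leO b a -> a = b.
Proof. by move=> [ab [/(mem_asym ab)|]|]. Qed.

Lemma leO_sub a b : Ord b -> leO a b -> a ⊆ b.
Proof. by move=> ob ab x xa; apply: mem_leO ab. Qed.

Lemma sub_leO a b : Ord a -> Ord b -> a ⊆ b -> leO a b.
Proof. by move=> oa ob ab; apply: Ord_notin => // /ab/mem_irr. Qed.

Lemma Ord_min (A : set V) : (forall a, A a -> Ord a) -> A !=set0 ->
  exists2 m, A m & forall a, A a -> leO m a.
Proof.
move=> oA [a Aa]; move: (Aa); elim/mem_ind: a Aa => a IH Aa _.
have [[b [ba Ab]]|nb] := pselect (exists b, b ∈ a /\ A b); first exact: IH ba _ _.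
exists a => // b Ab; apply: Ord_notin; [exact: oA|exact: oA|].
by move=> ba; apply: nb; exists b.
Qed.

Lemma Ord_setof (C : set V) : is_set C -> (forall a, C a -> Ord a) ->
  (forall a b, C a -> b ∈ a -> C b) -> Ord (setof C).
Proof.
move=> sC oC tC; split=> [a|a].
  by rewrite setofP // => Ca b ba; apply: tC ba.
by rewrite /mem -/(elts _ a) => aC; have := aC; rewrite -/(mem _ _) => h;
  have [] : Ord a by apply: oC; move: h; rewrite -[_ ∈ _]/(elts _ _) setofP.
Qed.

Lemma mem_setof C x : is_set C -> x ∈ setof C <-> C x.
Proof. by move=> sC; rewrite -[_ ∈ _]/(elts _ _) setofP. Qed.

Lemma mem_supO (A : set V) z : is_set A -> z ∈ supO A <-> exists2 y, A y & z ∈ y.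
Proof. by move=> sA; rewrite -[_ ∈ _]/(elts _ _) bigcupE. Qed.

Lemma Ord_supO (A : set V) : is_set A -> (forall a, A a -> Ord a) -> Ord (supO A).
Proof.
move=> sA oA; split=> [b /(mem_supO _ sA)[a Aa ba] c cb|b /(mem_supO _ sA)[a Aa ba]].
  by apply/mem_supO => //; exists a => //; apply: Ord_trans ba => //; exact: oA.
by have [] := Ord_mem (oA _ Aa) ba.
Qed.

Lemma supO_ub (A : set V) a : is_set A -> (forall a, A a -> Ord a) -> A a ->
  leO a (supO A).
Proof.
move=> sA oA Aa; apply: sub_leO; [exact: oA|exact: Ord_supO|].
by move=> x xa; apply/mem_supO => //; exists a.
Qed.

Lemma supO_lub (A : set V) b : is_set A -> (forall a, A a -> Ord a) -> Ord b ->
  (forall a, A a -> leO a b) -> leO (supO A) b.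
Proof.
move=> sA oA ob Ab; apply: sub_leO => //; first exact: Ord_supO.
by move=> x /(mem_supO _ sA)[a Aa xa]; apply: mem_leO xa (Ab _ Aa).
Qed.

Definition sucO (a : V) : V := setof [set z | z ∈ a \/ z = a].

Lemma mem_sucO a z : z ∈ sucO a <-> z ∈ a \/ z = a.
Proof.
apply: mem_setof; exists (bigcupV (elts (upair a (upair a a)))).
rewrite bigcupE; last exact: is_set_elts.
rewrite upairE.
apply/seteqP; split=> [x [y [->|->]]|x [xa|->]]; first by left.
- by rewrite -[_ ∈ _]/(elts _ _) upairE => -[]; right.
- by exists a => //; left.
- by exists (upair a a); [right|rewrite -[_ ∈ _]/(elts _ _) upairE; left].
Qed.

Lemma sucO_self a : a ∈ sucO a. Proof. by apply/mem_sucO; right. Qed.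

Lemma Ord_sucO a : Ord a -> Ord (sucO a).
Proof.
move=> oa; split=> [b /mem_sucO[ba|->] c cb|b /mem_sucO[ba|->]].
- by apply/mem_sucO; left; apply: Ord_trans cb ba.
- by apply/mem_sucO; left.
- by have [] := Ord_mem oa ba.
- by have [] := oa.
Qed.

Lemma sucO_le a b : Ord a -> Ord b -> a ∈ b -> leO (sucO a) b.
Proof.
move=> oa ob ab; apply: sub_leO => //; first exact: Ord_sucO.
by move=> x /mem_sucO[xa|->//]; apply: Ord_trans ab.
Qed.

Lemma mem_sucO_le a b : a ∈ sucO b <-> leO a b.
Proof. exact: mem_sucO. Qed.

Lemma Ord_hartogs x : Ord (hartogs x).
Proof.
have m y : y ∈ hartogs x <-> Ord y /\ elts y #<= elts x.
  by rewrite -[_ ∈ _]/(elts _ _) hartogsE.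
split=> [a /m[oa ax] b ba|a /m[[]//]].
apply/m; split; first exact: Ord_mem oa ba.
by apply: card_le_trans ax; apply: subset_card_le; case: oa => ta _; apply: ta ba.
Qed.

Lemma mem_omega2 a : a ∈ omega2 <-> Ord a /\ elts a #<= elts omega1.
Proof. by rewrite -[_ ∈ _]/(elts _ _) hartogsE. Qed.

Lemma Ord_omega2 : Ord omega2. Proof. exact: Ord_hartogs. Qed.
Lemma Ord_omega1 : Ord omega1. Proof. exact: Ord_hartogs. Qed.
#[local] Hint Resolve Ord_omega1 Ord_omega2 : core.

Lemma Ord_in2 a : a ∈ omega2 -> Ord a.
Proof. exact: Ord_mem. Qed.

Fixpoint ordV (n : nat) : V := if n is n'.+1 then sucO (ordV n') else emptyV.

Lemma mem_emptyV x : ~ x ∈ emptyV.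
Proof. by move=> /mem_class_of[[]]. Qed.

Lemma Ord_ordV n : Ord (ordV n).
Proof.
elim: n => [|n IH]; last exact: Ord_sucO.
by split=> [x /mem_emptyV|x /mem_emptyV].
Qed.

Lemma elts_sucO a : elts (sucO a) = elts a `|` [set a].
Proof. by apply/seteqP; split=> z /mem_sucO. Qed.

Lemma finite_ordV n : finite_set (elts (ordV n)).
Proof.
elim: n => [|n IH] /=; last by rewrite elts_sucO finite_setU.
by apply: (@sub_finite_set _ _ set0) => // x /mem_emptyV.
Qed.

Lemma ordV_lt m n : (m < n)%N -> ordV m ∈ ordV n.
Proof.
elim: n => // n IH; rewrite ltnS leq_eqVlt => /orP[/eqP->|/IH mn] /=.
  exact: sucO_self.
by apply/mem_sucO; left.
Qed.

Lemma ordV_inj : injective ordV.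
Proof.
move=> m n e; case: (ltngtP m n) => // /ordV_lt.
  by rewrite e => /mem_irr.
by rewrite e => /mem_irr.
Qed.

Lemma mem_ordV n x : x ∈ ordV n <-> exists2 m, (m < n)%N & x = ordV m.
Proof.
split=> [|[m mn ->]]; last exact: ordV_lt.
elim: n => [/mem_emptyV//|n IH] /mem_sucO[/IH[m mn ->]|->]; last by exists n.
by exists m => //; exact: ltnW.
Qed.

(** [omega] is given as the set of finite ordinals. An ordinal that is no numeral contains every
    numeral by induction, hence is infinite. *)
Lemma mem_omega x : x ∈ omega <-> exists n, x = ordV n.
Proof.
rewrite -[_ ∈ _]/(elts _ _) omegaE; split=> [[ox fx]|[n ->]]; last first.
  by split; [exact: Ord_ordV|exact: finite_ordV].
apply: contrapT => nx.
apply: (@infiniteP _ (elts x)).2 fx.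
pose W := range ordV.
have Wx : W `<=` elts x.
  move=> _ [n _ <-]; elim: n => [|n IH].
    case: (Ord_total (Ord_ordV 0) ox) => // [e|/mem_emptyV//].
    by case: nx; exists 0%N.
  case: (Ord_total (Ord_ordV n.+1) ox) => // [e|].
    by case: nx; exists n.+1.
  by move=> /mem_sucO[/(mem_asym IH)[]|xn]; case: nx; exists n.
apply: card_le_trans (subset_card_le Wx).
exact: card_range_inj ordV_inj.
Qed.

Lemma ordV_omega n : ordV n ∈ omega. Proof. by apply/mem_omega; exists n. Qed.

Lemma elts_omega : elts omega = range ordV.
Proof.
by apply/seteqP; split=> [x /mem_omega[n ->]|_ [n _ <-]]; [exists n|exact: ordV_omega].
Qed.

Lemma countable_omega (T : Type) (C : set T) : countable C <-> C #<= elts omega.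
Proof.
split=> cC; apply: card_le_trans cC _; rewrite elts_omega; last exact: card_image_le.
exact: card_range_inj ordV_inj.
Qed.

Lemma Ord_omega : Ord omega.
Proof.
have -> : omega = setof (elts omega) by apply: elts_inj; rewrite setofP //; exact: is_set_elts.
apply: Ord_setof; first exact: is_set_elts.
  by move=> a /mem_omega[n ->]; exact: Ord_ordV.
by move=> a b /mem_omega[n ->] /mem_ordV[m _ ->]; exact: ordV_omega.
Qed.

Lemma mem_omega1 a : a ∈ omega1 <-> Ord a /\ countable (elts a).
Proof. by rewrite -[_ ∈ _]/(elts _ _) hartogsE /= -countable_omega. Qed.

Lemma omega_in_omega1 : omega ∈ omega1.
Proof. by apply/mem_omega1; split; [exact: Ord_omega|apply/countable_omega]. Qed.

Lemma omega1_in_omega2 : omega1 ∈ omega2.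
Proof. by apply/mem_omega2. Qed.

Lemma omega_in_omega2 : omega ∈ omega2.
Proof. exact: Ord_trans omega_in_omega1 omega1_in_omega2. Qed.

(** * Cardinals *)

Lemma card_le_inj (T : Type) (U : pointedType) (A : set T) (B : set U) :
  A #<= B <-> exists f : T -> U, (forall x, A x -> B (f x)) /\
    (forall x y, A x -> A y -> f x = f y -> x = y).
Proof.
split=> [/pcard_leP/unsquash f|[f [fAB fi]]].
  exists f; split=> [x Ax|x y Ax Ay]; first exact: 'funS_f.
  by apply: 'inj_f; apply/mem_set.
apply/pcard_leP/injfunPex; exists f; first by move=> x; exact: fAB.
by move=> x y /set_mem Ax /set_mem Ay; exact: fi.
Qed.

Lemma card_le_surj (T : Type) (U : Type) (A : set T) (B : set U) (f : U -> T) :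
  (forall x, A x -> exists2 y, B y & f y = x) -> A #<= B.
Proof.
move=> fs; apply: card_le_trans (card_image_le f B).
by apply: subset_card_le => x /fs[y By <-]; exists y.
Qed.

Lemma sucO_in_omega2 a : a ∈ omega2 -> sucO a ∈ omega2.
Proof.
move=> /mem_omega2[oa ca]; apply/mem_omega2; split; first exact: Ord_sucO.
have [aw|wa] := Ord_leO_total Ord_omega oa; last first.
  have sub : omega ⊆ omega1.
    by apply: leO_sub Ord_omega1 (or_introl omega_in_omega1).
  apply: card_le_trans (subset_card_le sub); apply/countable_omega.
  move: wa => /mem_omega[n ->]; apply: finite_set_countable.
  exact: (finite_ordV n.+1).
have wa := leO_sub oa aw.
have sw x : x ∈ omega -> sucO x ∈ omega.
  by move=> /mem_omega[n ->]; exact: (ordV_omega n.+1).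
have s0 x : emptyV <> sucO x.
  by move=> e; apply: (@mem_emptyV x); rewrite e; exact: sucO_self.
have si x y : sucO x = sucO y -> x = y.
  move=> e; have := sucO_self x; rewrite e => /mem_sucO[xy|//].
  have := sucO_self y; rewrite -e => /mem_sucO[yx|//].
  by case: (mem_asym xy).
have w0 := ordV_omega 0.
(* Hilbert's hotel: the new point goes to 0, the numerals move up by one and all else stays. This
   injects the successor of an infinite [a] into [a]. *)
pose h x := if pselect (x = a) then emptyV else
  if pselect (x ∈ omega) then sucO x else x.
have hP x : [\/ x = a /\ h x = emptyV, x ∈ omega /\ h x = sucO x |
             [/\ x <> a, ~ x ∈ omega & h x = x]].
  rewrite /h; case: (pselect (x = a)) => xa; first by constructor 1.
  by case: (pselect (x ∈ omega)) => xw; [constructor 2|constructor 3].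
apply: card_le_trans ca; apply/card_le_inj; exists h.
split=> [x /mem_sucO xa|x y _ _].
  case: (hP x) => [[_ ->]|[xw ->]|[nx _ ->]]; [exact: wa|exact/wa/sw|by case: xa].
case: (hP x) => [[-> ->]|[xw ->]|[nx nxw ->]]; case: (hP y) => [[-> ->]|[yw ->]|[ny nyw ->]] //.
- by move=> /s0.
- by move=> e; case: nyw; rewrite -e.
- by move=> /esym/s0.
- exact: si.
- by move=> e; case: nyw; rewrite -e; exact: sw.
- by move=> e; case: nxw; rewrite e.
- by move=> e; case: nxw; rewrite e; exact: sw.
Qed.

(** * Order types of sets of ordinals *)

Lemma mem_wf : well_founded Defs.mem.
Proof. by move=> x; elim/mem_ind: x => x IH; constructor; exact: IH. Qed.

Section Collapse.
Variable U : set V.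

(** The Mostowski collapse: for an ordinal [x] and a class [U] of ordinals it is the order type of
    the part of [U] below [x]. *)
Definition collapse : V -> V :=
  Fix mem_wf (fun _ => V) (fun x rec =>
    setof [set z | exists y (yx : y ∈ x), U y /\ z = rec y yx]).

Lemma mem_collapse x z :
  z ∈ collapse x <-> exists y, [/\ y ∈ x, U y & z = collapse y].
Proof.
rewrite {1}/collapse Fix_eq; last first.
  move=> y f g fg; congr setof; apply/funext => w; apply/propext.
  by split=> -[v [vy [Uv ->]]]; exists v, vy; rewrite fg.
rewrite -/collapse; set C := [set _ | _].
have CE w : C w <-> exists y, [/\ y ∈ x, U y & w = collapse y].
  by split=> [[y [yx [Uy ->]]]|[y [yx Uy ->]]]; exists y => //; exists yx.
rewrite mem_setof //; exists (setof C); apply: (@setofE _ (fun i : idx x => collapse (el i))).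
by move=> w /CE[y [[i <-] _ ->]]; exists i.
Qed.

Hypothesis oU : forall x, U x -> Ord x.

Lemma collapse_lt x y : U x -> U y -> x ∈ y -> collapse x ∈ collapse y.
Proof. by move=> Ux Uy xy; apply/mem_collapse; exists x. Qed.

Lemma collapse_inj x y : U x -> U y -> collapse x = collapse y -> x = y.
Proof.
move=> Ux Uy e; case: (Ord_total (oU Ux) (oU Uy)) => // xy.
  by have := collapse_lt Ux Uy xy; rewrite e => /mem_irr.
by have := collapse_lt Uy Ux xy; rewrite e => /mem_irr.
Qed.

Lemma Ord_collapse x : U x -> Ord (collapse x).
Proof.
elim/mem_ind: x => x IH Ux; split=> [a|a] /mem_collapse[y [yx Uy ->]].
  move=> z /mem_collapse[w [wy Uw ->]]; apply/mem_collapse; exists w; split=> //.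
  by apply: Ord_trans yx => //; exact: oU.
by have [] := IH _ yx Uy.
Qed.

Lemma collapse_image : is_set U ->
  exists2 a, Ord a & elts a = collapse @` U.
Proof.
move=> [s es]; have sC : is_set (collapse @` U).
  exists (setof (collapse @` U)); apply: (@setofE _ (fun i : idx s => collapse (el i))).
  by move=> _ [x Ux <-]; move: Ux; rewrite -es => -[i <-]; exists i.
exists (setof (collapse @` U)); last exact: setofP.
apply: Ord_setof => // [_ [x Ux <-]|_ b [x Ux <-] /mem_collapse[y [yx Uy ->]]].
  exact: Ord_collapse.
by exists y.
Qed.
End Collapse.

(** The order type of [U] is an ordinal: below [omega2] it injects into [omega1], otherwise it
    includes [omega2]. This stands in for comparability of cardinals. *)
Lemma sub_omega2_dichotomy (U : set V) : U `<=` elts omega2 ->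
  U #<= elts omega1 \/ elts omega2 #<= U.
Proof.
move=> U2; have oU x : U x -> Ord x by move=> /U2; exact: Ord_in2.
have [a oa ea] := collapse_image oU (is_set_sub U2 (is_set_elts _)).
have [a2|o2a] := Ord_leO_total oa Ord_omega2; last first.
  right; apply: card_le_trans (card_image_le (collapse U) U).
  by rewrite -ea; apply: subset_card_le; apply: leO_sub => //; left.
case: a2 => [/mem_omega2[_ ca]|a2]; last first.
  right; apply: card_le_trans (card_image_le (collapse U) U).
  by rewrite -ea a2.
left; apply: card_le_trans ca; rewrite ea.
suff /card_eqPle[] : collapse U @` U #= U by [].
by apply: inj_card_eq => x y /set_mem Ux /set_mem Uy; exact: collapse_inj.
Qed.

Lemma omega2_not_le_omega1 : ~ (elts omega2 #<= elts omega1).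
Proof. by move=> c; apply: (@mem_irr omega2); apply/mem_omega2. Qed.

(** [H omega2] is defined by a strict inequality of cardinals; this turns it into the bound
    [omega1]. *)
Lemma le_omega1P (T : Type) (A : set T) :
  A #<= elts omega1 <-> A #<= elts omega2 /\ ~ (elts omega2 #<= A).
Proof.
split=> [A1|[A2 nA]].
  split; last by move=> h; apply: omega2_not_le_omega1; exact: card_le_trans A1.
  apply: card_le_trans A1 (subset_card_le _); apply: leO_sub => //.
  by left; exact: omega1_in_omega2.
move: A2 => /card_le_inj[f [fA fi]].
have /card_eqPle[e1 e2] : f @` A #= A.
  by apply: inj_card_eq => x y /set_mem Ax /set_mem Ay; exact: fi.
have [] := @sub_omega2_dichotomy (f @` A); first by move=> _ [x /fA ? <-].
  exact: card_le_trans.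
by move=> h; case: nA; exact: card_le_trans e1.
Qed.

(** An unbounded countable set, enumerated along the numerals, would be a cofinal map from
    [omega]. *)
Lemma cof_omega1_countable b (C : set V) : has_cof b omega1 -> C `<=` elts b ->
  countable C -> exists2 c, c ∈ b & forall x, C x -> x ∈ c.
Proof.
move=> [ob _ [f [fb _]] ncof] Cb cC.
have [->|/set0P C0] := eqVneq C set0.
  by exists (f omega) => //; apply: fb; exact: omega_in_omega1.
have [g gC] := countable_enum cC C0.
have gb n : g n ∈ b by apply: Cb; rewrite -gC; exists n.
have := ncof _ omega_in_omega1; pose h v := g (get [set n | v = ordV n]).
have hE n : h (ordV n) = g n.
  by rewrite /h; congr g; have /ordV_inj // := @getPex _ [set m | ordV n = ordV m]
    (ex_intro _ n erefl).
move=> nh; apply: contrapT => nC; apply: nh; exists h; split.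
  by move=> _ /mem_omega[n ->]; rewrite hE.
move=> y yb; apply: contrapT => ny; apply: nC; exists y => //.
rewrite -gC => _ [n _ <-]; case: (Ord_leO_total (Ord_mem ob yb) (Ord_mem ob (gb n))) => //.
by move=> yg; case: ny; exists (ordV n); [exact: ordV_omega|rewrite hE].
Qed.

Lemma countable_le_omega1 (T : Type) (C : set T) : countable C -> C #<= elts omega1.
Proof.
move=> /countable_omega cC; apply: card_le_trans cC (subset_card_le _).
by apply: leO_sub; [|left; exact: omega_in_omega1].
Qed.

Lemma in_omega2_trans a b : a ∈ b -> b ∈ omega2 -> a ∈ omega2.
Proof. exact: Ord_trans. Qed.

Lemma emptyV_in_omega2 : emptyV ∈ omega2.
Proof. exact: in_omega2_trans (ordV_omega 0) omega_in_omega2. Qed.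

Lemma max_omega2 a b : a ∈ omega2 -> b ∈ omega2 ->
  exists c, [/\ c ∈ omega2, leO a c & leO b c].
Proof.
move=> a2 b2; case: (Ord_leO_total (Ord_in2 a2) (Ord_in2 b2)) => [ab|ba].
  by exists b.
by exists a; split=> //; left.
Qed.

Lemma is_set_image (f : V -> V) (C : set V) : is_set C -> is_set (f @` C).
Proof.
move=> [s <-]; exists (setof (f @` elts s)).
apply: (@setofE _ (fun i : idx s => f (el i))).
by move=> _ [_ [i <-] <-]; exists i.
Qed.

(** * Regularity of omega2, countable unions, and closure properties of H(omega2) *)

Section Regular.
Variable Gamma : set V.
Hypothesis Gamma_stat : stationary omega2 Gamma.
Hypothesis Gamma_cof : forall b, Gamma b -> has_cof b omega1.

(* If [f : d -> omega2] were unbounded with [d <= omega1] least, the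
   suprema of its initial segments would form a club of ordinals of countable
   cofinality, which misses Gamma. *)
Lemma bounded_le_omega1 d f : Ord d -> leO d omega1 ->
  (forall x, x ∈ d -> f x ∈ omega2) ->
  exists2 c, c ∈ omega2 & forall x, x ∈ d -> f x ∈ c.
Proof.
elim/mem_ind: d => d IH od d1 f2; apply: contrapT => nb.
have bnd c : c ∈ omega2 -> exists2 x, x ∈ d & leO c (f x).
  move=> c2; apply: contrapT => nx; apply: nb; exists c => // x xd.
  case: (Ord_leO_total (Ord_in2 c2) (Ord_in2 (f2 _ xd))) => // cf.
  by case: nx; exists x.
have sub e x : e ∈ d -> x ∈ e -> x ∈ d by move=> ed xe; exact: Ord_trans xe ed.
have IHe e : e ∈ d -> exists2 c, c ∈ omega2 & forall x, x ∈ e -> f x ∈ c.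
  move=> ed; apply: IH => //; first exact: Ord_mem ed.
    by left; exact: mem_leO ed d1.
  by move=> x xe; apply: f2; exact: sub xe.
have lim x : x ∈ d -> sucO x ∈ d.
  move=> xd; have ox := Ord_mem od xd.
  case: (sucO_le ox od xd) => // sd; case: nb.
  have [c c2 fc] := IHe _ xd.
  have [m [m2 cm fm]] := max_omega2 c2 (f2 _ xd).
  exists (sucO m) => [|y]; first exact: sucO_in_omega2.
  have om := Ord_in2 m2.
  rewrite -sd => /mem_sucO[/fc yc|->]; apply/mem_sucO_le => //.
  by left; exact: mem_leO cm.
pose R e := [set sucO (f x) | x in elts e].
have sR e : is_set (R e) by apply/is_set_image/is_set_elts.
pose s e := supO (R e).
have f2s e x : e ∈ d -> x ∈ e -> sucO (f x) ∈ omega2.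
  by move=> ed xe; apply/sucO_in_omega2/f2; exact: sub xe.
have oR e : e ∈ d -> forall a, R e a -> Ord a.
  by move=> ed _ [x xe <-]; apply: Ord_in2; exact: f2s xe.
have s_le e c : e ∈ d -> Ord c -> (forall x, x ∈ e -> f x ∈ c) -> leO (s e) c.
  move=> ed oc fc; apply: supO_lub => //; first exact: oR.
  by move=> _ [x xe <-]; apply: sucO_le => //; [apply: Ord_in2; apply: f2; exact: sub xe|exact: fc].
have s2 e : e ∈ d -> s e ∈ omega2.
  move=> ed; have [c c2 fc] := IHe _ ed.
  by apply: leO_mem (s_le _ _ ed (Ord_in2 c2) fc) c2.
have f_s e x : e ∈ d -> x ∈ e -> f x ∈ s e.
  move=> ed xe; apply/mem_supO => //; exists (sucO (f x)); first by exists x.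
  exact: sucO_self.
have s_mono e e' : e' ∈ d -> leO e e' -> leO (s e) (s e').
  move=> ed ee; have ed' := leO_mem od ee ed.
  apply: s_le => //; first exact/Ord_in2/s2.
  by move=> x xe; apply: f_s => //; apply: mem_leO ee => //; exact: Ord_mem ed.
pose D := s @` elts d.
have clubD : club omega2 D.
  split=> [_ [e ed <-]|x x2|a a2 [[y ya] la]]; first exact: s2.
    have [y yd xy] := bnd _ x2; exists (s (sucO y)).
      by exists (sucO y) => //; exact: lim.
    apply: (leO_mem _ xy); first by apply/Ord_in2/s2/lim.
    by apply: f_s; [exact: lim|exact: sucO_self].
  have oa := Ord_in2 a2.
  (* Closure: a limit point [a] of the values of [s] is [s e0] for the least index [e0] whose value
     is not below [a]. Since the values are cofinal in [a], this [e0] is a limit ([limE]), which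
     gives that [s e0] is at most [a]. *)
  have [||e0 [e0d nse0] e0min] := @Ord_min [set e | e ∈ d /\ ~ s e ∈ a].
  - by move=> e [ed _]; exact: Ord_mem ed.
  - have [x xd ax] := bnd _ a2; exists (sucO x); split; first exact: lim.
    apply: leO_notin; apply: leO_trans ax _; first by apply/Ord_in2/s2/lim.
    by left; apply: f_s; [exact: lim|exact: sucO_self].
  have below e : e ∈ e0 -> s e ∈ a.
    move=> ee0; apply: contrapT => nsa.
    have ed : e ∈ d by exact: sub ee0.
    by apply: (leO_notin (e0min e _)) ee0.
  have [n [[e ed en] yn na]] := la _ ya.
  have limE x : x ∈ e0 -> sucO x ∈ e0.
    move=> xe0; have ox := Ord_mem (Ord_mem od e0d) xe0.
    case: (sucO_le ox (Ord_mem od e0d) xe0) => // E.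
    have [n' [[e' ed' en'] xn' na']] := la _ (below _ xe0).
    case: (Ord_leO_total (Ord_mem od e0d) (Ord_mem od ed')) => [e0e|].
      by case: nse0; apply: leO_mem oa (s_mono _ _ ed' e0e) _; rewrite en'.
    rewrite -E => /mem_sucO_le ex; exfalso.
    have xd : x ∈ d by exact: sub xe0.
    by move: (s_mono _ _ xd ex) => /leO_notin; rewrite en'; apply.
  exists e0 => //; apply: leO_anti; last first.
    by apply: Ord_notin => //; exact/Ord_in2/s2.
  apply: s_le => // x xe0.
  have sx := limE _ xe0; apply: Ord_trans (below _ sx) => //.
  by apply: f_s; [exact: sub sx|exact: sucO_self].
have [_ [e ed <-] Gs] := Gamma_stat.2 _ clubD.
have cof := Gamma_cof Gs; have ocs : Ord (s e) by case: cof.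
have [|||c cs fc] := @cof_omega1_countable (s e) (f @` elts e).
- exact: cof.
- by move=> _ [x xe <-]; exact: f_s.
- apply: card_le_trans (card_image_le _ _) _.
  by have /mem_omega1[] : e ∈ omega1 by exact: mem_leO ed d1.
suff /leO_notin : leO (s e) c by [].
apply: s_le => //; first exact: Ord_mem cs.
by move=> x xe; apply: fc; exists x.
Qed.

Lemma omega2_regular (C : set V) : C `<=` elts omega2 -> C #<= elts omega1 ->
  exists2 c, c ∈ omega2 & forall x, C x -> x ∈ c.
Proof.
move=> C2 /card_le_inj[f [fC fi]].
(* The inverse of the injection; the default [emptyV] keeps it inside [omega2] on all of
   [omega1]. *)
pose g i := if pselect (exists x, C x /\ f x = i) is left h then sval (cid h) else emptyV.
have gE x : C x -> g (f x) = x.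
  move=> Cx; rewrite /g; case: pselect => [h|nh]; last by case: nh; exists x.
  by case: cid => y /= [Cy /fi]; apply.
have [|c c2 gc] := @bounded_le_omega1 omega1 g Ord_omega1 (leO_refl _).
  move=> i _; rewrite /g; case: pselect => [h|_]; last exact: emptyV_in_omega2.
  by case: cid => y /= [/C2].
by exists c => // x Cx; rewrite -(gE _ Cx); apply/gc/fC.
Qed.

Lemma supO_omega2 (C : set V) : C `<=` elts omega2 -> countable C -> supO C ∈ omega2.
Proof.
move=> C2 cC; have [c c2 Cc] := omega2_regular C2 (countable_le_omega1 cC).
apply: leO_mem (supO_lub _ _ _ _) (c2) => //.
- exact: is_set_countable.
- by move=> a /C2; exact: Ord_in2.
- exact: Ord_in2 c2.
- by move=> a /Cc; left.
Qed.

Lemma omega1_le_tail e : e ∈ omega2 ->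
  elts omega1 #<= elts omega2 `\` elts e.
Proof.
move=> e2; have [|U1|U2] := @sub_omega2_dichotomy (elts omega2 `\` elts e).
- by move=> x [].
- have [|c c2 Uc] := omega2_regular _ U1; first by move=> x [].
  case: (Ord_leO_total (Ord_in2 e2) (Ord_in2 c2)) => [ec|ce].
    by have /mem_irr : c ∈ c by apply: Uc; split=> //; exact: leO_notin.
  by case: (mem_asym ce); apply: Uc; split=> //; exact: mem_irr.
- apply: card_le_trans U2; apply: subset_card_le; apply: leO_sub => //.
  by left; exact: omega1_in_omega2.
Qed.

(** Disjoint copies of [omega1] are laid out one after another below [omega2]: the next copy starts
    above the stage [s n], and regularity bounds it by [s n.+1]. A common bound of the stages is
    still below [omega2], so it injects back into [omega1]. *)
Lemma card_nat_omega1 : [set: nat] `*` elts omega1 #<= elts omega1.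
Proof.
have step e : exists gc : (V -> V) * V, e ∈ omega2 ->
    [/\ gc.2 ∈ omega2, leO e gc.2,
       forall i, i ∈ omega1 -> gc.1 i ∈ gc.2 /\ ~ gc.1 i ∈ e &
       forall i j, i ∈ omega1 -> j ∈ omega1 -> gc.1 i = gc.1 j -> i = j].
  have [e2|ne] := pselect (e ∈ omega2); last by exists (id, e).
  have /card_le_inj[g [gU gi]] := omega1_le_tail e2.
  have [||c c2 gc] := @omega2_regular (g @` elts omega1).
  - by move=> _ [x /gU[]] ? _ <-.
  - exact: card_image_le.
  have [m [m2 cm em]] := max_omega2 c2 e2.
  exists (g, m) => _; split=> //= i i1; split; last by case: (gU _ i1).
  by apply: mem_leO (Ord_in2 m2) (gc _ _) cm; exists i.
have {step}[gc gcP] := choice step.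
pose s n := iter n (fun e => (gc e).2) emptyV.
have s2 n : s n ∈ omega2.
  by elim: n => [|n IH]; [exact: emptyV_in_omega2|have [] := gcP _ IH].
have s_mono m n : (m <= n)%N -> leO (s m) (s n).
  elim: n => [|n IH]; first by rewrite leqn0 => /eqP->.
  rewrite leq_eqVlt => /orP[/eqP->//|/IH mn].
  by apply: leO_trans mn _; [exact: Ord_in2|have [] := gcP _ (s2 n)].
have [||c c2 sc] := @omega2_regular (range s); first by move=> _ [n _ <-]; exact: s2.
  by apply: countable_le_omega1; exact: (@countable_range _ s).
have oc := Ord_in2 c2; have /mem_omega2[_ c1] := c2.
apply: card_le_trans c1; apply/card_le_inj.
exists (fun u => (gc (s u.1)).1 u.2); split=> [[n i] [_ i1] /=|[n i] [m j] [_ /= i1] [_ /= j1] e].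
  have [_ _ /(_ _ i1)[gi _] _] := gcP _ (s2 n).
  by apply: Ord_trans oc gi (sc _ _); exists n.+1.
have nlt n' m' i' j' : i' ∈ omega1 -> j' ∈ omega1 -> (n' < m')%N ->
    (gc (s n')).1 i' <> (gc (s m')).1 j'.
  move=> i'1 j'1 /s_mono nm E.
  have [_ _ /(_ _ i'1)[gi _] _] := gcP _ (s2 n').
  have [_ _ /(_ _ j'1)[_ gj] _] := gcP _ (s2 m').
  by case: gj; rewrite -E; exact: mem_leO (Ord_in2 (s2 _)) gi nm.
case: (ltngtP n m) => nm.
- by case: (nlt _ _ _ _ i1 j1 nm).
- by case: (nlt _ _ _ _ j1 i1 nm).
- by move: e; rewrite nm => e; have [_ _ _ /(_ _ _ i1 j1 e)->] := gcP _ (s2 m).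
Qed.

Lemma card_bigcup_omega1 (T : pointedType) (F : nat -> set T) :
  (forall n, F n #<= elts omega1) -> \bigcup_n F n #<= elts omega1.
Proof.
move=> F1; apply: card_le_trans card_nat_omega1.
have /choice[f fP] : forall n, exists f : T -> V, (forall x, F n x -> f x ∈ omega1) /\
    (forall x y, F n x -> F n y -> f x = f y -> x = y).
  by move=> n; have /card_le_inj[g [g1 g2]] := F1 n; exists g.
pose i x := get [set n | F n x].
have iP x : (\bigcup_n F n) x -> F (i x) x.
  by move=> [n _ Fx]; apply: (@getPex _ [set m | F m x]); exists n.
apply/card_le_inj; exists (fun x => (i x, f (i x) x)); split=> [x /iP Fx|x y /iP Fx /iP Fy].
  by split=> //=; have [h _] := fP (i x); exact: h.
by case=> e; rewrite e in Fx *; have [_ h] := fP (i y); exact: h.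
Qed.

Lemma card_setU_omega1 (T : pointedType) (A B : set T) :
  A #<= elts omega1 -> B #<= elts omega1 -> A `|` B #<= elts omega1.
Proof.
move=> A1 B1; pose F (n : nat) := if n is 0 then A else B.
apply: card_le_trans (@card_bigcup_omega1 _ F _); last by case.
by apply: subset_card_le => x [?|?]; [exists 0%N|exists 1%N].
Qed.

(** * Transitive closures and the class H(omega2) *)

Lemma sub_trcl x : elts x `<=` trcl x.
Proof. exact: sub_gen_smallest. Qed.

Lemma trcl_min x A : transitive_class A -> elts x `<=` A -> trcl x `<=` A.
Proof. by move=> tA xA; exact: smallest_sub. Qed.

Lemma transitive_trcl x : transitive_class (trcl x).
Proof. by move=> y xy z zy A [tA xA]; apply: (tA y) => //; apply: xy. Qed.

Lemma trcl_sub y x : y ∈ x -> trcl y `<=` trcl x.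
Proof.
move=> yx; apply: trcl_min; first exact: transitive_trcl.
by apply: transitive_trcl; exact: sub_trcl.
Qed.

Lemma H2E x : H omega2 x <-> trcl x #<= elts omega1.
Proof. by rewrite le_omega1P. Qed.

Lemma H_trans x y : H omega2 x -> y ∈ x -> H omega2 y.
Proof.
move=> /H2E x1 yx; apply/H2E; apply: card_le_trans x1; apply: subset_card_le.
exact: trcl_sub.
Qed.

Lemma H_sub a x : a ∈ omega2 -> x ⊆ a -> H omega2 x.
Proof.
move=> /mem_omega2[[ta _] a1] xa; apply/H2E; apply: card_le_trans a1.
by apply: subset_card_le; exact: trcl_min.
Qed.

Lemma H_ord a : a ∈ omega2 -> H omega2 a.
Proof. by move=> a2; exact: H_sub a2 _. Qed.

(** The transitive closure is the countable union of the elements with their own closures, each part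
    of size at most [omega1]. *)
Lemma H_countable x : countable (elts x) -> (forall y, y ∈ x -> H omega2 y) ->
  H omega2 x.
Proof.
move=> cx Hx; apply/H2E.
have [e|/set0P x0] := eqVneq (elts x) set0.
  apply: countable_le_omega1; apply: (@sub_countable _ _ _ (elts x)) => //.
  by apply: subset_card_le; apply: trcl_min => //; rewrite e => y.
have [f fx] := countable_enum cx x0.
apply: card_le_trans (@card_bigcup_omega1 _ (fun n => [set f n] `|` trcl (f n)) _).
  apply: subset_card_le; apply: trcl_min => [y [n _ [->|yf]] z zy|y].
  - by exists n => //; right; exact: sub_trcl.
  - by exists n => //; right; apply: transitive_trcl zy.
  - by rewrite -fx => -[n _ <-]; exists n => //; left.
move=> n; apply: card_setU_omega1; first exact/countable_le_omega1/countable1.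
by apply/H2E/Hx; rewrite -[_ ∈ _]/(elts _ _) -fx; exists n.
Qed.

Lemma H_countable_ord x : countable (elts x) -> elts x `<=` elts omega2 -> H omega2 x.
Proof. by move=> cx x2; apply: H_countable => // y /x2; exact: H_ord. Qed.

Lemma H_finite x : finite_set (elts x) -> (forall y, y ∈ x -> H omega2 y) ->
  H omega2 x.
Proof. by move=> /finite_set_countable; exact: H_countable. Qed.

Lemma mem_upair x y z : z ∈ upair x y <-> z = x \/ z = y.
Proof. by rewrite -[_ ∈ _]/(elts _ _) upairE. Qed.

Lemma finite_upair x y : finite_set (elts (upair x y)).
Proof. by rewrite upairE; exact: finite_set2. Qed.

Lemma H_upair x y : H omega2 x -> H omega2 y -> H omega2 (upair x y).
Proof.
by move=> Hx Hy; apply: H_finite => [|z /mem_upair[->|->]] //; exact: finite_upair.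
Qed.

Lemma H_opair x y : H omega2 x -> H omega2 y -> H omega2 (opair x y).
Proof. by move=> Hx Hy; do !apply: H_upair. Qed.

Lemma H_triple x y z : H omega2 x -> H omega2 y -> H omega2 z ->
  H omega2 (triple x y z).
Proof. by move=> Hx Hy Hz; do !apply: H_opair. Qed.

End Regular.

Lemma upair_inj x y x' y' : upair x y = upair x' y' ->
  (x = x' /\ y = y') \/ (x = y' /\ y = x').
Proof.
move=> e; have m z : z = x \/ z = y <-> z = x' \/ z = y'.
  by rewrite -!mem_upair e.
have := m x; have := m y; have := m x'; have := m y'.
by intuition (subst; auto).
Qed.

Lemma opair_inj x y x' y' : opair x y = opair x' y' -> x = x' /\ y = y'.
Proof.
move=> /upair_inj[[/upair_inj e1 /upair_inj e2]|[/upair_inj e1 /upair_inj e2]];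
by intuition (subst; auto).
Qed.

Lemma triple_inj x y z x' y' z' : triple x y z = triple x' y' z' ->
  [/\ x = x', y = y' & z = z'].
Proof. by move=> /opair_inj[/opair_inj[-> ->] ->]. Qed.

(** [hartogs omega2] is omega3: an ordinal from there on injects into no set of size at most
    [omega2], which is the strict half of the definition of [H th]. *)
Lemma H_omega2_sub th : leO (hartogs omega2) th -> Ord th -> H omega2 `<=` H th.
Proof.
move=> h3 oth x [x2 _].
have o2 : omega2 ∈ th.
  apply: mem_leO h3 => //; rewrite -[_ ∈ _]/(elts _ _) hartogsE.
  by split=> //; exact: card_lexx.
split; first by apply: card_le_trans x2 (subset_card_le _); apply: leO_sub => //; left.
move=> thx; apply: (@mem_irr (hartogs omega2)).
rewrite -{1}[_ ∈ _]/(elts _ _) hartogsE; split; first exact: Ord_hartogs.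
apply: card_le_trans (card_le_trans thx x2); apply: subset_card_le.
exact: leO_sub.
Qed.

(** * Closure under finitary operations and clubs of countable sets *)

(** One operation on lists of all lengths, with a set of values, packs a whole family of finitary
    functions: the length can select the function, and countably many functions can answer at
    once. *)
Definition closed_under (f : seq V -> set V) (B : set V) : Prop :=
  forall s, (forall x, x \in s -> B x) -> f s `<=` B.

Definition hull (f : seq V -> set V) (A : set V) : set V :=
  smallest (closed_under f) A.

Definition countable_op (X : set V) (f : seq V -> set V) : Prop :=
  forall s, (forall x, x \in s -> X x) -> f s `<=` X /\ countable (f s).

Lemma hull_closed f A : closed_under f (hull f A).
Proof.
move=> s sA x fx B [cB AB]; apply: (cB s) => // y /sA; exact.
Qed.

Lemma sub_hull f A : A `<=` hull f A.
Proof. exact: sub_gen_smallest. Qed.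

Lemma hull_min f A B : closed_under f B -> A `<=` B -> hull f A `<=` B.
Proof. by move=> cB AB; exact: smallest_sub. Qed.

Lemma hull_mono f A B : A `<=` B -> hull f A `<=` hull f B.
Proof.
move=> AB; apply: hull_min; first exact: hull_closed.
exact: subset_trans AB (@sub_hull f B).
Qed.

Lemma countable_setU (T : Type) (A B : set T) :
  countable A -> countable B -> countable (A `|` B).
Proof.
move=> cA cB; pose F (b : bool) := if b then A else B.
apply: (@sub_countable _ _ _ (\bigcup_b F b)).
  by apply: subset_card_le => x [?|?]; [exists true|exists false].
by apply: bigcup_countable => [|[]].
Qed.

Lemma is_set_range (f : nat -> V) : is_set (range f).
Proof. by exists (setof (range f)); exact: (@setofE nat f). Qed.

Lemma countable_seqs (C : set V) : countable C ->
  countable [set s : seq V | forall x, x \in s -> C x].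
Proof.
move=> cC; have [->|/set0P C0] := eqVneq C set0.
  apply: (@sub_countable _ _ _ [set [::]]); last exact: countable1.
  by apply: subset_card_le => -[//|x s] sC; case: (sC x (mem_head _ _)).
have [f fC] := countable_enum cC C0.
apply: (@card_le_trans _ _ _ [set: seq nat]); last exact: countableP.
apply: (card_le_surj (f := map f)) => s sC.
elim: s sC => [|x s IH] sC; first by exists [::].
have [t _ <-] : exists2 t, [set: seq nat] t & [seq f i | i <- t] = s.
  by apply: IH => y ys; apply: sC; rewrite inE ys orbT.
have : C x by apply: sC; exact: mem_head.
by rewrite -fC => -[n _ <-]; exists (n :: t).
Qed.

Lemma chain_seq (T : nat -> set V) (s : seq V) : (forall m n, (m <= n)%N -> T m `<=` T n) ->
  (forall x : V, x \in s -> (\bigcup_n T n) x) -> exists n, forall x : V, x \in s -> T n x.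
Proof.
move=> mono; elim: s => [|x s IH] sT; first by exists 0%N.
have [|n Tn] := IH; first by move=> y ys; apply: sT; rewrite inE ys orbT.
have [m _ Tm] := sT x (mem_head _ _).
exists (maxn m n) => y; rewrite inE => /orP[/eqP->|/Tn].
  by apply: mono Tm; exact: leq_maxl.
by apply: mono; exact: leq_maxr.
Qed.

Lemma hull_countable X f A : countable_op X f -> A `<=` X -> countable A ->
  hull f A `<=` X /\ countable (hull f A).
Proof.
move=> cf AX cA; split; first by apply: hull_min => // s /cf[].
pose step B := B `|` \bigcup_(s in [set s | forall x, x \in s -> B x]) f s.
pose T n := iter n step A.
have TX n : T n `<=` X /\ countable (T n).
  elim: n => //= n [TX cT]; split.
    move=> x [/TX//|[s /= sT]].
    by have [h _] := cf s (fun y ys => TX _ (sT y ys)); exact: h.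
  apply: countable_setU => //; apply: bigcup_countable; first exact: countable_seqs.
  by move=> s /= sT; have [] := cf s (fun y ys => TX _ (sT y ys)).
apply: (@sub_countable _ _ _ (\bigcup_n T n)); last first.
  by apply: bigcup_countable => // n _; have [] := TX n.
apply: subset_card_le; apply: hull_min; last by move=> x Ax; exists 0%N.
move=> s sT x fx.
have [|n sn] := chain_seq _ sT.
  move=> m n /subnK <-; elim: (n - m)%N => // k IH; rewrite addSn.
  by apply: subset_trans IH _ => y; left.
by exists n.+1 => //; right; exists s.
Qed.

(** Elements of a hull depend on finitely many generators, so hulls commute with unions of
    increasing chains; the club in [stationary_hull] is closed for this reason. *)
Lemma hull_finitary f A x : hull f A x ->
  exists2 s : seq V, (forall y, y \in s -> A y) & hull f [set` s] x.
Proof.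
move: x; apply: hull_min => [s sP x fx|x Ax]; last first.
  exists [:: x]; first by move=> y; rewrite inE => /eqP->.
  by apply: sub_hull; exact: mem_head.
suff [t tA st] : exists2 t : seq V, (forall y, y \in t -> A y) &
    (forall y, y \in s -> hull f [set` t] y).
  by exists t => //; exact: hull_closed st _ fx.
elim: s sP {fx} => [|y s IH] sP; first by exists [::].
have [t tA st] : exists2 t : seq V, (forall y, y \in t -> A y) &
    (forall y, y \in s -> hull f [set` t] y).
  by apply: IH => z zs; apply: sP; rewrite inE zs orbT.
have [u uA uy] := sP y (mem_head _ _).
exists (u ++ t) => [z|z]; first by rewrite mem_cat => /orP[/uA|/tA].
rewrite inE => /orP[/eqP->|/st]; [move: uy|]; apply: hull_mono => w /=;
  by rewrite mem_cat => ->; rewrite ?orbT.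
Qed.

(** The operation answers a list by the elements of a member of [D] that absorbs the entries one at
    a time. Along longer and longer lists from a closed [a] these members increase and exhaust [a],
    so [a] is in [D]. *)
Lemma club_operation X D : clubP X D -> exists2 f, countable_op X f &
  forall a, Pomega1 X a -> closed_under f (elts a) -> D a.
Proof.
move=> [DX Dub Dcl].
pose nxt b x := get [set c | D c /\ b ⊆ c /\ x ∈ c].
have nxtP b x : Pomega1 X b -> X x -> [/\ D (nxt b x), b ⊆ nxt b x & x ∈ nxt b x].
  move=> [bX cb] Xx.
  have cbx : countable (elts b `|` [set x]).
    by apply: countable_setU => //; exact: countable1.
  have [|c Dc bc] := Dub (setof (elts b `|` [set x])).
    rewrite /Pomega1 /= elts_setof_countable //; split=> //.
    by move=> y [/bX|->].
  have [] := @getPex _ [set c | D c /\ b ⊆ c /\ x ∈ c].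
    exists c; split=> //; rewrite elts_setof_countable // in bc.
    by split=> [y yb|]; apply: bc; [left|right].
  by move=> ? [].
have Xe : Pomega1 X emptyV.
  split=> [x /mem_emptyV//|].
  apply: (@sub_countable _ _ _ (@set0 V)) => //.
  by apply: subset_card_le => x /mem_emptyV.
have [b0 Db0 _] := Dub _ Xe.
pose g (s : seq V) := foldr (fun x b => nxt b x) b0 s.
have gP s : (forall x, x \in s -> X x) -> D (g s).
  elim: s => //= x s IH sX.
  have [] := nxtP (g s) x => //; last by apply: sX; exact: mem_head.
  by apply/DX/IH => y ys; apply: sX; rewrite inE ys orbT.
exists (fun s => elts (g s)) => [s /gP/DX[]//|a [aX ca] fa].
have [a0|/set0P a0] := eqVneq (elts a) set0.
  have -> : a = b0; last by [].
  apply: eqV => z; split=> [|zb]; first by rewrite -[_ ∈ _]/(elts _ _) a0.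
  by apply: (fa [::]).
have [h ha] := countable_enum ca a0.
(* [foldr] absorbs the head last. With the enumeration reversed, passing from [s n] to [s n.+1] puts
   one more absorption on top of [g (s n)]. *)
pose s n := rev [seq h i | i <- iota 0 n].
have hX n : X (h n) by apply: aX; rewrite -ha; exists n.
have sS n : s n.+1 = h n :: s n.
  by rewrite /s -addn1 iotaD map_cat rev_cat.
have sX n x : x \in s n -> elts a x.
  by rewrite mem_rev => /mapP[i _ ->]; rewrite -ha; exists i.
have Dg n : D (g (s n)) by apply: gP => x /sX/aX.
have nP n := nxtP _ _ (DX _ (Dg n)) (hX n).
have <- : bigcupV (range (fun n => g (s n))) = a.
  have sr : is_set (range (fun n => g (s n))).
    exact: is_set_range.
  apply: elts_inj; rewrite bigcupE //; apply/seteqP; split=> z.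
    by move=> [_ [n _ <-] zg]; apply: (fa (s n)) => // x /sX.
  rewrite -ha => -[n _ <-]; exists (g (s n.+1)); first by exists n.+1.
  by rewrite sS; have [] := nP n.
by apply: Dcl => // n; rewrite sS /=; have [] := nP n.
Qed.

(** The countable subsets of [omega2] whose hull adds no new ordinal below [omega2] form a club, so
    one of them is in [Y]. *)
Lemma stationary_hull (Y : set V) X f :
  stationaryP (elts omega2) Y -> elts omega2 `<=` X -> countable_op X f ->
  exists M N, [/\ Y M, Pomega1 X N, elts N = hull f (elts M) &
    elts N `&` elts omega2 = elts M].
Proof.
move=> [Y2 sY] X2 cf.
pose D := [set a | Pomega1 (elts omega2) a /\
  hull f (elts a) `&` elts omega2 `<=` elts a].
have hullX a : Pomega1 (elts omega2) a ->
    hull f (elts a) `<=` X /\ countable (hull f (elts a)).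
  by move=> [a2 ca]; apply: hull_countable => //; exact: subset_trans X2.
have clD : clubP (elts omega2) D.
  split=> [a []//|a a2|a Da a_mono].
    have [hX ch] := hullX _ a2.
    have cb : countable (hull f (elts a) `&` elts omega2).
      by apply: sub_countable ch; apply: subset_card_le => x [].
    exists (setof (hull f (elts a) `&` elts omega2)); last first.
      rewrite elts_setof_countable // => x xa; split; first exact: sub_hull.
      by have [+ _] := a2; apply.
    rewrite /D /Pomega1 /= elts_setof_countable //; split=> [|x [hx x2]].
      by split=> // x [].
    split=> //; move: hx; apply: hull_min; first exact: hull_closed.
    by move=> y [].
  have E : elts (bigcupV (range a)) = \bigcup_n elts (a n).
    rewrite bigcupE; last exact: is_set_range.
    by apply/seteqP; split=> [z [_ [n _ <-] zn]|z [n _ zn]]; [exists n|exists (a n)].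
  rewrite /D /Pomega1 /= E; split; first split.
  - by move=> z [n _]; have [[+ _] _] := Da n; apply.
  - by apply: bigcup_countable => // n _; have [[]] := Da n.
  - move=> x [/hull_finitary[s sa hx] x2].
    have [|n sn] := chain_seq _ sa.
      move=> m n /subnK <-; elim: (n - m)%N => // k IH; rewrite addSn.
      exact: subset_trans IH (a_mono _).
    exists n => //; have [_ +] := Da n; apply; split=> //.
    by move: hx; exact: hull_mono.
have [M [M2 hM] YM] := sY _ clD; have [hX ch] := hullX _ M2.
exists M, (setof (hull f (elts M))); rewrite /Pomega1 /= elts_setof_countable //.
split=> //; apply/seteqP; split=> // x xM; split; first exact: sub_hull.
by have [+ _] := M2; apply.
Qed.

(** * Countability of formulas and elementary submodels *)

Section FormCountable.
Variables (L : Type) (ar : L -> nat) (sym : nat -> L).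
Hypothesis sym_surj : forall r, exists k, sym k = r.

Let sform := {n & form ar n}.
Let atom := ({n : nat & 'I_n * 'I_n}%type +
  {u : nat * nat & {ffun 'I_(ar (sym u.1)) -> 'I_u.2}})%type.

(** Trees over countably many atoms are countable, and every formula is decoded from one. [L] is a
    bare type, so relation symbols are named through their numbers under [sym]. Surjectivity is the
    aim, and ill-formed trees decode to [None]. *)
Fixpoint decode_form (t : GenTree.tree atom) : option sform :=
  match t with
  | GenTree.Leaf (inl u) => Some (Tagged (fun n => form ar n)
      (FEq ar (tagged u).1 (tagged u).2))
  | GenTree.Leaf (inr u) => Some (Tagged (fun n => form ar n)
      (FRel (fun i => tagged u i)))
  | GenTree.Node 0 [:: p] =>
      omap (fun u : sform => Tagged (fun n => form ar n) (FNeg (tagged u))) (decode_form p)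
  | GenTree.Node 1 [:: p; q] =>
      if decode_form p is Some u then
        omap (fun v : sform => Tagged (fun n => form ar n)
          (FAnd (tagged u) (tagged_as u v))) (decode_form q)
      else None
  | GenTree.Node 2 [:: p] =>
      if decode_form p is Some (existT (S n) q) then
        Some (Tagged (fun n => form ar n) (FAll q))
      else None
  | _ => None
  end.

Lemma decode_form_surj n (p : form ar n) :
  exists t, decode_form t = Some (Tagged (fun n => form ar n) p).
Proof.
elim: p => {n} [n i j|n r v|n p [t tp]|n p [t tp] q [u uq]|n p [t tp]].
- by exists (GenTree.Leaf (inl (Tagged (fun n => ('I_n * 'I_n)%type) (i, j)))).
- have [k kr] := sym_surj r; subst r.
  exists (GenTree.Leaf (inr (Tagged
    (fun u : nat * nat => {ffun 'I_(ar (sym u.1)) -> 'I_u.2})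
    ([ffun i => v i] : {ffun 'I_(ar (sym (k, n).1)) -> 'I_(k, n).2})))).
  rewrite /=; do 3 f_equal; apply/funext => i; exact: ffunE.
- by exists (GenTree.Node 0 [:: t]); rewrite /= tp.
- exists (GenTree.Node 1 [:: t; u]); rewrite /= tp uq /=.
  do 3 f_equal; exact: tagged_asE.
- by exists (GenTree.Node 2 [:: t]); rewrite /= tp.
Qed.

Lemma form_enum : exists phi : nat -> sform, forall n (p : form ar n),
  exists k, phi k = Tagged (fun n => form ar n) p.
Proof.
exists (fun k => odflt (Tagged (fun n => form ar n) (FEq ar (ord0 : 'I_1) ord0))
  (obind decode_form (unpickle k))) => n p.
have [t tp] := decode_form_surj p; exists (pickle t).
by rewrite pickleK /= tp.
Qed.

(** The Skolem functions of all formulas at once, as one operation; its values are countable because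
    the formulas are. *)
Definition form_op (G : forall n, form ar n.+1 -> ('I_n -> V) -> V) (s : seq V) :
    set V :=
  [set x | exists n p e, (forall i, e i \in s) /\ x = G n p e].

Lemma countable_form_op G s : countable (form_op G s).
Proof.
have [phi phiP] := form_enum.
pose h (u : nat * seq nat) := match phi u.1 with
  | existT (S n) p => G n p (fun i => nth emptyV s (nth 0%N u.2 i))
  | _ => emptyV end.
apply: (@card_le_trans _ _ _ [set: nat * seq nat]); last exact: countableP.
apply: (card_le_surj (f := h)) => _ [n [p [e [es ->]]]].
have [k kp] := phiP _ p.
exists (k, [seq index (e i) s | i <- enum 'I_n]) => //.
rewrite /h /= kp /=; congr G; apply/funext => i.
rewrite (nth_map i); last by rewrite size_enum_ord.
by rewrite nth_ord_enum nth_index.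
Qed.

Lemma closed_form_op G B : closed_under (form_op G) B <->
  forall n p (e : 'I_n -> V), (forall i, B (e i)) -> B (G n p e).
Proof.
split=> [cB n p e Be|cB s sB _ [n [p [e [es ->]]]]]; last first.
  by apply: cB => i; exact: sB.
apply: (cB [seq e i | i <- enum 'I_n]); first by move=> _ /mapP[i _ ->].
by exists n, p, e; split=> // i; apply: map_f; rewrite mem_enum.
Qed.
End FormCountable.

Lemma tarski_vaught (N M : set V) : N `<=` M ->
  (forall n (p : form arMem n.+1) e, (forall i, N (e i)) ->
    (exists2 x, M x & sat M relMem p (scons x e)) ->
    exists2 x, N x & sat M relMem p (scons x e)) ->
  elementary N M.
Proof.
move=> NM TV; split=> // n p; elim: p => {n} [||n p IH|n p IHp q IHq|n p IH] //= e Ne.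
- by rewrite IH.
- by rewrite IHp // IHq.
have Ns x i : N x -> N (scons x e i).
  by move=> Nx; rewrite /scons; case: unliftP => [j _|_] //=.
split=> [h x Mx|h x Nx]; last by apply/IH => [i|]; [exact: Ns|apply/h/NM].
apply: contrapT => np.
have [|y Ny ny] := TV _ (FNeg p) e Ne; first by exists x.
by apply: ny; apply/IH => [i|]; [exact: Ns|exact: h].
Qed.

(** * Definability in H(omega2) and Skolem hulls *)

Lemma scons0 n x (e : 'I_n -> V) : scons x e ord0 = x.
Proof. by rewrite /scons unlift_none. Qed.

Lemma sconsS n x (e : 'I_n -> V) i : scons x e (lift ord0 i) = e i.
Proof. by rewrite /scons liftK. Qed.

Lemma mem_capV x (A : set V) z : z ∈ capV x A <-> z ∈ x /\ A z.
Proof. by rewrite -[_ ∈ _]/(elts _ _) (@setof_sub x) // => y []. Qed.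

Lemma elts_capV x (A : set V) : elts (capV x A) = elts x `&` A.
Proof. by apply/seteqP; split=> z /mem_capV. Qed.

Lemma H_subset k x y : H k x -> y ⊆ x -> H k y.
Proof.
move=> [x1 x2] yx; have s : trcl y `<=` trcl x.
  apply: trcl_min; first exact: transitive_trcl.
  exact: subset_trans yx (@sub_trcl x).
split; first exact: card_le_trans (subset_card_le s) x1.
by move=> h; apply: x2; exact: card_le_trans h (subset_card_le s).
Qed.

Section Skolem.
Variables (pi : V -> V) (Y : set V) (F : skolem_family) (Gamma : set V).
Hypothesis pi_bij : set_bij (elts omega2) (H omega2) pi.
Hypothesis Y_sub : Y `<=` Pomega1 (elts omega2).
Hypothesis Y_thin : forall b, b ∈ omega2 ->
  [set capV a (elts b) | a in Y] #<= elts omega1.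
Hypothesis F_skolem : definable_skolem pi Y F.
Hypothesis Gamma_stat : stationary omega2 Gamma.
Hypothesis Gamma_cof : forall b, Gamma b -> has_cof b omega1.

Let Hc := H omega2.

(** Definability over the structure, as a property of relations on assignments in [Hc]. The closure
    lemmas assemble the formulas, so that no de Bruijn term is written by hand; to match [dfn_all]
    and [dfn_ex], the relations below quantify over [Hc] only. *)
Definition dfn n (R : ('I_n -> V) -> Prop) : Prop :=
  exists q : form arA n, forall e, (forall i, Hc (e i)) -> (satA pi Y q e <-> R e).

Lemma dfn_ext n (R R' : ('I_n -> V) -> Prop) :
  (forall e, (forall i, Hc (e i)) -> (R e <-> R' e)) -> dfn R -> dfn R'.
Proof. by move=> RR [q qR]; exists q => e He; rewrite qR // RR. Qed.

Lemma dfn_eq n (i j : 'I_n) : dfn (fun e => e i = e j).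
Proof. by exists (FEq arA i j). Qed.

Lemma dfn_mem n (i j : 'I_n) : dfn (fun e => e i ∈ e j).
Proof.
by exists (@FRel _ arA n symMem (fun k : 'I_2 => if k == ord0 then i else j)).
Qed.

Lemma dfn_Y n (i : 'I_n) : dfn (fun e => Y (e i)).
Proof. by exists (@FRel _ arA n symY (fun=> i)). Qed.

Lemma dfn_pi n (i j : 'I_n) : dfn (fun e => e i ∈ omega2 /\ e j = pi (e i)).
Proof.
by exists (@FRel _ arA n symPi (fun k : 'I_2 => if k == ord0 then i else j)).
Qed.

Lemma dfn_not n (R : ('I_n -> V) -> Prop) : dfn R -> dfn (fun e => ~ R e).
Proof.
by move=> [q qR]; exists (FNeg q) => e He; rewrite /satA /= -/(satA _ _ _ _) qR.
Qed.

Lemma dfn_and n (R S : ('I_n -> V) -> Prop) : dfn R -> dfn S ->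
  dfn (fun e => R e /\ S e).
Proof.
move=> [q qR] [s sS]; exists (FAnd q s) => e He.
by rewrite /satA /= -!/(satA _ _ _ _) qR // sS.
Qed.

Lemma dfn_imp n (R S : ('I_n -> V) -> Prop) : dfn R -> dfn S ->
  dfn (fun e => R e -> S e).
Proof.
move=> dR dS; apply: dfn_ext (dfn_not (dfn_and dR (dfn_not dS))) => e _.
split; last by move=> h [r ns]; exact/ns/h.
by move=> h r; apply: contrapT => ns; apply: h.
Qed.

Lemma dfn_or n (R S : ('I_n -> V) -> Prop) : dfn R -> dfn S ->
  dfn (fun e => R e \/ S e).
Proof.
move=> dR dS; apply: dfn_ext (dfn_imp (dfn_not dR) dS) => e _.
split; last by case.
by move=> h; have [r|/h] := pselect (R e); [left|right].
Qed.

Lemma dfn_iff n (R S : ('I_n -> V) -> Prop) : dfn R -> dfn S ->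
  dfn (fun e => R e <-> S e).
Proof. by move=> dR dS; exact: dfn_and (dfn_imp dR dS) (dfn_imp dS dR). Qed.

Lemma dfn_all n (R : V -> ('I_n -> V) -> Prop) :
  dfn (fun e : 'I_n.+1 -> V => R (e ord0) (fun i => e (lift ord0 i))) ->
  dfn (fun e => forall x, Hc x -> R x e).
Proof.
move=> [q qR]; exists (FAll q) => e He; rewrite /satA /=.
have E x : Hc x -> satA pi Y q (scons x e) <-> R x e.
  move=> Hx; rewrite qR; first rewrite scons0.
    have -> // : (fun i => scons x e (lift ord0 i)) = e.
    by apply/funext => i; exact: sconsS.
  by move=> i; rewrite /scons; case: unliftP => [j _|_] /=.
by split=> h x Hx; apply/(E _ Hx)/h.
Qed.

Lemma dfn_ex n (R : V -> ('I_n -> V) -> Prop) :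
  dfn (fun e : 'I_n.+1 -> V => R (e ord0) (fun i => e (lift ord0 i))) ->
  dfn (fun e => exists x, Hc x /\ R x e).
Proof.
move=> dR; have dn := dfn_not (@dfn_all n (fun x e => ~ R x e) (dfn_not dR)).
apply: dfn_ext dn => e _; split=> [h|[x [Hx Rx]] h]; last exact: h Hx Rx.
by apply: contrapT => nx; apply: h => x Hx Rx; apply: nx; exists x.
Qed.

Lemma Sk_closed B : skolem_closed F (Sk F B).
Proof. by move=> n p e Be C [cC BC]; apply: (cC) => i; exact: (Be i C). Qed.

Lemma sub_Sk B : B `<=` Sk F B.
Proof. exact: sub_gen_smallest. Qed.

Lemma Sk_min B C : skolem_closed F C -> B `<=` C -> Sk F B `<=` C.
Proof. by move=> cC BC; exact: smallest_sub. Qed.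

Lemma Sk_mono B C : B `<=` C -> Sk F B `<=` Sk F C.
Proof.
move=> BC; apply: Sk_min; first exact: Sk_closed.
exact: subset_trans BC (@sub_Sk C).
Qed.

Lemma H_skolem_closed : skolem_closed F Hc.
Proof. by move=> n p e He; have [h _ _] := F_skolem p; exact: h. Qed.

Section Hull.
Variable B : set V.
Hypothesis BH : B `<=` Hc.

Lemma Sk_H : Sk F B `<=` Hc.
Proof. exact: Sk_min H_skolem_closed BH. Qed.

(** The Skolem function of the defining formula, applied inside the hull, gives the witness. The
    closure properties of hulls below are instances with a suitable [R]. *)
Lemma Sk_wit n (R : V -> ('I_n -> V) -> Prop) e :
  dfn (fun e : 'I_n.+1 -> V => R (e ord0) (fun i => e (lift ord0 i))) ->
  (forall i, Sk F B (e i)) -> (exists2 x, Hc x & R x e) ->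
  exists2 x, Sk F B x & R x e.
Proof.
move=> [q qR] Be [x Hx Rx].
have He i : Hc (e i) by exact: Sk_H.
have [FH _ Fw] := F_skolem q.
have E y : Hc y -> satA pi Y q (scons y e) <-> R y e.
  move=> Hy; rewrite qR; first rewrite scons0.
    have -> // : (fun i => scons y e (lift ord0 i)) = e.
    by apply/funext => i; exact: sconsS.
  by move=> i; rewrite /scons; case: unliftP => [j _|_] /=.
exists (F q e); first exact: Sk_closed.
by apply/E; [exact: FH|apply: Fw => //; exists x => //; exact/E].
Qed.

Lemma Sk_wit1 (R : V -> V -> Prop) a :
  dfn (fun e : 'I_2 -> V => R (e ord0) (e (lift ord0 ord0))) ->
  Sk F B a -> (exists2 x, Hc x & R x a) -> exists2 x, Sk F B x & R x a.
Proof.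
by move=> dR Ba; exact: (@Sk_wit 1 (fun x e => R x (e ord0)) (fun=> a)).
Qed.

Lemma Sk_wit2 (R : V -> V -> V -> Prop) a b :
  dfn (fun e : 'I_3 -> V =>
    R (e ord0) (e (lift ord0 ord0)) (e (lift ord0 (lift ord0 ord0)))) ->
  Sk F B a -> Sk F B b -> (exists2 x, Hc x & R x a b) ->
  exists2 x, Sk F B x & R x a b.
Proof.
move=> dR Ba Bb.
apply: (@Sk_wit 2 (fun x e => R x (e ord0) (e (lift ord0 ord0)))
  (fun i => if i == ord0 then a else b)) => // i.
by case: ifP.
Qed.

Lemma Sk_pi i : i ∈ omega2 -> Sk F B i -> Sk F B (pi i).
Proof.
move=> i2 Bi; have [|x Bx [_ <-] //] :=
  @Sk_wit1 (fun x i => i ∈ omega2 /\ x = pi i) i (dfn_pi _ _) Bi.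
by exists (pi i) => //; have [h _ _] := pi_bij; exact: h.
Qed.

(** [pi] is definable in both directions, so a hull is the [pi]-image of its ordinals below
    [omega2]. *)
Lemma Sk_pi_inv i : i ∈ omega2 -> Sk F B (pi i) -> Sk F B i.
Proof.
move=> i2 Bi; have [|x Bx [x2 e]] :=
  @Sk_wit1 (fun x p => x ∈ omega2 /\ p = pi x) _ (dfn_pi _ _) Bi.
  by exists i => //; exact: H_ord.
suff <- : x = i by [].
by have [_ inj _] := pi_bij; apply: inj => //; exact/mem_set.
Qed.

(** The quantifier is bounded by [Hc] for definability; transitivity of [Hc] makes it the true
    successor. The later [is_] predicates follow this pattern. *)
Definition is_sucO x a := forall z, Hc z -> (z ∈ x <-> (z ∈ a \/ z = a)).

Lemma dfn_sucO n (i j : 'I_n) : dfn (fun e => is_sucO (e i) (e j)).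
Proof.
apply: dfn_all; apply: dfn_iff; first exact: dfn_mem.
by apply: dfn_or; [exact: dfn_mem|exact: dfn_eq].
Qed.

Lemma is_sucOP x a : Hc x -> Hc a -> is_sucO x a <-> x = sucO a.
Proof.
move=> Hx Ha; split=> [h|-> z _]; last exact: mem_sucO.
apply: eqV => z; rewrite mem_sucO; split=> [zx|za].
  by apply/h => //; exact: H_trans Hx zx.
by apply/h => //; case: za => [/(H_trans Ha)|->].
Qed.

Lemma Sk_sucO a : Hc (sucO a) -> Sk F B a -> Sk F B (sucO a).
Proof.
move=> Hs Ba; have Ha := Sk_H Ba.
have [|x Bx /is_sucOP <-] // := @Sk_wit1 is_sucO a (dfn_sucO _ _) Ba.
  by exists (sucO a) => // z _; exact: mem_sucO.
exact: Sk_H.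
Qed.

Lemma Sk_capV m b : Sk F B m -> Sk F B b -> Sk F B (capV m (elts b)).
Proof.
move=> Bm Bb; have Hm := Sk_H Bm.
have Hs : Hc (capV m (elts b)) by apply: H_subset Hm _ => z /mem_capV[].
have [||x Bx xE] := @Sk_wit2 (fun x m b => forall z, Hc z -> (z ∈ x <->
    (z ∈ m /\ z ∈ b))) m b _ Bm Bb.
- apply: dfn_all; apply: dfn_iff; first exact: dfn_mem.
  by apply: dfn_and; exact: dfn_mem.
- by exists (capV m (elts b)) => // z _; exact: mem_capV.
suff <- : x = capV m (elts b) by [].
apply: eqV => z; rewrite mem_capV; split=> [zx|zs].
  by apply/xE => //; exact: H_trans (Sk_H Bx) zx.
by apply/xE => //; apply: H_trans Hm _; case: zs.
Qed.

(** Thinness leaves at most [omega1] traces on [b], so by regularity their [pi]-codes are bounded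
    below [omega2]. Being such a bound is definable from [b], hence the hull contains one. *)
Lemma Sk_thin b : b ∈ omega2 -> Sk F B b ->
  exists eta, [/\ eta ∈ omega2, Sk F B eta & forall a, Y a ->
    exists2 z, z ∈ eta & capV a (elts b) = pi z].
Proof.
move=> b2 Bb.
have HY a : Y a -> Hc a.
  by move=> /Y_sub[a2 ca]; exact: (H_countable_ord Gamma_stat Gamma_cof).
(* The structure has no constant for [omega2]; being in the domain of [pi] expresses that [eta] is
   below it. *)
pose R eta b := (exists p, Hc p /\ (eta ∈ omega2 /\ p = pi eta)) /\
  forall a, Hc a -> (Y a -> exists z, Hc z /\ (z ∈ eta /\
    exists w, Hc w /\ ((z ∈ omega2 /\ w = pi z) /\
      forall u, Hc u -> (u ∈ w <-> (u ∈ a /\ u ∈ b))))).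
have piH z : z ∈ omega2 -> Hc (pi z) by move=> z2; have [h _ _] := pi_bij; exact: h.
have [||eta Beta [[_ [_ [eta2 _]]] h]] := @Sk_wit1 R b _ Bb.
- apply: dfn_and; first by apply: dfn_ex; exact: dfn_pi.
  apply: dfn_all; apply: dfn_imp; first exact: dfn_Y.
  apply: dfn_ex; apply: dfn_and; first exact: dfn_mem.
  apply: dfn_ex; apply: dfn_and; first exact: dfn_pi.
  apply: dfn_all; apply: dfn_iff; first exact: dfn_mem.
  by apply: dfn_and; exact: dfn_mem.
- pose T := [set capV a (elts b) | a in Y].
  pose Z := [set z | z ∈ omega2 /\ T (pi z)].
  have [||eta eta2 Zeta] := @omega2_regular _ Gamma_stat Gamma_cof Z.
  + by move=> z [].
  + apply: card_le_trans (Y_thin b2); apply/card_le_inj; exists pi.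
    split=> [z []//|z z' [z2 _] [z'2 _]].
    by have [_ inj _] := pi_bij; apply: inj; exact/mem_set.
  exists eta; first exact: H_ord.
  split; first by exists (pi eta); split=> //; exact: piH.
  move=> a Ha Ya; have [_ _ surj] := pi_bij.
  have [|z z2 zE] := surj (capV a (elts b)).
    by apply: H_subset Ha _ => x /mem_capV[].
  exists z; split; first exact: H_ord.
  split; first by apply: Zeta; split=> //; exists a.
  exists (pi z); split; first exact: piH.
  by split=> // u _; rewrite zE mem_capV.
exists eta; split=> // a Ya; have Ha := HY _ Ya.
have [z [Hz [zeta [w [Hw [[z2 wE] uE]]]]]] := h _ Ha Ya.
exists z => //; rewrite -wE; apply: eqV => u; rewrite mem_capV.
split=> [[ua ub]|uw]; first by apply/uE => //; exact: H_trans Ha ua.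
by apply/uE => //; exact: H_trans Hw uw.
Qed.

Definition is_emptyV x := forall z, Hc z -> ~ z ∈ x.

Lemma dfn_emptyV n (i : 'I_n) : dfn (fun e => is_emptyV (e i)).
Proof. by apply: dfn_all; apply: dfn_not; exact: dfn_mem. Qed.

Lemma is_emptyVP x : Hc x -> is_emptyV x <-> x = emptyV.
Proof.
move=> Hx; split=> [h|-> z _ /mem_emptyV//].
by apply: eqV => z; split=> [zx|/mem_emptyV//]; case: (h z) => //; exact: H_trans zx.
Qed.

Lemma Hc_omega : Hc omega. Proof. exact: H_ord omega_in_omega2. Qed.

Lemma Hc_ordV n : Hc (ordV n).
Proof. exact: H_trans Hc_omega (ordV_omega n). Qed.

Lemma Sk_ordV n : Sk F B (ordV n).
Proof.
elim: n => [|n IH] /=; last by apply: Sk_sucO => //; exact: (Hc_ordV n.+1).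
have [|||x Bx xE] := @Sk_wit 0 (fun x _ => is_emptyV x) (fun=> emptyV).
- exact: dfn_emptyV.
- by case.
- by exists emptyV; [exact: (Hc_ordV 0)|move=> z _ /mem_emptyV].
by have /(is_emptyVP (Sk_H Bx)) <- := xE.
Qed.

Definition is_inductive w :=
  (forall z, Hc z -> (is_emptyV z -> z ∈ w)) /\
  (forall x, Hc x -> (x ∈ w -> forall y, Hc y -> (is_sucO y x -> y ∈ w))).

Lemma dfn_inductive n (i : 'I_n) : dfn (fun e => is_inductive (e i)).
Proof.
apply: dfn_and.
  by apply: dfn_all; apply: dfn_imp; [exact: dfn_emptyV|exact: dfn_mem].
apply: dfn_all; apply: dfn_imp; first exact: dfn_mem.
by apply: dfn_all; apply: dfn_imp; [exact: dfn_sucO|exact: dfn_mem].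
Qed.

Lemma is_inductive_omega : is_inductive omega.
Proof.
split=> [z Hz /(is_emptyVP Hz) ->|x Hx /mem_omega[n ->] y Hy /is_sucOP-> //].
- exact: (ordV_omega 0).
- exact: (ordV_omega n.+1).
- exact: Hc_ordV.
Qed.

(** [omega] is the least inductive set, a definition without parameters. *)
Lemma Sk_omega : Sk F B omega.
Proof.
have [|||w Bw [iw minw]] := @Sk_wit 0 (fun w _ => is_inductive w /\
    forall v, Hc v -> (is_inductive v -> forall x, Hc x -> (x ∈ w -> x ∈ v)))
  (fun=> emptyV).
- apply: dfn_and; first exact: dfn_inductive.
  apply: dfn_all; apply: dfn_imp; first exact: dfn_inductive.
  by apply: dfn_all; apply: dfn_imp; exact: dfn_mem.
- by case.
- exists omega; first exact: Hc_omega.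
  split; first exact: is_inductive_omega.
  move=> v Hv [v0 vS] x _ /mem_omega[n ->]; elim: n => [|n IH].
    by apply: v0 => [|z _ /mem_emptyV//]; exact: (Hc_ordV 0).
  apply: (vS _ (Hc_ordV n) IH); first exact: (Hc_ordV n.+1).
  by apply/is_sucOP; [exact: (Hc_ordV n.+1)|exact: Hc_ordV|].
suff <- : w = omega by [].
apply: eqV => x; split=> [xw|/mem_omega[n ->]].
  apply: (minw omega Hc_omega is_inductive_omega) => //.
  exact: H_trans (Sk_H Bw) xw.
have [w0 wS] := iw; elim: n => [|n IH].
  by apply: w0 => [|z _ /mem_emptyV//]; exact: (Hc_ordV 0).
apply: (wS _ (Hc_ordV n) IH); first exact: (Hc_ordV n.+1).
by apply/is_sucOP; [exact: (Hc_ordV n.+1)|exact: Hc_ordV|].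
Qed.

Definition is_upair u x y := forall z, Hc z -> (z ∈ u <-> (z = x \/ z = y)).

Lemma dfn_upair n (i j k : 'I_n) : dfn (fun e => is_upair (e i) (e j) (e k)).
Proof.
apply: dfn_all; apply: dfn_iff; first exact: dfn_mem.
by apply: dfn_or; exact: dfn_eq.
Qed.

Lemma is_upairP u x y : Hc u -> Hc x -> Hc y -> is_upair u x y <-> u = upair x y.
Proof.
move=> Hu Hx Hy; split=> [h|-> z _]; last by rewrite mem_upair.
apply: eqV => z; rewrite mem_upair; split=> [zu|zxy].
  by apply/h => //; exact: H_trans zu.
by apply/h => //; case: zxy => ->.
Qed.

Definition is_opair p x y := exists u, Hc u /\ exists v, Hc v /\
  (is_upair u x x /\ (is_upair v x y /\ is_upair p u v)).

Lemma dfn_opair n (i j k : 'I_n) : dfn (fun e => is_opair (e i) (e j) (e k)).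
Proof.
apply: dfn_ex; apply: dfn_ex; apply: dfn_and; first exact: dfn_upair.
by apply: dfn_and; exact: dfn_upair.
Qed.

Lemma is_opairP p x y : Hc p -> Hc x -> Hc y -> is_opair p x y <-> p = opair x y.
Proof.
have HU := H_upair Gamma_stat Gamma_cof.
move=> Hp Hx Hy; split=> [[u [Hu [v [Hv [uE [vE pE]]]]]]|pE].
  move/is_upairP: uE vE pE => -> // /is_upairP-> // /is_upairP-> //; exact: HU.
rewrite pE in Hp *; have [Hxx Hxy] := (HU _ _ Hx Hx, HU _ _ Hx Hy).
exists (upair x x); split=> //; exists (upair x y); split=> //.
by split; [|split]; apply/is_upairP.
Qed.

(** The hull contains the graph of a function that covers [m] by its values on [omega]. Each numeral
    is in the hull, and so is the value there. *)
Lemma Sk_elts m : countable (elts m) -> Sk F B m -> elts m `<=` Sk F B.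
Proof.
move=> cm Bm x xm; have Hm := Sk_H Bm.
have [g gm] := countable_enum cm (ex_intro _ x xm).
have gm' n : g n ∈ m by rewrite -[_ ∈ _]/(elts _ _) -gm; exists n.
have Hg n : Hc (g n) by exact: H_trans Hm (gm' n).
pose G := setof (range (fun n => opair (ordV n) (g n))).
have mG p : p ∈ G <-> exists n, p = opair (ordV n) (g n).
  rewrite mem_setof; last exact: is_set_range.
  by split=> [[n _ <-]|[n ->]]; exists n.
have Ho x' y' := @H_opair _ Gamma_stat Gamma_cof x' y'.
pose R f m w :=
  (forall x, Hc x -> (x ∈ m -> exists n, Hc n /\ (n ∈ w /\
     exists p, Hc p /\ (p ∈ f /\ is_opair p n x)))) /\
  (forall n, Hc n -> forall x, Hc x -> forall y, Hc y ->
    forall p, Hc p -> forall q, Hc q ->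
     (p ∈ f -> (q ∈ f -> (is_opair p n x -> (is_opair q n y -> x = y))))).
have [||f Bf [fs ff]] := @Sk_wit2 R m omega _ Bm Sk_omega.
- apply: dfn_and.
    apply: dfn_all; apply: dfn_imp; first exact: dfn_mem.
    apply: dfn_ex; apply: dfn_and; first exact: dfn_mem.
    by apply: dfn_ex; apply: dfn_and; [exact: dfn_mem|exact: dfn_opair].
  do 5 apply: dfn_all.
  do 2 (apply: dfn_imp; first exact: dfn_mem).
  by do 2 (apply: dfn_imp; first exact: dfn_opair); exact: dfn_eq.
- exists G.
    apply: (H_countable Gamma_stat Gamma_cof) => [|p /mG[n ->]].
      by rewrite setofP; [exact: (@countable_range _ _ _ (@subset_refl _ _))|exact: is_set_range].
    by apply: Ho; [exact: Hc_ordV|exact: Hg].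
  split=> [y Hy ym|n Hn y Hy z Hz p Hp q Hq /mG[k ->] /mG[l ->]].
    have : elts m y by [].
    rewrite -gm => -[n _ gn]; exists (ordV n); split; first exact: Hc_ordV.
    split; first exact: ordV_omega.
    have Hp : Hc (opair (ordV n) y) by apply: Ho => //; exact: Hc_ordV.
    exists (opair (ordV n) y); split=> //; split; first by apply/mG; exists n; rewrite gn.
    by apply/is_opairP => //; exact: Hc_ordV.
  have Hk j : Hc (opair (ordV j) (g j)) by apply: Ho; [exact: Hc_ordV|exact: Hg].
  move=> /is_opairP-/(_ (Hk _) Hn Hy)/opair_inj[kn gk].
  move=> /is_opairP-/(_ (Hk _) Hn Hz)/opair_inj[ln gl].
  by rewrite -gk -gl; congr g; apply: ordV_inj; rewrite kn ln.
have Hf := Sk_H Bf; have Hx := H_trans Hm xm.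
have [n [Hn [/mem_omega[k nk] [p [Hp [pf px]]]]]] := fs _ Hx xm; subst n.
have [||y By [q [Hq [qf qy]]]] := @Sk_wit2 (fun y f n => exists p, Hc p /\
    (p ∈ f /\ is_opair p n y)) f (ordV k) _ Bf (Sk_ordV k).
- by apply: dfn_ex; apply: dfn_and; [exact: dfn_mem|exact: dfn_opair].
- by exists x => //; exists p.
by rewrite (ff _ Hn _ Hx _ (Sk_H By) _ Hp _ Hq).
Qed.

End Hull.

End Skolem.

(** * Comparison of countable models *)

Section Comparison.
Variables (pi : V -> V) (Y : set V) (F : skolem_family) (Gamma : set V).
Hypothesis pi_bij : set_bij (elts omega2) (H omega2) pi.
Hypothesis Y_sub : Y `<=` Pomega1 (elts omega2).
Hypothesis Y_thin : forall b, b ∈ omega2 ->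
  [set capV a (elts b) | a in Y] #<= elts omega1.
Hypothesis Y_initial : forall a b, Y a -> b ∈ omega2 -> Y (capV a (elts b)).
Hypothesis F_skolem : definable_skolem pi Y F.
Hypothesis Gamma_Lambda : Gamma `<=` Lambda F.
Hypothesis Gamma_stat : stationary omega2 Gamma.

Let X := calX F Y.

Lemma Gamma_cof b : Gamma b -> has_cof b omega1.
Proof. by move=> /Gamma_Lambda[]. Qed.

Lemma Gamma_in2 b : Gamma b -> b ∈ omega2.
Proof. by move=> /Gamma_Lambda[]. Qed.

Lemma Gamma_Ord b : Gamma b -> Ord b.
Proof. by move=> /Gamma_in2/Ord_in2. Qed.

Lemma ord_sub_H b : b ∈ omega2 -> elts b `<=` H omega2.
Proof. by move=> b2 x xb; apply: H_ord; exact: in_omega2_trans b2. Qed.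

(** A point of Gamma is a limit of [clubC]. Finitely many arguments below [b] lie below one [c] of
    [clubC] in [b], so every element of the hull of [b] is already in the hull of such a [c], whose
    ordinals are those below [c]. *)
Lemma Sk_Gamma b : Gamma b -> Sk F (elts b) `&` elts omega2 = elts b.
Proof.
move=> Gb; have [b2 _ [[x0 x0b] lim]] := Gamma_Lambda Gb.
have ob := Gamma_Ord Gb.
apply/seteqP; split=> [x [xb x2]|x xb]; last first.
  by split; [exact: sub_Sk|exact: in_omega2_trans b2].
pose good c := clubC F c /\ c ∈ b.
have ubnd (s : seq V) : (forall c, c \in s -> good c) ->
    exists2 c, good c & forall d, d \in s -> leO d c.
  elim: s => [_|d s IH sg].
    by have [c [Cc _ cb]] := lim _ x0b; exists c.
  have [|c [Cc cb] cs] := IH; first by move=> e es; apply: sg; rewrite inE es orbT.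
  have [Cd db] := sg _ (mem_head _ _).
  have [oc od] := (Ord_mem ob cb, Ord_mem ob db).
  case: (Ord_leO_total oc od) => cd.
    exists d => // e; rewrite inE => /orP[/eqP->//|/cs ec].
    exact: leO_trans cd.
  exists c => // e; rewrite inE => /orP[/eqP->|/cs//].
  by left.
have [c [Cc cb] xc] : exists2 c, good c & Sk F (elts c) x.
  move: x xb {x2}; apply: Sk_min => [n p e eg|x xb].
    have /choice[c cP] : forall i, exists c, good c /\ Sk F (elts c) (e i).
      by move=> i; have [c gc ec] := eg i; exists c.
    have [|d gd ds] := ubnd [seq c i | i <- enum 'I_n].
      by move=> _ /mapP[i _ ->]; have [] := cP i.
    exists d => //; apply: Sk_closed => i; have [_] := cP i; apply: Sk_mono.
    apply: leO_sub; first by case: gd => _ /(Ord_mem ob).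
    by apply: ds; apply: map_f; rewrite mem_enum.
  have [c [Cc xc cb]] := lim _ xb.
  by exists c => //; exact: sub_Sk.
apply: Ord_trans ob _ cb; have [_ E] := Cc.
by rewrite -[_ ∈ _]/(elts _ _) -E.
Qed.

(** The trace on [b] equals the trace on some [c] below [b], whose code is less than an [eta] in the
    hull of [b]. The ordinals of that hull are those below [b], so the code is below [b] as well. *)
Lemma Y_capV_Sk b a : Gamma b -> Y a -> Sk F (elts b) (capV a (elts b)).
Proof.
move=> Gb Ya; have b2 := Gamma_in2 Gb; have bH := ord_sub_H b2.
have [_ ca] := Y_sub Ya; have ob := Gamma_Ord Gb.
have [|||c cb ac] := @cof_omega1_countable b (elts a `&` elts b).
- exact: Gamma_cof.
- by move=> x [].
- by apply: sub_countable ca; apply: subset_card_le => x [].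
have c2 := in_omega2_trans cb b2.
have [eta [eta2 Beta etaP]] :=
  Sk_thin pi_bij Y_sub Y_thin F_skolem Gamma_stat Gamma_cof bH c2
    (@sub_Sk F (elts b) c cb).
have [z zeta zE] := etaP _ Ya.
have -> : capV a (elts b) = capV a (elts c).
  apply: eqV => x; rewrite !mem_capV; split=> [[xa xb]|[xa xc]]; split=> //.
    by apply: ac.
  exact: Ord_trans xc cb.
rewrite zE; apply: (Sk_pi pi_bij F_skolem bH).
  exact: in_omega2_trans zeta eta2.
apply: sub_Sk; apply: Ord_trans ob zeta _.
by rewrite -[_ ∈ _]/(elts _ _) -Sk_Gamma.
Qed.

Section Model.
Variable M : V.
Hypothesis XM : X M.

Lemma X_Y : Y M. Proof. by case: XM. Qed.

Lemma X_in2 x : x ∈ M -> x ∈ omega2.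
Proof. by case: (Y_sub X_Y) => + _; apply. Qed.

Lemma X_countable : countable (elts M).
Proof. by case: (Y_sub X_Y). Qed.

Lemma X_Ord x : x ∈ M -> Ord x.
Proof. by move=> /X_in2/Ord_in2. Qed.

Lemma X_subH : elts M `<=` H omega2.
Proof. by move=> x /X_in2; exact: H_ord. Qed.

Lemma X_H : H omega2 M.
Proof. exact: H_countable_ord Gamma_stat Gamma_cof _ X_countable X_in2. Qed.

Lemma Sk_X x : Sk F (elts M) x -> x ∈ omega2 -> x ∈ M.
Proof. by case: XM => _ E _ xM x2; rewrite -[_ ∈ _]/(elts _ _) -E. Qed.

Lemma X_sucO x : x ∈ M -> sucO x ∈ M.
Proof.
move=> xM; have s2 := sucO_in_omega2 (X_in2 xM).
by apply: Sk_X => //; apply: (Sk_sucO F_skolem X_subH (H_ord s2)); exact: sub_Sk.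
Qed.

Lemma Sk_XE x : Sk F (elts M) x <-> exists2 i, i ∈ M & x = pi i.
Proof.
split=> [xM|[i iM ->]]; last first.
  by apply: (Sk_pi pi_bij F_skolem X_subH (X_in2 iM)); exact: sub_Sk.
have [_ _ surj] := pi_bij.
have [i i2 ix] := surj _ (Sk_H F_skolem X_subH xM); exists i => //.
by apply: Sk_X => //; apply: (Sk_pi_inv pi_bij F_skolem X_subH) => //; rewrite ix.
Qed.

Lemma Sk_X_countable m : countable (elts m) -> Sk F (elts M) m ->
  elts m `<=` Sk F (elts M).
Proof. exact: (Sk_elts F_skolem Gamma_stat Gamma_cof X_subH). Qed.

Lemma Sk_X_sub K : X K -> Sk F (elts M) K -> K ⊆ M.
Proof.
move=> [YK _ _] KM x xK; have [K2 cK] := Y_sub YK.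
by apply: Sk_X; [exact: Sk_X_countable KM _ xK|exact: K2].
Qed.

(** The ordinal coding [x] is in both hulls, therefore in [M] and in [b]. *)
Lemma Sk_X_Gamma b x : Gamma b -> Sk F (elts M) x -> Sk F (elts b) x ->
  Sk F (elts M `&` elts b) x.
Proof.
move=> Gb /Sk_XE[i iM ->] bx; have i2 := X_in2 iM.
have bH := ord_sub_H (Gamma_in2 Gb).
apply: (Sk_pi pi_bij F_skolem) => //; first by move=> y [/X_subH].
apply: sub_Sk; split=> //; rewrite -Sk_Gamma //; split=> //.
exact: Sk_pi_inv pi_bij F_skolem _ _ _ i2 bx.
Qed.

Lemma X_capV b : Gamma b -> X (capV M (elts b)).
Proof.
move=> Gb; have [YM SM CM] := XM; have ob := Gamma_Ord Gb.
split; first exact: Y_initial (Gamma_in2 Gb).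
  rewrite elts_capV; apply/seteqP; split=> [x [xS x2]|x [xM xb]].
    split; first by rewrite -SM; split=> //; apply: Sk_mono xS => y [].
    by rewrite -Sk_Gamma //; split=> //; apply: Sk_mono xS => y [].
  by split; [exact: sub_Sk|exact: X_in2].
move=> g /mem_capV[gM gb]; apply/mem_capV; split; first exact: CM.
apply: leO_mem ob _ gb; have og := X_Ord gM; apply: supO_lub => //.
- by apply: is_set_sub (is_set_elts g) => x [].
- by move=> a [_ ag]; exact: Ord_mem ag.
- by move=> a [_ ag]; left.
Qed.

Definition supM b := supO (elts M `&` elts b).

Lemma mem_supM b z : z ∈ supM b <-> exists m, [/\ m ∈ M, m ∈ b & z ∈ m].
Proof.
rewrite mem_supO; last by apply: is_set_sub (is_set_elts M) => x [].
by split=> [[m [mM mb] zm]|[m [mM mb zm]]]; exists m.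
Qed.

Lemma Ord_supM b : Ord (supM b).
Proof.
apply: Ord_supO; first by apply: is_set_sub (is_set_elts M) => x [].
by move=> a [/X_Ord].
Qed.

Lemma supM_le b : Ord b -> leO (supM b) b.
Proof.
move=> ob; apply: sub_leO => //; first exact: Ord_supM.
by move=> z /mem_supM[m [_ mb zm]]; exact: Ord_trans zm mb.
Qed.

Lemma supM_lt b : Gamma b -> supM b ∈ b.
Proof.
move=> Gb; have ob := Gamma_Ord Gb.
have [|||c cb ac] := @cof_omega1_countable b (elts M `&` elts b).
- exact: Gamma_cof.
- by move=> x [].
- by apply: sub_countable X_countable; apply: subset_card_le => x [].
have oc := Ord_mem ob cb.
apply: leO_mem ob _ cb; apply: sub_leO => //; first exact: Ord_supM.
by move=> z /mem_supM[m [mM mb zm]]; apply: Ord_trans zm _ => //; exact: ac.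
Qed.

Lemma supM_in2 : supO (elts M) ∈ omega2.
Proof. exact: supO_omega2 Gamma_stat Gamma_cof _ X_in2 X_countable. Qed.

(** Elements of [M] together with limits of elements of [M] (and 0, the supremum of the empty set).
    Clause (6) concerns elements and clause (5) limits; this treats them alike. *)
Definition adh x := x ∈ M \/ supM x = x.

End Model.

(** * Existence and position of comparison points *)

Lemma Gamma_next e : e ∈ omega2 ->
  exists g, [/\ Gamma g, leO e g & forall h, Gamma h -> leO e h -> leO g h].
Proof.
move=> e2; have oe := Ord_in2 e2.
pose D := [set y | y ∈ omega2 /\ e ∈ y].
have cD : club omega2 D.
  split=> [y []//|x x2|a a2 [[y ya] la]].
    have [c [c2 xc ec]] := max_omega2 x2 e2.
    exists (sucO c); last exact/mem_sucO_le.
    by split; [exact: sucO_in_omega2|exact/mem_sucO_le].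
  have [z [[_ ez] _ za]] := la _ ya.
  by split=> //; apply: Ord_trans (Ord_in2 a2) ez za.
have [x [x2 ex] Gx] := Gamma_stat.2 _ cD.
have [||m [Gm em] mP] := @Ord_min [set g | Gamma g /\ leO e g].
- by move=> a [/Gamma_Ord].
- by exists x; split=> //; left.
by exists m; split=> // h Gh eh; apply: mP.
Qed.

Lemma Gamma_ofP M b : Gamma_of Gamma M b <-> Gamma b /\
  forall g, Gamma g -> leO (supM M b) g -> g ∈ b -> False.
Proof.
by split=> [[Gb h]|[Gb h]]; split=> // g Gg; [move=> sg gb; apply: (h g)|
  move=> [sg gb]; exact: (h g)].
Qed.

(** A point [g] of Gamma between the supremum of [M] below [b] and [b] is at most [x] by minimality
    of [b]. If [x] is in [M], its successor pushes that supremum past [x]; if [x] is a limit of [M],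
    then [g] is [x], against [supM_lt]. *)
Lemma adh_Gamma_of M x b : X M -> x ∈ omega2 -> adh M x -> Gamma b ->
  x ∈ b -> (forall h, Gamma h -> x ∈ h -> leO b h) -> Gamma_of Gamma M b.
Proof.
move=> XM x2 aM Gb xb bmin; apply/Gamma_ofP; split=> // g Gg sg gb.
have [[og ob] ox] := (Gamma_Ord Gg, Gamma_Ord Gb, Ord_in2 x2).
have gx : leO g x by apply: Ord_notin => // /(bmin _ Gg)/leO_notin.
case: aM => [xM|sx].
  have : x ∈ supM M b.
    apply/mem_supM; exists (sucO x); split; [exact: X_sucO| |exact: sucO_self].
    (* [b] is no successor of [x]: having cofinality omega1, it contains a point above [x]. *)
    case: (sucO_le ox ob xb) => // E.
    have [c cb /(_ x)] : exists2 c, c ∈ b & forall y, [set x] y -> y ∈ c.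
      apply: cof_omega1_countable; [exact: Gamma_cof|by move=> _ ->|].
      exact: countable1.
    move=> /(_ erefl) xc; move: cb; rewrite -E => /mem_sucO_le.
    by move=> /leO_notin.
  move=> /(mem_leO og)/(_ sg) xg; exact: leO_notin gx xg.
have xs : leO x (supM M b).
  apply: sub_leO => //; first exact: Ord_supM.
  move=> z; rewrite -sx => /mem_supM[m [mM mx zm]]; apply/mem_supM.
  by exists m; split=> //; apply: Ord_trans xb.
have E : g = x by apply: leO_anti => //; exact: leO_trans og xs sg.
by move: (supM_lt XM Gg); rewrite E sx => /mem_irr.
Qed.

Lemma adh_next M N x : X M -> X N -> x ∈ omega2 -> adh M x -> adh N x ->
  exists b, [/\ Gamma_of Gamma M b, Gamma_of Gamma N b & x ∈ b].
Proof.
move=> XM XN x2 aM aN.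
have [b [Gb xb bmin]] := Gamma_next (sucO_in_omega2 x2).
have xb' : x ∈ b by apply: (mem_leO (Gamma_Ord Gb) (sucO_self x)).
have bmin' h : Gamma h -> x ∈ h -> leO b h.
  move=> Gh xh; apply: bmin => //; apply: sucO_le xh; first exact: Ord_in2.
  exact: Gamma_Ord.
by exists b; split=> //; apply: adh_Gamma_of xb' bmin'.
Qed.

(** Suppose the supremum [e] of the common points is not one of them. Between any two common points
    there is an element of each model, or the smaller would lie in the interval excluded by the
    larger. So [e] is a limit of both models, and [adh_next] yields a common point above [e]. *)
Lemma comparison_exists M N : X M -> X N ->
  exists b, (Gamma_of Gamma M `&` Gamma_of Gamma N) b /\
    forall g, (Gamma_of Gamma M `&` Gamma_of Gamma N) g -> leO g b.
Proof.
move=> XM XN; set T := _ `&` _.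
have oT g : T g -> Ord g by case=> [[/Gamma_Ord]].
have [c [Gc sc _]] := Gamma_next (supM_in2 XM).
have Tc g : T g -> leO g c.
  move=> Tg; have [/Gamma_ofP[Gg h] _] := Tg.
  apply: Ord_notin; [exact: oT|exact: Gamma_Ord|] => cg.
  apply: (h c) => //; apply: sub_leO; [exact: Ord_supM|exact: Gamma_Ord|].
  move=> z /mem_supM[m [mM _ zm]]; apply: (mem_leO (Gamma_Ord Gc)) sc.
  by apply/mem_supO; [exact: is_set_elts|exists m].
have sT : is_set T.
  apply: is_set_sub (is_set_elts (sucO c)) => g /Tc gc.
  exact/mem_sucO_le.
pose e := supO T.
have ec : leO e c by apply: supO_lub => //; exact: Gamma_Ord.
have e2 : e ∈ omega2 by apply: leO_mem ec _ => //; exact: Gamma_in2.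
have oe := Ord_in2 e2.
have Te g : T g -> leO g e by exact: supO_ub.
have [Te'|nTe] := pselect (T e); first by exists e.
have adhe K : X K -> T `<=` Gamma_of Gamma K -> adh K e.
  move=> XK TK; right; apply: leO_anti; first exact: supM_le.
  apply: sub_leO => //; first exact: Ord_supM.
  have up g : T g -> exists2 h, T h & g ∈ h.
    move=> Tg; apply/(mem_supO _ sT); case: (Te _ Tg) => // ge.
    by case: nTe; rewrite -ge.
  move=> z /(mem_supO _ sT)[b Tb zb]; have [b' Tb' bb'] := up _ Tb.
  have [Gb _] := TK _ Tb.
  have /Gamma_ofP[Gb' h] := TK _ Tb'.
  have : b ∈ supM K b'.
    apply: contrapT => nb; apply: (h b) => //.
    by apply: Ord_notin => //; [exact: Ord_supM|exact: oT].
  move=> /mem_supM[m [mK mb' bm]]; apply/mem_supM; exists m; split=> //.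
    exact: mem_leO oe mb' (Te _ Tb').
  exact: Ord_trans (X_Ord XK mK) zb bm.
have [||b [bM bN eb]] := adh_next XM XN e2.
- by apply: adhe => // g [].
- by apply: adhe => // g [].
by have /leO_notin := Te b (conj bM bN).
Qed.

Let cmp := comparison_point Gamma.

Lemma cmpP M N : X M -> X N -> [/\ Gamma (cmp M N), Gamma_of Gamma M (cmp M N),
  Gamma_of Gamma N (cmp M N) &
  forall g, Gamma_of Gamma M g -> Gamma_of Gamma N g -> leO g (cmp M N)].
Proof.
move=> XM XN; have [[bM bN] bmax] := @getPex _ _ (comparison_exists XM XN).
by split=> //; [case: bM|move=> g gM gN; exact: bmax].
Qed.

Lemma cmpC M N : cmp M N = cmp N M.
Proof. by rewrite /cmp /comparison_point setIC. Qed.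

Lemma adh_cmp M N x : X M -> X N -> x ∈ omega2 -> adh M x -> adh N x ->
  x ∈ cmp M N.
Proof.
move=> XM XN x2 aM aN; have [b [bM bN xb]] := adh_next XM XN x2 aM aN.
have [Gc _ _ cmax] := cmpP XM XN.
exact: mem_leO (Gamma_Ord Gc) xb (cmax _ bM bN).
Qed.

Lemma Gamma_of_sub K N : X K -> X N -> K ⊆ N ->
  Gamma_of Gamma K `<=` Gamma_of Gamma N.
Proof.
move=> XK XN KN b /Gamma_ofP[Gb h]; apply/Gamma_ofP; split=> // g Gg sg gb.
apply: (h g) => //; apply: leO_trans sg; first exact: Gamma_Ord.
apply: sub_leO; [exact: Ord_supM|exact: Ord_supM|].
by move=> z /mem_supM[m [/KN mN mb zm]]; apply/mem_supM; exists m.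
Qed.

Lemma cmp_sub M K N : X M -> X K -> X N -> K ⊆ N -> leO (cmp M K) (cmp M N).
Proof.
move=> XM XK XN KN; have [_ _ _ cmax] := cmpP XM XN.
have [_ cM cK _] := cmpP XM XK.
by apply: cmax => //; exact: Gamma_of_sub cK.
Qed.

Lemma capV_capV M d b : Ord d -> leO b d ->
  capV (capV M (elts d)) (elts b) = capV M (elts b).
Proof.
move=> od bd; apply: eqV => z; rewrite !mem_capV; split=> [[[zM _] zb]//|[zM zb]].
by split=> //; split=> //; exact: mem_leO bd.
Qed.

(** A point above [d] is lost because [d] itself enters its excluded interval; at points up to [d]
    the cut changes no supremum. *)
Lemma Gamma_of_capV M d b : X M -> Gamma d ->
  Gamma_of Gamma (capV M (elts d)) b <-> Gamma_of Gamma M b /\ leO b d.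
Proof.
move=> XM Gd; have od := Gamma_Ord Gd.
have same c : Gamma c -> leO c d -> supM (capV M (elts d)) c = supM M c.
  move=> Gc cd; apply: eqV => z; rewrite !mem_supM.
  split=> -[m [mM mc zm]]; exists m; split=> //; first by case/mem_capV: mM.
  by apply/mem_capV; split=> //; exact: mem_leO cd.
split=> [/Gamma_ofP[Gb h]|[/Gamma_ofP[Gb h] bd]]; last first.
  by apply/Gamma_ofP; split=> // g Gg; rewrite same //; exact: h.
have bd : leO b d.
  apply: Ord_notin => //; first exact: Gamma_Ord.
  move=> db; apply: (h d) => //.
  apply: sub_leO => //; first by apply: Ord_supM; exact: X_capV.
  move=> z /mem_supM[m [/mem_capV[_ md] _ zm]]; exact: Ord_trans zm md.
by split=> //; apply/Gamma_ofP; split=> // g Gg; rewrite -same //; exact: h.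
Qed.

(** The trichotomy of adequacy with the cut as a parameter, so that it can be moved down to smaller
    points of Gamma. *)
Definition compared b M N :=
  [\/ capV M (elts b) = capV N (elts b),
      Sk F (elts N) (capV M (elts b)) | Sk F (elts M) (capV N (elts b))].

Definition adequate2 M N := compared (cmp M N) M N.

Lemma adequate2C M N : adequate2 M N -> adequate2 N M.
Proof.
by rewrite /adequate2 cmpC => -[E|?|?]; [constructor 1|constructor 3|constructor 2].
Qed.

(* Cutting [m] at [b] is cutting it at the least element of [N] above [b]. *)
Lemma Sk_X_capV N m b : X N -> countable (elts m) -> elts m `<=` elts omega2 ->
  b ∈ omega2 -> Sk F (elts N) m -> Sk F (elts N) (capV m (elts b)).
Proof.
move=> XN cm m2 b2 Nm; have ob := Ord_in2 b2.
have mN x : x ∈ m -> x ∈ N.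
  by move=> xm; apply: Sk_X => //; [exact: Sk_X_countable Nm _ xm|exact: m2].
have [[n nN bn]|no] := pselect (exists2 n, n ∈ N & leO b n).
  have [||c [cN bc] cmin] := @Ord_min [set n | n ∈ N /\ leO b n].
  - by move=> a [/(X_Ord XN)].
  - by exists n.
  have -> : capV m (elts b) = capV m (elts c).
    have oc := X_Ord XN cN.
    apply: eqV => z; rewrite !mem_capV; split=> -[zm zb]; split=> //.
      exact: mem_leO bc.
    apply: contrapT => /(Ord_notin ob (Ord_in2 (m2 _ zm))) bz.
    by apply: (leO_notin (cmin z _) zb); split=> //; exact: mN.
  by apply: (Sk_capV F_skolem (X_subH XN)) => //; exact: sub_Sk.
have -> // : capV m (elts b) = m.
apply: eqV => z; rewrite mem_capV; split=> [[]//|zm]; split=> //.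
apply: contrapT => /(Ord_notin ob (Ord_in2 (m2 _ zm))) bz.
by apply: no; exists z => //; exact: mN.
Qed.

Lemma compared_down b d M N : X M -> X N -> Gamma b -> Gamma d -> leO b d ->
  compared d M N -> compared b M N.
Proof.
move=> XM XN Gb Gd bd; have od := Gamma_Ord Gd.
have cut K L : X K -> X L -> Sk F (elts L) (capV K (elts d)) ->
    Sk F (elts L) (capV K (elts b)).
  move=> XK XL KL; rewrite -(capV_capV K od bd).
  have XK' := X_capV XK Gd.
  apply: Sk_X_capV => //; [exact: X_countable|exact: X_in2|exact: Gamma_in2].
case=> [E|/cut h|/cut h]; [constructor 1|constructor 2; exact: h|constructor 3; exact: h].
by rewrite -(capV_capV M od bd) E capV_capV.
Qed.

(** The new comparison point [b] is at most [d] and at most the old one, so the trichotomy descends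
    to [b]. When it puts the trace of [K] on [b] into the hull of [M], that trace is also in the
    hull of [b], hence in the hull of the part of [M] below [b], which the cut retains. *)
Lemma adequate2_capV M K d : X M -> X K -> Gamma d -> adequate2 M K ->
  adequate2 (capV M (elts d)) K.
Proof.
move=> XM XK Gd; have od := Gamma_Ord Gd; have XM' := X_capV XM Gd.
have [Gb bM' bK _] := cmpP XM' XK; have [Gc _ _ cmax] := cmpP XM XK.
have /(Gamma_of_capV _ XM Gd)[bM bd] := bM'.
rewrite /adequate2; set b := cmp (capV _ _) K in Gb bM bM' bK bd *.
move=> /(compared_down XM XK Gb Gc (cmax _ bM bK)).
rewrite /compared capV_capV // => -[->|?|h]; [by constructor 1|by constructor 2|].
constructor 3; have := Sk_X_Gamma XM Gb h (Y_capV_Sk Gb (X_Y XK)).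
apply: Sk_mono => x [xM xb]; apply/mem_capV; split=> //; exact: mem_leO bd.
Qed.

Lemma adequate2_Sk N K : X N -> X K -> Sk F (elts N) K -> adequate2 N K.
Proof.
move=> XN XK KN; constructor 3; have [Gb _ _ _] := cmpP XN XK.
apply: Sk_X_capV => //; [exact: X_countable|exact: X_in2|exact: Gamma_in2].
Qed.

Lemma adequate2_refl M : adequate2 M M. Proof. by constructor 1. Qed.

(** If the part of [N] below [d] is contained in [M], the trace of [K] on [b] is in the hull of [N]
    below [b], hence in that of [M]. Otherwise the trace of [M] on [d] is in the hull of [N] and the
    last hypothesis applies; cutting [M] at [d] does not move its comparison point with [K]. *)
Lemma adequate2_amalgamate M N K : X M -> X N -> X K -> Sk F (elts N) K ->
  adequate2 M N ->
  (Sk F (elts N) (capV M (elts (cmp M N))) ->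
    adequate2 (capV M (elts (cmp M N))) K) ->
  adequate2 M K.
Proof.
move=> XM XN XK KN MN M'K.
have subKN := Sk_X_sub XN XK KN.
have [Gd dM dN dmax] := cmpP XM XN; have [Gb bM bK bmax] := cmpP XM XK.
have bd := cmp_sub XM XK XN subKN.
rewrite /adequate2; set b := cmp M K in Gb bM bK bmax bd *.
rewrite /adequate2 in MN; set d := cmp M N in Gd dM dN dmax bd MN M'K *.
have od := Gamma_Ord Gd.
have from_sub : capV N (elts d) ⊆ M -> compared b M K.
  move=> NM; constructor 3.
  have h : Sk F (elts N) (capV K (elts b)).
    by apply: Sk_X_capV => //; [exact: X_countable|exact: X_in2|exact: Gamma_in2].
  have := Sk_X_Gamma XN Gb h (Y_capV_Sk Gb (X_Y XK)).
  apply: Sk_mono => x [xN xb]; apply: NM; apply/mem_capV; split=> //.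
  exact: mem_leO bd.
case: MN => [E|h|h].
- by apply: from_sub; rewrite -E => x /mem_capV[].
- have := M'K h; have -> : adequate2 (capV M (elts d)) K = compared b (capV M (elts d)) K.
    congr compared; rewrite /b /cmp /comparison_point; congr largest.
    apply/seteqP; split=> g [gM gK]; split=> //.
      by have /(Gamma_of_capV _ XM Gd)[] := gM.
    apply/(Gamma_of_capV _ XM Gd); split=> //; apply: dmax => //.
    exact: Gamma_of_sub gK.
  rewrite /compared capV_capV // => -[->|?|h']; [by constructor 1|by constructor 2|].
  by constructor 3; apply: Sk_mono h' => x /mem_capV[].
- by apply: from_sub; exact: Sk_X_sub (X_capV XN Gd) h.
Qed.

End Comparison.

(** * Strong genericity *)

Definition cupV (a b : V) : V := bigcupV (elts (upair a b)).

Lemma mem_cupV a b z : z ∈ cupV a b <-> z ∈ a \/ z ∈ b.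
Proof.
rewrite -[z ∈ cupV a b]/(elts _ _) bigcupE; last exact: is_set_elts.
split=> [[y /mem_upair[->|->]]|[za|zb]]; [by left|by right| |].
  by exists a => //; apply/mem_upair; left.
by exists b => //; apply/mem_upair; right.
Qed.

Lemma elts_cupV a b : elts (cupV a b) = elts a `|` elts b.
Proof. by apply/seteqP; split=> z /mem_cupV. Qed.

Lemma mem_set1V a z : z ∈ upair a a <-> z = a.
Proof. by rewrite mem_upair; split=> [[]|->]; tauto. Qed.

(** [M] has no largest element, so an enumeration of it is cofinal; a map from a numeral has a
    largest value and is not. *)
Lemma has_cof_supO M : countable (elts M) -> elts M !=set0 ->
  (forall x, x ∈ M -> Ord x /\ sucO x ∈ M) -> has_cof (supO (elts M)) omega.
Proof.
move=> cM M0 MS; have [g gM] := countable_enum cM M0.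
have memE z : z ∈ supO (elts M) <-> exists n, z ∈ g n.
  rewrite mem_supO; last exact: is_set_elts.
  rewrite -gM; split=> [[_ [n _ <-] zn]|[n zn]]; first by exists n.
  by exists (g n) => //; exists n.
have gM' n : g n ∈ M by rewrite -[_ ∈ _]/(elts _ _) -gM; exists n.
have os : Ord (supO (elts M)).
  by apply: Ord_supO; [exact: is_set_elts|move=> a /MS[]].
have gS n : g n ∈ supO (elts M).
  have [_ sM] := MS _ (gM' n).
  have [m _ mE] : range g (sucO (g n)) by rewrite gM.
  by apply/memE; exists m; rewrite mE; exact: sucO_self.
split=> //; first exact: Ord_omega.
  pose h v := g (get [set n | v = ordV n]).
  have hE n : h (ordV n) = g n.
    by rewrite /h; congr g; have /ordV_inj // := @getPex _ [set m | ordV n = ordV m]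
      (ex_intro _ n erefl).
  exists h; split=> [_ /mem_omega[n ->]|y /memE[n yn]]; first by rewrite hE.
  by exists (ordV n); [exact: ordV_omega|rewrite hE; left].
move=> _ /mem_omega[n ->] [f [fs fc]].
have [m ms fm] : exists2 m, m ∈ supO (elts M) & forall x, x ∈ ordV n -> leO (f x) m.
  elim: n fs {fc} => [|n IH] fs; first by exists (g 0%N) => // x /mem_emptyV.
  have [|m ms fm] := IH; first by move=> x xn; apply: fs; apply/mem_sucO; left.
  have fn := fs _ (sucO_self _).
  case: (Ord_leO_total (Ord_mem os ms) (Ord_mem os fn)) => mf.
    exists (f (ordV n)) => // x /mem_sucO[/fm xm|->//].
    by apply: leO_trans mf => //; exact: Ord_mem fn.
  by exists m => // x /mem_sucO[/fm//|->]; left.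
have /memE[k mk] := ms; have [x xn kx] := fc _ (gS k).
have ok := Ord_mem os (gS k); have om := Ord_mem os ms.
by have /leO_notin := leO_trans om kx (fm _ xn).
Qed.

Section Genericity.
Variables (pi : V -> V) (Y : set V) (F : skolem_family) (Gamma : set V).
Hypothesis pi_bij : set_bij (elts omega2) (H omega2) pi.
Hypothesis Y_sub : Y `<=` Pomega1 (elts omega2).
Hypothesis Y_thin : forall b, b ∈ omega2 ->
  [set capV a (elts b) | a in Y] #<= elts omega1.
Hypothesis Y_initial : forall a b, Y a -> b ∈ omega2 -> Y (capV a (elts b)).
Hypothesis F_skolem : definable_skolem pi Y F.
Hypothesis Gamma_Lambda : Gamma `<=` Lambda F.
Hypothesis Gamma_stat : stationary omega2 Gamma.

Let X := calX F Y.
Let P := poset F Y Gamma.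
Let cond := condition F Y Gamma.
Let S M := Sk F (elts M).
Let cof := Gamma_cof Gamma_Lambda.
Let in2 := Gamma_in2 Gamma_Lambda.

Lemma mem_poset p : p ∈ P <-> exists a x A, p = triple a x A /\ cond a x A.
Proof.
by rewrite -[_ ∈ _]/(elts _ _) posetE // => b; exact: in2.
Qed.

Lemma triple_in2 x al g b : triple al g b ∈ x -> (forall t, t ∈ x ->
    exists al g b, [/\ t = triple al g b, Gamma al, g ∈ b & b ∈ al]) ->
  [/\ Gamma al, g ∈ b, b ∈ al, g ∈ al & [/\ al ∈ omega2, g ∈ omega2 & b ∈ omega2]].
Proof.
move=> tx /(_ _ tx)[al' [g' [b' [/triple_inj[-> -> ->] Gal gb bal]]]].
have al2 := in2 Gal; have gal := Ord_trans (Ord_in2 al2) gb bal.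
by split=> //; split=> //; apply: in_omega2_trans al2.
Qed.

Lemma cond_H a x A : cond a x A -> [/\ H omega2 a, H omega2 x & H omega2 A].
Proof.
move=> c; have [[[fa a2] [fx xt]] [fA [AX _]]] := (cond_a c, cond_x c, cond_A c).
have Hf := @H_finite _ Gamma_stat cof.
split; apply: Hf => //.
- by move=> z /a2[z2 _]; exact: H_ord.
- move=> t tx; have [al [g [b [tE _ _ _]]]] := xt _ tx; rewrite tE in tx *.
  have [_ _ _ _ [al2 g2 b2]] := triple_in2 tx xt.
  by apply: (H_triple Gamma_stat cof); exact: H_ord.
- by move=> z /AX; exact: (X_H Y_sub Gamma_Lambda Gamma_stat).
Qed.

Lemma poset_H p : p ∈ P -> H omega2 p.
Proof.
by move=> /mem_poset[a [x [A [-> /cond_H[Ha Hx HA]]]]]; exact: (H_triple Gamma_stat cof).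
Qed.

(** Whatever [xi] or [al] clauses (5) and (6) test against an initial segment lies below the cut
    [d], where the segment agrees with the whole model. Adequacy survives by cutting the two models
    in turn. *)
Lemma cond_add_initial b y B B' : cond b y B -> finite_set (elts B') ->
  (forall K, K ∈ B' -> K ∈ B \/ exists L d, [/\ L ∈ B, Gamma d & K = capV L (elts d)]) ->
  cond b y B'.
Proof.
move=> [cb [fy cy] [fB [BX Bad]] c4 c5 c6] fB' BB'; split=> //.
- split=> //; split=> [K /BB'[/BX//|[L [d [/BX XL Gd ->]]]]|].
    exact: X_capV Y_initial Gamma_Lambda _ XL _ Gd.
  move=> K K' KB K'B; suff : adequate2 F Gamma K K' by [].
  have cut L L' : X L -> X L' -> adequate2 F Gamma L L' -> forall d, Gamma d ->
      adequate2 F Gamma (capV L (elts d)) L'.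
    move=> XL XL' LL' d Gd.
    exact: (adequate2_capV pi_bij Y_sub Y_thin Y_initial F_skolem Gamma_Lambda Gamma_stat).
  have Xc L d : X L -> Gamma d -> X (capV L (elts d)).
    by move=> XL Gd; exact: X_capV Y_initial Gamma_Lambda _ XL _ Gd.
  have base L : L ∈ B -> forall K', K' ∈ B' -> adequate2 F Gamma L K'.
    move=> LB K2 /BB'[K2B|[L' [d [L'B Gd ->]]]]; first exact: Bad.
    apply: adequate2C; apply: cut => //; [exact: BX|exact: BX|exact: Bad].
  have XK' : X K'.
    by have [/BX//|[L' [d [/BX XL Gd ->]]]] := BB' _ K'B; exact: Xc.
  have [KB'|[L [d [LB Gd ->]]]] := BB' _ KB; first exact: base.
  by apply: cut => //; [exact: BX|exact: base].
- move=> xi K xib /BB'[KB|[L [d [LB Gd ->]]]]; first exact: c5.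
  have od := Ord_in2 (in2 Gd); have oxi : Ord xi by have [/Ord_in2] := cb.2 _ xib.
  rewrite elts_capV => sx [k [[kL kd] nk]].
  have xid : xi ∈ d.
    by apply: (leO_mem od (Ord_notin oxi _ nk) kd); exact: Ord_mem kd.
  apply/mem_capV; split=> //; apply: (c5 _ _ xib LB); last by exists k.
  rewrite -[RHS]sx; congr supO; apply/seteqP; split=> z [] => [zL zxi|[zL zd] zxi//].
  by split=> //; split=> //; exact: Ord_trans xid.
- move=> K al g be /BB'[KB|[L [d [LB Gd ->]]]]; first exact: c6.
  move=> /mem_capV[alL ald] ty; have od := Ord_in2 (in2 Gd).
  have [Gal gb bal gal _] := triple_in2 ty cy; have oal := Ord_in2 (in2 Gal).
  have cut z : z ∈ al -> z ∈ d by move=> zal; exact: Ord_trans ald.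
  have E : elts (capV L (elts d)) `&` Icc g be = elts L `&` Icc g be.
    rewrite elts_capV; apply/seteqP; split=> z [] => [[zL zd] zi//|zL zi].
    by split=> //; split=> //; case: zi => _ zb; apply: cut; exact: leO_mem bal.
  have E' : elts (capV L (elts d)) `&` elts al = elts L `&` elts al.
    rewrite elts_capV; apply/seteqP; split=> z [] => [[zL zd] zi//|zL zi].
    by split=> //; split=> //; exact: cut.
  rewrite E E'; have [h1 h2] := c6 _ _ _ _ LB alL ty; split=> // /h1[gL bL].
  by split; apply/mem_capV; split=> //; exact: cut.
Qed.

(* By clause (5), no condition whose side conditions include [A] has [xi] in
   its first coordinate. *)
Definition forbids (A : V) (xi : V) : Prop := exists K, [/\ K ∈ A,
  supO (elts K `&` elts xi) = xi, elts K `\` elts xi !=set0 & ~ xi ∈ K].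

(** [(a, x, A)] is a mere lower bound: it will be the trace of a condition on a model, which is in
    the hull even if the condition is not. *)
Definition forbidding (a x A Xi b y B : V) : Prop :=
  [/\ cond b y B, a ⊆ b, x ⊆ y, A ⊆ B & forall xi, xi ∈ Xi -> forbids B xi].

(** What amalgamation asks of N, expressed through M alone. The last field is a single instance of
    reflection; it mentions Gamma, so closure under the Skolem functions does not provide it. *)
Record good (M : V) : Prop := Good {
  good_X : X M;
  good_finite : forall C : set V, finite_set C -> C `<=` S M -> S M (setof C);
  good_forbidding : forall a x A Xi, S M a -> S M x -> S M A -> S M Xi ->
    (exists b y B, forbidding a x A Xi b y B) ->
    exists b y B, [/\ S M b, S M y, S M B & forbidding a x A Xi b y B]
}.

Section GoodModel.
Variable M : V.
Hypothesis gM : good M.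
Let XM := good_X gM.

Lemma S_elts z m : S M m -> countable (elts m) -> z ∈ m -> S M z.
Proof.
move=> Sm cm; exact: (Sk_X_countable Y_sub F_skolem Gamma_Lambda Gamma_stat XM cm Sm).
Qed.

Lemma S_in z : S M z -> z ∈ omega2 -> z ∈ M.
Proof. exact: (Sk_X XM). Qed.

Lemma S_upair x y : S M (upair x y) <-> S M x /\ S M y.
Proof.
split=> [Su|[Sx Sy]].
  have cu := finite_set_countable (finite_upair x y).
  by split; apply: (S_elts Su cu); apply/mem_upair; [left|right].
apply: (good_finite gM); first exact: finite_set2.
by move=> z [->|->].
Qed.

Lemma S_opair x y : S M (opair x y) <-> S M x /\ S M y.
Proof. by rewrite !S_upair; tauto. Qed.

Lemma S_triple x y z : S M (triple x y z) <-> [/\ S M x, S M y & S M z].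
Proof. by rewrite !S_opair; split=> [[[]]|[]]. Qed.

Lemma S_elts_finite z m : S M m -> finite_set (elts m) -> z ∈ m -> S M z.
Proof. by move=> Sm /finite_set_countable; exact: S_elts. Qed.

Lemma S_model K : S M K -> X K -> K ⊆ M.
Proof. by move=> SK XK; exact: (Sk_X_sub Y_sub F_skolem Gamma_Lambda Gamma_stat XM XK). Qed.

Lemma good_nonempty : elts M !=set0.
Proof.
have : S M emptyV.
  have -> : emptyV = setof (@set0 V).
    apply: eqV => z; rewrite mem_setof; last by exists emptyV; apply/seteqP; split=> w // /mem_emptyV.
    by split=> // /mem_emptyV.
  by apply: (good_finite gM).
by move=> /S_in/(_ emptyV_in_omega2) h; exists emptyV.
Qed.

Lemma good_sup_lt m : m ∈ M -> m ∈ supO (elts M).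
Proof.
move=> mM; apply/mem_supO; first exact: is_set_elts.
exists (sucO m); last exact: sucO_self.
exact: (X_sucO Y_sub F_skolem XM).
Qed.

Lemma good_triple x al g b : S M x -> finite_set (elts x) -> triple al g b ∈ x ->
  (forall t, t ∈ x -> exists al g b,
    [/\ t = triple al g b, Gamma al, g ∈ b & b ∈ al]) ->
  [/\ al ∈ M, g ∈ M & b ∈ M].
Proof.
move=> Sx fx tx xt; have /S_triple[Sal Sg Sb] := S_elts_finite Sx fx tx.
by have [_ _ _ _ [al2 g2 b2]] := triple_in2 tx xt; split; exact: S_in.
Qed.

(** Each [K] in [A] is in the hull of [M], which gives adequacy, and is contained in [M], so no
    model reaches the new point [supO (elts M)] and clause (5) is vacuous there. In clause (6) the
    endpoints are in [M], so [M] does meet the interval. *)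
Lemma cond_add_model a x A : cond a x A -> S M a -> S M x -> S M A ->
  cond (cupV a (upair (supO (elts M)) (supO (elts M)))) x (cupV A (upair M M)).
Proof.
move=> [[fa ca] [fx cx] [fA [AX Aad]] c4 c5 c6] Sa Sx SA.
have SK K : K ∈ A -> S M K by move=> KA; exact: S_elts_finite SA fA KA.
split=> //.
- rewrite elts_cupV finite_setU; split; first by split=> //; exact: finite_upair.
  move=> xi /mem_cupV[/ca//|/mem_set1V->]; split.
    exact: (supM_in2 Y_sub Gamma_Lambda Gamma_stat XM).
  apply: has_cof_supO; [exact: (X_countable Y_sub XM)|exact: good_nonempty|].
  move=> z zM; split; first exact: (X_Ord Y_sub XM zM).
  exact: (X_sucO Y_sub F_skolem XM).
- rewrite elts_cupV finite_setU; split; first by split=> //; exact: finite_upair.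
  split=> [K [/AX//|/mem_set1V->//]|K L KA LA].
  suff : adequate2 F Gamma K L by [].
  have ad K' : K' ∈ A -> adequate2 F Gamma M K'.
    move=> K'A.
    exact: (adequate2_Sk Y_sub F_skolem Gamma_Lambda Gamma_stat XM (AX _ K'A) (SK _ K'A)).
  case: KA => [KA|/mem_set1V->]; case: LA => [LA|/mem_set1V->].
  + exact: Aad.
  + exact/adequate2C/ad.
  + exact: ad.
  + exact: adequate2_refl.
- move=> xi K /mem_cupV[xia|/mem_set1V->] /mem_cupV[KA|/mem_set1V->].
  + exact: c5.
  + by move=> _ _; apply: S_in (ca _ xia).1; exact: S_elts_finite Sa fa xia.
  + move=> _ [k [kK]]; case; apply: good_sup_lt.
    exact: (S_model (SK _ KA) (AX _ KA)).
  + by move=> _ [k [kK]]; case; exact: good_sup_lt.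
- move=> K al g b /mem_cupV[KA|/mem_set1V->]; first exact: c6.
  move=> alM tx; have [_ gM' bM] := good_triple Sx fx tx cx.
  have [_ gb _ _ _] := triple_in2 tx cx.
  split=> // E; have : (elts M `&` Icc g b) g by split=> //; split=> //; left.
  by rewrite E.
Qed.

Lemma amalgamation b y B : cond b y B -> M ∈ B ->
  exists a0 x0 A0, [/\ S M a0, S M x0, S M A0, cond a0 x0 A0 &
    forall a x A, S M a -> S M x -> S M A -> cond a x A ->
      a0 ⊆ a -> x0 ⊆ x -> A0 ⊆ A -> cond (cupV a b) (cupV x y) (cupV A B)].
Proof.
move=> cr MB; have [[fb cb] [fy cy] [fB [BX Bad]] c4 c5 c6] := cr.
pose d L := comparison_point Gamma L M.
have dP L (LB : L ∈ B) := cmpP Y_sub F_skolem Gamma_Lambda Gamma_stat (BX _ LB) XM.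
have Gd L : L ∈ B -> Gamma (d L) by move=> /dP[].
pose B' := setof (elts B `|` [set capV L (elts (d L)) | L in elts B]).
have fB' : finite_set (elts B `|` [set capV L (elts (d L)) | L in elts B]).
  by rewrite finite_setU; split=> //; exact: finite_image.
have B'E K : K ∈ B' <-> K ∈ B \/ exists2 L, L ∈ B & K = capV L (elts (d L)).
  rewrite mem_setof; last exact/is_set_countable/finite_set_countable.
  by split=> -[|[L LB E]]; [left|right; exists L|left|right; exists L].
have cr' : cond b y B'.
  apply: cond_add_initial cr _ _.
    by rewrite setofP //; exact/is_set_countable/finite_set_countable.
  by move=> K /B'E[|[L LB ->]]; [left|right; exists L, (d L); split=> //; exact: Gd].
pose sub (z : V) := setof (elts z `&` S M).
have subE z t : t ∈ sub z <-> t ∈ z /\ S M t.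
  by rewrite mem_setof //; apply: is_set_sub (is_set_elts z) => ? [].
have sub_sub z : sub z ⊆ z by move=> t /subE[].
have Ssub z : finite_set (elts z) -> S M (sub z).
  by move=> fz; apply: (good_finite gM) => [|t []//]; exact: finite_setIl.
(* Suprema outside the hull of [M] cannot enter a condition in it, and a conflict at a supremum
   arises only if a model of [B'] forbids it. So these finitely many points suffice, and
   [(b, y, B')] itself forbids all of them. *)
pose Xi := [set xi | S M xi /\ forbids B' xi] `&`
  [set supO (elts L `&` elts (d L)) | L in elts B].
have fXi : finite_set Xi by apply/finite_setIr/finite_image.
have XiE xi : xi ∈ setof Xi <-> Xi xi.
  by apply: mem_setof; exact/is_set_countable/finite_set_countable.
have fB2 : finite_set (elts B') by case: (cond_A cr').
have SXi : S M (setof Xi) by apply: (good_finite gM) => // xi [[]].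
have [|a0 [x0 [A0 [Sa0 Sx0 SA0 [c0 ba0 yx0 BA0 Xi0]]]]] :=
  good_forbidding gM (Ssub _ fb) (Ssub _ fy) (Ssub _ fB2) SXi.
  exists b, y, B'; split=> //.
  by move=> xi /XiE[[]].
exists a0, x0, A0; split=> // a x A Sa Sx SA cs a0a x0x A0A.
have [[fa ca] [fx cx] [fA [AX Aad]] s4 s5 s6] := cs.
have SK K : K ∈ A -> S M K by move=> KA; exact: S_elts_finite SA fA KA.
have KM K : K ∈ A -> K ⊆ M by move=> KA; exact: S_model (SK _ KA) (AX _ KA).
have aM xi : xi ∈ a -> xi ∈ M.
  by move=> xia; apply: S_in (ca _ xia).1; exact: S_elts_finite Sa fa xia.
have xM al g be : triple al g be ∈ x -> [/\ al ∈ M, g ∈ M & be ∈ M].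
  by move=> tx; exact: good_triple Sx fx tx cx.
have cutA L : L ∈ B -> S M (capV L (elts (d L))) -> capV L (elts (d L)) ∈ A.
  move=> LB SL; apply/A0A/BA0/subE; split=> //.
  by apply/B'E; right; exists L.
(* If [M] meets the interval, clause (6) puts both endpoints into [M], so the triple is in the trace
   of [y] and thus in [x]. *)
have ycase al g be : al ∈ M -> triple al g be ∈ y ->
    triple al g be ∈ x \/ (elts M `&` Icc g be = set0 /\ supO (elts M `&` elts al) ∈ g).
  move=> alM ty; have [h1 h2] := c6 _ _ _ _ MB alM ty.
  have [E|/set0P/h1[gM' bM]] := eqVneq (elts M `&` Icc g be) set0.
    by right; split=> //; exact: h2.
  left; apply/x0x/yx0/subE; split=> //; apply/S_triple.
  by split; exact: sub_Sk.
have adLM L : L ∈ B -> [\/ capV L (elts (d L)) = capV M (elts (d L)),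
    S M (capV L (elts (d L))) | S L (capV M (elts (d L)))].
  by move=> LB; exact: Bad.
(* Below [d L], either [L] contains [M], or the initial segment of [L] is in [A]. *)
have dcase L : L ∈ B -> (forall z, z ∈ M -> z ∈ d L -> z ∈ L) \/
    S M (capV L (elts (d L))).
  move=> LB; have Ld : forall z, z ∈ M -> z ∈ d L -> z ∈ capV M (elts (d L)).
    by move=> z zM zd; apply/mem_capV.
  case: (adLM _ LB) => [E|h|h]; [left|by right|left] => z zM zd.
    by have := Ld _ zM zd; rewrite -E => /mem_capV[].
  have XM' := X_capV Y_sub Y_initial Gamma_Lambda XM (Gd _ LB).
  apply: (Sk_X_sub Y_sub F_skolem Gamma_Lambda Gamma_stat (BX _ LB) XM' h).
  exact: Ld.
have adhd L z : L ∈ B -> z ∈ omega2 -> adh L z -> adh M z -> z ∈ d L.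
  move=> LB z2 aL aM'.
  exact: (adh_cmp Y_sub F_skolem Gamma_Lambda Gamma_stat (BX _ LB) XM z2 aL aM').
split.
- by split=> [|xi /mem_cupV[/ca|/cb]//]; rewrite elts_cupV finite_setU.
- by split=> [|t /mem_cupV[/cx|/cy]//]; rewrite elts_cupV finite_setU.
- split; first by rewrite elts_cupV finite_setU.
  split=> [K /mem_cupV[/AX|/BX]//|K L KAB LAB].
  suff : adequate2 F Gamma K L by [].
  have mixed L' K' : L' ∈ B -> K' ∈ A -> adequate2 F Gamma L' K'.
    move=> LB KA.
    apply: (adequate2_amalgamate pi_bij Y_sub Y_thin Y_initial F_skolem Gamma_Lambda
      Gamma_stat (BX _ LB) XM (AX _ KA) (SK _ KA) (Bad _ _ LB MB)).
    by move=> SL; apply: Aad KA; exact: cutA.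
  have [KA|KB] := (mem_cupV _ _ _).1 KAB; have [LA|LB] := (mem_cupV _ _ _).1 LAB.
  + exact: Aad.
  + exact/adequate2C/mixed.
  + exact: mixed.
  + exact: Bad.
(* Either [ycase] brings the second triple into [x], or the elements of [M] below [al], among them
   [be], stay under [g'], and the intervals are apart. *)
- have mixed al g be g' be' : triple al g be ∈ x -> triple al g' be' ∈ y ->
      triple al g be <> triple al g' be' -> Ico g be `&` Ico g' be' = set0.
    move=> tx ty ne; have [alM _ beM] := xM _ _ _ tx.
    have [tx'|[_ sg]] := ycase _ _ _ alM ty; first exact: s4 tx tx' ne.
    have [_ _ bal _ _] := triple_in2 tx cx.
    have [_ _ _ _ [_ g2 _]] := triple_in2 ty cy.
    rewrite -subset0 => z [[_ zbe] [gz _]]; apply: (leO_notin gz).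
    apply: Ord_trans (Ord_in2 g2) _ sg; apply/mem_supO.
      by apply: is_set_sub (is_set_elts M) => ? [].
    by exists be.
  move=> al g be g' be' /mem_cupV[tx|ty] /mem_cupV[tx'|ty'] ne.
  + exact: s4 ne.
  + exact: mixed ne.
  + by rewrite setIC; apply: mixed tx' ty _ => e; apply: ne.
  + exact: c4 ne.
- move=> xi K /mem_cupV[xia|xib] /mem_cupV[KA|LB]; [exact: s5| | |exact: c5].
    (* [xi] from [a] against [K] from [B]: [xi] is in [M] and a limit of [K], so it is below [d K].
       Suppose the initial segment of [K] is in [A]. If it reaches beyond [xi], clause (5) for [A]
       applies to it; if not, [xi] is its supremum, and were it missing from [K], it would be in
       [Xi] and forbidden by [A], against [xi] being in [a]. *)
    move=> sxi [l [lL nl]]; have xi2 := (ca _ xia).1.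
    have xid : xi ∈ d K by apply: adhd => //; [right|left; exact: aM].
    have od : Ord (d K) by exact/Ord_in2/in2/Gd.
    have [h|SL] := dcase _ LB; first exact: h (aM _ xia) xid.
    have E : elts (capV K (elts (d K))) `&` elts xi = elts K `&` elts xi.
      rewrite elts_capV; apply/seteqP; split=> z [] => [[]//|zK zxi].
      by split=> //; split=> //; exact: Ord_trans xid.
    have L'A := cutA _ LB SL.
    have [e0|/set0P ne0] := eqVneq (elts (capV K (elts (d K))) `\` elts xi) set0; last first.
      by have /mem_capV[] : xi ∈ capV K (elts (d K)) by apply: s5 => //; rewrite E.
    apply: contrapT => nxi.
    have Exi : supO (elts K `&` elts (d K)) = xi.
      rewrite -[RHS]sxi; congr supO; rewrite -E -elts_capV.
      apply/seteqP; split=> z; last by case.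
      move=> zK; split=> //; apply: contrapT => nz.
      by have : (elts (capV K (elts (d K))) `\` elts xi) z by []; rewrite e0.
    have [J [JA sJ nJ]] : forbids A xi.
      have [|J [JA0 ? ? ?]] := Xi0 xi _; last by exists J; split=> //; exact: A0A.
      apply/XiE; split; last by exists K.
      split; first exact: S_elts_finite Sa fa xia.
      by exists K; split=> //; [apply/B'E; left|exists l].
    by case; exact: s5.
  (* [xi] from [b] against [K] from [A]: a limit of [K] is a limit of [M], so clause (5) for [M]
     puts [xi] into [M], and the trace of [b] is contained in [a]. *)
  move=> sxi [k [kK nk]]; apply: s5 => //; last by exists k.
  apply/a0a/ba0/subE; split=> //; apply: sub_Sk; apply: c5 => //; last first.
    by exists k; split=> //; exact: (KM _ KA).
  apply: leO_anti.
    by apply: (supM_le Y_sub XM); exact: Ord_in2 (cb _ xib).1.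
  apply: sub_leO; [exact: Ord_in2 (cb _ xib).1|exact: (Ord_supM Y_sub XM)|].
  move=> z; rewrite -{1}sxi => /mem_supM[m [mK mxi zm]]; apply/mem_supM.
  by exists m; split=> //; exact: (KM _ KA).
- move=> K al g be /mem_cupV[KA|LB] alK /mem_cupV[tx|ty]; [exact: s6| | |exact: c6]; last first.
    (* A triple of [x] against [K] from [B]: [al] is common to [K] and [M], so the interval lies
       below [d K]. There either [K] contains [M], hence both endpoints, or the initial segment of
       [K] is in [A] and clause (6) carries over from it. *)
    have [alM gM' bM] := xM _ _ _ tx; have [Gal gb bal gal [al2 _ _]] := triple_in2 tx cx.
    have ald : al ∈ d K by apply: adhd => //; left.
    have od : Ord (d K) by exact/Ord_in2/in2/Gd.
    have cut z : z ∈ al -> z ∈ d K by move=> zal; exact: Ord_trans ald.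
    have [h|SL] := dcase _ LB.
      have [gK bK] : g ∈ K /\ be ∈ K by split; apply: h => //; exact: cut.
      split=> // E; have : (elts K `&` Icc g be) g by split=> //; split=> //; left.
      by rewrite E.
    have L'A := cutA _ LB SL.
    have [|h1 h2] := s6 _ _ _ _ L'A _ tx; first exact/mem_capV.
    have E : elts (capV K (elts (d K))) `&` Icc g be = elts K `&` Icc g be.
      rewrite elts_capV; apply/seteqP; split=> z [] => [[zL zd] zi//|zL zi].
      split=> //; split=> //; case: zi => _ zb; apply: cut.
      exact: leO_mem (Ord_in2 al2) zb bal.
    have E' : elts (capV K (elts (d K))) `&` elts al = elts K `&` elts al.
      rewrite elts_capV; apply/seteqP; split=> z [] => [[zL zd] zi//|zL zi].
      by split=> //; split=> //; exact: cut.
    rewrite E in h1 h2; rewrite E' in h2; split=> // /h1[].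
    by move=> /mem_capV[gK _] /mem_capV[bK _].
  have [tx|[E sg]] := ycase _ _ _ (KM _ KA _ alK) ty; first exact: s6.
  have [_ _ _ _ [al2 g2 _]] := triple_in2 ty cy.
  split=> [[z [zK zi]]|_].
    by have : (elts M `&` Icc g be) z; [split=> //; exact: (KM _ KA)|rewrite E].
  apply: leO_mem (Ord_in2 g2) _ sg; apply: sub_leO.
  + exact: (Ord_supM Y_sub (AX _ KA)).
  + exact: (Ord_supM Y_sub XM).
  + move=> z /mem_supM[m [mK mxi zm]]; apply/mem_supM.
    by exists m; split=> //; exact: (KM _ KA).
Qed.

(** Stated through the conditions in [N], so as to serve both for the hull itself and for an
    elementary submodel of a larger [H th] with the same conditions. *)
Lemma good_strongly_generic N q : N `&` elts P = S M `&` elts P ->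
  q ∈ P -> (forall a x A, q = triple a x A -> M ∈ A) ->
  strongly_generic P poset_le N q.
Proof.
move=> NP qP qM; move=> D [DN Dd] r /mem_poset[b [y [B [-> cr]]]].
move=> [b' [y' [B' [a [x [A [/triple_inj[<- <- <-] /qM MA [_ _ AB]]]]]]]].
have [a0 [x0 [A0 [Sa0 Sx0 SA0 c0 ext]]]] := amalgamation cr (AB _ MA).
have [|e De] := Dd (triple a0 x0 A0).
  rewrite NP; split; last by apply/mem_poset; exists a0, x0, A0.
  exact/S_triple.
move=> [a1 [x1 [A1 [a0' [x0' [A0' [eE /triple_inj[<- <- <-] [aa xx AA]]]]]]]].
have [] : (N `&` elts P) e by exact: DN.
move=> Ne Pe; have [Se _] : (S M `&` elts P) e by rewrite -NP.
have [a2 [x2 [A2 [eE2 c2]]]] := (mem_poset _).1 Pe.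
move: eE2 c2; rewrite eE => /triple_inj[<- <- <-] c1.
move: Se; rewrite eE => /S_triple[Sa1 Sx1 SA1].
have cw := ext _ _ _ Sa1 Sx1 SA1 c1 aa xx AA.
exists (triple a1 x1 A1); first by rewrite -eE.
exists (triple (cupV a1 b) (cupV x1 y) (cupV A1 B)); split.
- by apply/mem_poset; do 3 eexists.
- do 6 eexists; split; [reflexivity|reflexivity|].
  by split=> z zz; apply/mem_cupV; left.
- do 6 eexists; split; [reflexivity|reflexivity|].
  by split=> z zz; apply/mem_cupV; right.
Qed.

End GoodModel.
End Genericity.

(** * Existence of good models *)

Section GoodModels.
Variables (pi : V -> V) (Y : set V) (F : skolem_family) (Gamma : set V).
Hypothesis pi_bij : set_bij (elts omega2) (H omega2) pi.
Hypothesis Y_stationary : stationaryP (elts omega2) Y.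
Hypothesis Y_thin : forall b, b ∈ omega2 ->
  [set capV a (elts b) | a in Y] #<= elts omega1.
Hypothesis Y_initial : forall a b, Y a -> b ∈ omega2 -> Y (capV a (elts b)).
Hypothesis F_skolem : definable_skolem pi Y F.
Hypothesis Gamma_Lambda : Gamma `<=` Lambda F.
Hypothesis Gamma_stat : stationary omega2 Gamma.

Let Y_sub : Y `<=` Pomega1 (elts omega2) := Y_stationary.1.
Let P := poset F Y Gamma.
Let cof := Gamma_cof Gamma_Lambda.

Let supC (g : V) := supO (clubC F `&` elts g).

Lemma supC_in2 g : g ∈ omega2 -> supC g ∈ omega2.
Proof.
move=> g2; have og := Ord_in2 g2; apply: leO_mem (Ord_omega2) _ g2.
apply: supO_lub => //.
- by apply: is_set_sub (is_set_elts g) => ? [].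
- by move=> a [_]; exact: Ord_mem.
- by move=> a [_]; left.
Qed.

Let forbidding' := forbidding Y F Gamma.

(* The length of [s] selects the operation: [sup (C `&` g)] for [[:: g]], and an
   extension of [(a, x, A)] forbidding [Xi] for [[:: a; x; A; Xi]]. *)
Definition good_op (s : seq V) : set V :=
  (form_op F s `|` [set setof [set` s]]) `|`
  match s with
  | [:: g] => if pselect (g ∈ omega2) then [set supC g] else set0
  | [:: a; x; A; Xi] =>
    if pselect (exists byB : V * V * V, forbidding' a x A Xi byB.1.1 byB.1.2 byB.2)
    is left h then [set (sval (cid h)).1.1; (sval (cid h)).1.2; (sval (cid h)).2]
    else set0
  | _ => set0
  end.

Lemma good_op_countable : countable_op (H omega2) good_op.
Proof.
move=> s sH.
have sym : forall r, exists k,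
    (fun k => match k with 0 => symMem | 1 => symPi | _ => symY end) k = r.
  by case; [exists 0%N|exists 1%N|exists 2%N].
split=> [z [[[n [p [e [es ->]]]]|->]|]|].
- by apply: (H_skolem_closed F_skolem) => i; exact/sH/es.
- have ss : is_set [set` s] by apply/is_set_countable/finite_set_countable; exact: finite_seq.
  apply: (H_finite Gamma_stat cof) => [|y]; first by rewrite setofP //; exact: finite_seq.
  by rewrite mem_setof // => /sH.
- case: s sH => // g [_|x [//|A [//|Xi [_|//]]]].
    by case: pselect => // g2 ->; exact/H_ord/supC_in2.
  case: pselect => // h; case: cid => -[[b y] B] /= [/(cond_H Y_sub Gamma_Lambda Gamma_stat)].
  by move=> [Hb Hy HB] _ _ _ _ [[->|->]|->].
- apply: countable_setU; first apply: countable_setU.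
  + exact: (countable_form_op sym).
  + exact: countable1.
  + apply: finite_set_countable; case: s {sH} => // g [|x [//|A [//|Xi [|//]]]].
      by case: pselect => ?; [exact: finite_set1|exact: finite_set0].
    case: pselect => [h|?]; [exact: finite_set3|exact: finite_set0].
Qed.

(** [g] is a slot for further closure: strong properness fills it with a club and Skolem functions
    for [H th], the proof of stationarity with a search for points of a named club. *)
Lemma good_hull X0 g : H omega2 `<=` X0 -> countable_op X0 g ->
  exists M N, [/\ good Y F Gamma M, Pomega1 X0 N, closed_under g (elts N) &
    elts N `&` H omega2 = Sk F (elts M)].
Proof.
move=> HX cg.
(* [X0] may exceed [H omega2], while [good_op] is controlled only on lists from [H omega2]; it is
   switched off elsewhere. *)
pose f s := g s `|` (if pselect (forall x, x \in s -> H omega2 x) then good_op s else set0).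
have cf : countable_op X0 f.
  move=> s sX; have [gX cgs] := cg _ sX; rewrite /f.
  case: (pselect (forall x, x \in s -> H omega2 x)) => [sH|?]; last by rewrite setU0.
  have [oH co] := good_op_countable sH; split; last exact: countable_setU.
  by move=> z [/gX//|/oH/HX].
have w2X : elts omega2 `<=` X0 by move=> z /H_ord/HX.
have [M [N [YM XN NE N2]]] := stationary_hull Y_stationary w2X cf.
have Nf : closed_under f (elts N) by rewrite NE; exact: hull_closed.
have Ng : closed_under g (elts N) by move=> s sN z gz; apply: (Nf s) => //; left.
have No s : (forall x, x \in s -> elts N x) -> (forall x, x \in s -> H omega2 x) ->
    good_op s `<=` elts N.
  move=> sN sH z oz; apply: (Nf s) => //; right.
  by case: (pselect (forall x, x \in s -> H omega2 x)).
pose S := elts N `&` H omega2.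
have So s : (forall x, x \in s -> S x) -> good_op s `<=` S.
  move=> sS; have sH x : x \in s -> H omega2 x by move=> /sS[].
  move=> z oz; split; last by have [h _] := good_op_countable sH; exact: h.
  by apply: (No s) => // x /sS[].
have ScF : skolem_closed F S.
  apply: ((closed_form_op (L := symA) (ar := arA) F S).1 _) => s sS z fz.
  by apply: (So s) => //; left; left.
have MS : elts M `<=` S.
  by move=> z; rewrite -N2 => -[zN z2]; split=> //; exact: H_ord.
(* An element of [S] is some [pi i]. As [S] is its own Skolem hull it contains the code [i], which
   is then in [M]. *)
have SE : S = Sk F (elts M).
  apply/seteqP; split; last exact: Sk_min ScF MS.
  move=> x [xN Hx]; have [_ _ surj] := pi_bij.
  have [i i2 ix] := surj _ Hx; rewrite -ix.
  have MH : elts M `<=` H omega2 by move=> z /MS[].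
  apply: (Sk_pi pi_bij F_skolem MH) => //; apply: sub_Sk.
  rewrite -N2; split=> //.
  have SH : S `<=` H omega2 by move=> z [].
  have : Sk F S i by apply: (Sk_pi_inv pi_bij F_skolem SH) => //; apply: sub_Sk; rewrite ix.
  by rewrite /Sk smallest_id // => -[].
have XM : calX F Y M.
  split=> //.
    rewrite -SE -N2; apply/seteqP; split=> z [] => [[zN _] z2|zN z2]; first by split.
    by split=> //; split=> //; exact: H_ord.
  move=> m mM; rewrite -[_ ∈ _]/(elts _ _) -N2.
  have m2 : m ∈ omega2 by move: mM; rewrite -[_ ∈ _]/(elts _ _) -N2 => -[].
  split; last exact: supC_in2.
  have [] // : S (supC m).
  apply: (So [:: m]); first by move=> x; rewrite inE => /eqP->; exact: MS.
  by right; case: pselect.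
exists M, N; split=> //; split=> //.
  move=> C /finite_seqP[s ->] sC; rewrite -SE in sC *.
  by apply: (So s) => //; left; right.
move=> a x A Xi; rewrite -SE => Sa Sx SA SXi [b0 [y0 [B0 fb]]].
have sS z : z \in [:: a; x; A; Xi] -> S z.
  by rewrite !inE => /or4P[] /eqP->.
have := So _ sS; rewrite /good_op /=; case: pselect => [h|nh]; last first.
  by case: nh; exists (b0, y0, B0).
case: cid => -[[b y] B] /= hB sub; exists b, y, B.
by split=> //; apply: sub; right; [left; left|left; right|right].
Qed.

Lemma good_extension M p : good Y F Gamma M -> p ∈ P -> Sk F (elts M) p ->
  exists a x A, [/\ triple a x A ∈ P, poset_le (triple a x A) p,
    supO (elts M) ∈ a & forall N, N `&` elts P = Sk F (elts M) `&` elts P ->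
      strongly_generic P poset_le N (triple a x A)].
Proof.
move=> gM /(mem_poset Y_sub Gamma_Lambda)[a [x [A [-> c]]]].
move=> /(S_triple Y_sub F_skolem Gamma_Lambda Gamma_stat gM)[Sa Sx SA].
have cq := cond_add_model Y_sub F_skolem Gamma_Lambda Gamma_stat gM c Sa Sx SA.
set a' := cupV a _ in cq; set A' := cupV A _ in cq.
have qP : triple a' x A' ∈ P by apply/(mem_poset Y_sub Gamma_Lambda); exists a', x, A'.
exists a', x, A'; split=> //.
- exists a', x, A', a, x, A; split=> //; split=> // z za; apply/mem_cupV; by left.
- by apply/mem_cupV; right; apply/mem_set1V.
- move=> N NE; apply: (good_strongly_generic pi_bij Y_sub Y_thin Y_initial F_skolem
    Gamma_Lambda Gamma_stat gM NE qP).
  move=> b y B /triple_inj[_ _ <-].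
  by apply/mem_cupV; right; apply/mem_set1V.
Qed.

Lemma strongly_proper : strongly_proper_on_stationary P poset_le.
Proof.
exists (hartogs omega2); split; first exact: Ord_hartogs.
move=> th [_ [oth _ _ _]] th3 _.
have Hth := H_omega2_sub th3 oth.
have H0 : H th emptyV by apply/Hth/H_ord/emptyV_in_omega2.
split=> [N []//|D clD].
have [f cf fD] := club_operation clD.
(* Skolem functions for [H th]; [H0] is there for the default value [emptyV]. *)
pose G n (p : form arMem n.+1) (e : 'I_n -> V) :=
  if pselect (exists x, H th x /\ sat (H th) relMem p (scons x e)) is left h
  then sval (cid h) else emptyV.
pose g s := f s `|` form_op G s.
have cg : countable_op (H th) g.
  move=> s sH; have [fH cfs] := cf _ sH.
  have sym : forall r, exists k : nat, (fun _ : nat => tt) k = r.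
    by case; exists 0%N.
  split; last exact: countable_setU cfs (countable_form_op sym G s).
  move=> z [/fH//|[n [p [e [_ ->]]]]]; rewrite /G.
  by case: pselect => // h; case: cid => ? [].
have [M [N [gM XN Ng NS]]] := good_hull Hth cg.
exists N.
  by apply: fD => // s sN z fz; apply: (Ng s) => //; left.
split=> //.
  apply: tarski_vaught; first by case: XN.
  move=> n p e Ne [x Hx px]; exists (G n p e).
    have cN : closed_under (form_op G) (elts N).
      by move=> s sN z fz; apply: (Ng s) => //; right.
    exact: (closed_form_op G (elts N)).1 cN _ _ _ Ne.
  by rewrite /G; case: pselect => [h|[]]; [case: cid => ? []|exists x].
move=> p pN pP; have Hp := poset_H Y_sub Gamma_Lambda Gamma_stat pP.
have [|a [x [A [qP qp _ sg]]]] := good_extension gM pP; first by rewrite -NS.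
exists (triple a x A); split=> //; apply: sg; rewrite -NS.
apply/seteqP; split=> z [] => [zN zP|[zN _] zP]; split=> //; split=> //.
exact: (poset_H Y_sub Gamma_Lambda Gamma_stat).
Qed.

End GoodModels.

(** * The forcing relation *)

Section ForcingTheory.
Variables (Q : V) (le : V -> V -> Prop).
Local Notation "q <=Q p" := (le (@el Q q) (@el Q p)) (at level 70).
Hypothesis le_refl : forall p : idx Q, p <=Q p.
Hypothesis le_trans : forall r q p : idx Q, r <=Q q -> q <=Q p -> r <=Q p.

Local Notation feq := (feq le).
Local Notation fmem := (fmem le).
Local Notation fnot := (fnot le).
Local Notation fimp := (fimp le).
Local Notation fex := (fex le).
Local Notation fdisj := (fdisj le).
Local Notation fupair := (fupair le).
Local Notation fpair := (fpair le).
Local Notation ftriple := (ftriple le).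
Local Notation check := (check Q).

Implicit Types (A B : fprop Q) (p q r : idx Q) (s t u v w : name Q).

Definition dense_below (A : fprop Q) p := forall q, q <=Q p -> exists2 r, r <=Q q & A r.
Definition mono (A : fprop Q) := forall p q, q <=Q p -> A p -> A q.
(** The regular open sets of conditions. Connectives of the forcing language are coded by negation,
    and on such sets the resulting double negations can be removed by density. *)
Definition regular_prop (A : fprop Q) := mono A /\ forall p, dense_below A p -> A p.

Lemma mono_fnot A : mono (fnot A).
Proof. by move=> p q qp nA r rq; apply: nA; exact: le_trans qp. Qed.

Lemma mono_fand A B : mono A -> mono B -> mono (fand A B).
Proof. by move=> mA mB p q qp [Ap Bp]; split; [exact: mA Ap|exact: mB Bp]. Qed.

Lemma regular_fnot A : mono A -> regular_prop (fnot A).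
Proof.
move=> mA; split; first exact: mono_fnot.
move=> p d q qp Aq; have [r rq nA] := d q qp.
by apply: (nA r (le_refl r)); exact: mA Aq.
Qed.

Lemma regular_feq s t : regular_prop (feq s t).
Proof.
case: s t => I f c [J g d]; split.
  move=> p q qp [h1 h2]; split=> i r rq rc; [apply: h1|apply: h2] => //;
    exact: le_trans qp.
move=> p D; split=> i q qp qc.
  have [r rq [h1 _]] := D q qp.
  have [r' [j [rr rd e]]] := h1 i r (le_refl r) (le_trans rq qc).
  by exists r', j; split=> //; exact: le_trans rq.
have [r rq [_ h2]] := D q qp.
have [r' [j [rr rd e]]] := h2 i r (le_refl r) (le_trans rq qc).
by exists r', j; split=> //; exact: le_trans rq.
Qed.

Lemma regular_fmem s t : regular_prop (fmem s t).
Proof.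
case: t => J g d; split=> [p q qp h r rq|p D q qp].
  by apply: h; exact: le_trans qp.
have [r rq h] := D q qp; have [r' [j [rr rd e]]] := h r (le_refl r).
by exists r', j; split=> //; exact: le_trans rq.
Qed.

Lemma fimpE A B p : mono A -> regular_prop B ->
  fimp A B p <-> forall q, q <=Q p -> A q -> B q.
Proof.
move=> mA [mB rB]; split=> [h q qp Aq|h q qp [Aq nB]]; last first.
  exact: (nB q (le_refl q)) (h q qp Aq).
apply: rB => r rq; apply: contrapT => nr.
apply: (h r (le_trans rq qp)); split; first exact: mA Aq.
by move=> r' rr Br; apply: nr; exists r'.
Qed.

Lemma regular_fimp A B : mono A -> regular_prop (fimp A B).
Proof. by move=> mA; apply: regular_fnot; apply: mono_fand => //; exact: mono_fnot. Qed.

Lemma fexE (A : name Q -> fprop Q) p :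
  fex A p <-> dense_below (fun r => exists s, A s r) p.
Proof.
split=> [h q qp|h q qp nA].
  apply: contrapT => nr; apply: (h q qp) => s r rq Ar.
  by apply: nr; exists r => //; exists s.
by have [r rq [s Ar]] := h q qp; exact: nA s r rq Ar.
Qed.

Lemma regular_fex (A : name Q -> fprop Q) : regular_prop (fex A).
Proof. by apply: regular_fnot => p q qp Ap s; exact: mono_fnot (Ap s). Qed.

Lemma fexI (A : name Q -> fprop Q) s p : mono (A s) -> A s p -> fex A p.
Proof. by move=> mA Ap; apply/fexE => q qp; exists q => //; exists s; exact: mA Ap. Qed.

Lemma fdisjE A B p : fdisj A B p <-> dense_below (fun r => A r \/ B r) p.
Proof.
split=> [h q qp|h q qp [nA nB]].
  apply: contrapT => nr; apply: (h q qp); split=> r rq ABr; apply: nr; exists r => //.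
    by left.
  by right.
by have [r rq [/nA|/nB]] := h q qp; apply.
Qed.

Lemma mono_fdisj A B : mono (fdisj A B). Proof. exact: mono_fnot. Qed.

Lemma feq_refl s p : feq s s p.
Proof. by elim: s p => I f IH c p; split=> i q qp qc; exists q, i; split. Qed.

Lemma feq_sym s t p : feq s t p -> feq t s p.
Proof.
elim: s t p => I f IH c [J g d] p [h1 h2]; split=> i q qp qc.
  by have [r [j [rq rd e]]] := h2 i q qp qc; exists r, j; split=> //; exact: IH.
by have [r [j [rq rd e]]] := h1 i q qp qc; exists r, j; split=> //; exact: IH.
Qed.

Lemma feq_mono s t p q : q <=Q p -> feq s t p -> feq s t q.
Proof. by have [m _] := regular_feq s t; exact: m. Qed.

Lemma fmem_mono s t p q : q <=Q p -> fmem s t p -> fmem s t q.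
Proof. by have [m _] := regular_fmem s t; exact: m. Qed.

Lemma feq_trans s t u p : feq s t p -> feq t u p -> feq s u p.
Proof.
elim: s t u p => I f IH c [J g d] [K h k] p [a1 a2] [b1 b2]; split=> i q qp qc.
  have [r [j [rq rd e]]] := a1 i q qp qc.
  have [r' [l [rr rk e']]] := b1 j r (le_trans rq qp) rd.
  exists r', l; split=> //; first exact: le_trans rq.
  exact: IH (feq_mono rr e) e'.
have [r [j [rq rd e]]] := b2 i q qp qc.
have [r' [l [rr rk e']]] := a2 j r (le_trans rq qp) rd.
exists r', l; split=> //; first exact: le_trans rq.
exact: IH e' (feq_mono rr e).
Qed.

Lemma fmem_eql s s' t p : feq s s' p -> fmem s t p -> fmem s' t p.
Proof.
case: t => J g d e h q qp; have [r [j [rq rd e']]] := h q qp.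
exists r, j; split=> //; apply: feq_trans e'.
exact/feq_sym/(feq_mono (le_trans rq qp)).
Qed.

Lemma fmem_eqr s t t' p : feq t t' p -> fmem s t p -> fmem s t' p.
Proof.
case: t t' => I f c [J g d] [h1 _] h q qp; have [r [i [rq rc e]]] := h q qp.
have [r' [j [rr rd e']]] := h1 i r (le_trans rq qp) rc.
exists r', j; split=> //; first exact: le_trans rq.
exact: feq_trans (feq_mono rr e) e'.
Qed.

(** * Check names, pairs and triples in the forcing language *)

Lemma feq_check_tree (x y : tree) p :
  feq (check_tree Q x) (check_tree Q y) p <-> teq x y.
Proof.
elim: x y p => T f IH [U g] p; split=> [[h1 h2]|[h1 h2]]; split.
- move=> i; have [r [[j q] [_ _ e]]] := h1 (i, p) p (le_refl p) (le_refl p).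
  by exists j; have /IH := e.
- move=> j; have [r [[i q] [_ _ e]]] := h2 (j, p) p (le_refl p) (le_refl p).
  by exists i; have /IH := e.
- move=> [i c] q qp qc; have [j ij] := h1 i.
  by exists q, (j, q); split=> //; exact/IH.
- move=> [j c] q qp qc; have [i ij] := h2 j.
  by exists q, (i, q); split=> //; exact/IH.
Qed.

Lemma feq_check x y p : feq (check x) (check y) p <-> x = y.
Proof.
rewrite /check feq_check_tree; split=> [|->]; last exact: teq_refl.
by move=> /class_of_eq; rewrite !reprE.
Qed.

Lemma fmem_checkE s x p : fmem s (check x) p <->
  dense_below (fun r => exists2 y, y ∈ x & feq s (check y) r) p.
Proof.
rewrite /check; have mE y : y ∈ x <-> exists i : tidx (Defs.repr x), class_of (tsub i) = y by [].
case: (Defs.repr x) mE => T f /= mE; split=> h q qp.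
  have [r [[i c] [rq rc e]]] := h q qp; exists r => //; exists (class_of (f i)).
    by apply/mE; exists i.
  apply: feq_trans e _; apply/feq_check_tree; exact: canonP.
have [r rq [y /mE[i <-] e]] := h q qp; exists r, (i, r); split=> //.
apply: feq_trans e _; apply/feq_check_tree; apply: teq_sym; exact: canonP.
Qed.

Lemma fmem_check x y p : fmem (check x) (check y) p <-> x ∈ y.
Proof.
rewrite fmem_checkE; split=> [h|xy q qp].
  by have [r _ [z zy /feq_check->]] := h p (le_refl p).
by exists q => //; exists x => //; exact: feq_refl.
Qed.

Lemma fmem_GdotE t p : fmem t (Gdot Q) p <->
  dense_below (fun r => exists2 c, r <=Q c & feq t (check (el c)) r) p.
Proof.
split=> h q qp; first by have [r [c [rq rc e]]] := h q qp; exists r => //; exists c.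
by have [r rq [c rc e]] := h q qp; exists r, c.
Qed.

Lemma fupairE z x y p : fupair z x y p <-> [/\ fmem x z p, fmem y z p &
  forall w q, q <=Q p -> fmem w z q -> dense_below (fun r => feq w x r \/ feq w y r) q].
Proof.
have mm s t : mono (fmem s t) by case: (regular_fmem s t).
have rfd A B : regular_prop A -> regular_prop B -> regular_prop (fdisj A B).
  by move=> rA rB; apply: regular_fnot; apply: mono_fand; exact: mono_fnot.
split=> [h|[xz yz h] w].
  have h1 w q : q <=Q p -> fmem w z q -> fdisj (feq w x) (feq w y) q.
    have [/fimpE + _] := h w; apply; first exact: mm.
    by apply: rfd; exact: regular_feq.
  have h2 w q : q <=Q p -> fdisj (feq w x) (feq w y) q -> fmem w z q.
    have [_ /fimpE +] := h w; apply; first exact: mono_fdisj.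
    exact: regular_fmem.
  split=> [||w q qp wz]; last exact/fdisjE/h1.
    apply: h2 => //; apply/fdisjE => q qp; exists q => //; left; exact: feq_refl.
  by apply: h2 => //; apply/fdisjE => q qp; exists q => //; right; exact: feq_refl.
split; apply/fimpE.
- exact: mm.
- by apply: rfd; exact: regular_feq.
- by move=> q qp wz; apply/fdisjE; exact: h.
- exact: mono_fdisj.
- exact: regular_fmem.
- move=> q qp /fdisjE d; have [_ st] := regular_fmem w z; apply: st => r rq.
  have [r' rr e] := d r rq; exists r' => //.
  have rp := le_trans rr (le_trans rq qp).
  by case: e => e; apply: fmem_eql (feq_sym e) (fmem_mono rp _).
Qed.

Lemma fupair_mono z x y : mono (fupair z x y).
Proof.
move=> p q qp /fupairE[xz yz h]; apply/fupairE.
split; [exact: fmem_mono xz|exact: fmem_mono yz|move=> w r rq].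
by apply: h; exact: le_trans qp.
Qed.

Lemma fupair_congr z x y z' x' y' p : feq z z' p -> feq x x' p -> feq y y' p ->
  fupair z x y p -> fupair z' x' y' p.
Proof.
move=> ez ex ey /fupairE[xz yz h]; apply/fupairE; split.
- exact: fmem_eql ex (fmem_eqr ez xz).
- exact: fmem_eql ey (fmem_eqr ez yz).
- move=> w q qp wz.
  have wz' := fmem_eqr (feq_sym (feq_mono qp ez)) wz.
  move=> r rq; have [r' rr e] := h w q qp wz' r rq; exists r' => //.
  have rp := le_trans rr (le_trans rq qp).
  by case: e => e; [left|right]; apply: feq_trans e (feq_mono rp _).
Qed.

Lemma fupair_check z x y p : fupair (check z) (check x) (check y) p <-> z = upair x y.
Proof.
rewrite fupairE; split=> [[/fmem_check xz /fmem_check yz h]|->].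
  apply: eqV => w; rewrite mem_upair; split=> [wz|[->|->]//].
  have [] := h (check w) p (le_refl p) _ p (le_refl p); first exact/fmem_check.
  by move=> r _ [/feq_check|/feq_check]; [left|right].
split; [by apply/fmem_check/mem_upair; left|by apply/fmem_check/mem_upair; right|].
move=> w q _ /fmem_checkE h r /h[r' rr [v /mem_upair[->|->] e]]; exists r' => //.
  by left.
by right.
Qed.

Lemma fpair_check x y p : fpair (check (opair x y)) (check x) (check y) p.
Proof.
have mono1 u v z x' y' : mono (fand (fupair u x' x') (fand (fupair v x' y') (fupair z u v))).
  by do 2?apply: mono_fand; exact: fupair_mono.
apply: (fexI (s := check (upair x x))); first by case: (regular_fex
  (fun v => fand (fupair (check (upair x x)) (check x) (check x))
    (fand (fupair v (check x) (check y)) (fupair (check (opair x y)) (check (upair x x)) v)))).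
apply: (fexI (s := check (upair x y))); first exact: mono1.
by split; [|split]; apply/fupair_check.
Qed.

Lemma fpair_congr z z' x y p : feq z z' p -> fpair z x y p -> fpair z' x y p.
Proof.
move=> ez /fexE h; apply/fexE => q qp; have [r rq [u /fexE h']] := h q qp.
have rp := le_trans rq qp.
exists r => //; exists u; apply/fexE => q' qr; have [r' rr [v [h1 [h2 h3]]]] := h' q' qr.
exists r' => //; exists v; split=> //; split=> //.
have e := feq_mono (le_trans rr (le_trans qr rp)) ez.
by apply: fupair_congr h3 => //; exact: feq_refl.
Qed.

(** The condition is strengthened step by step until both unordered pairs and both components are
    decided to be check names; [fupair_check] then reads off equalities in [V]. *)
Lemma fpair_decode z0 x y p : fpair (check z0) x y p ->
  dense_below (fun r => exists x0 y0,
    [/\ z0 = opair x0 y0, feq x (check x0) r & feq y (check y0) r]) p.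
Proof.
move=> /fexE h q qp; have [r1 r1q [u /fexE h1]] := h q qp.
have [r2 r21 [v [ux [vxy zuv]]]] := h1 r1 (le_refl r1).
have [uz vz _] := (fupairE _ _ _ _).1 zuv.
have [r3 r32 [u0 _ eu]] := (fmem_checkE _ _ _).1 uz r2 (le_refl r2).
have [r4 r43 [v0 _ ev]] := (fmem_checkE _ _ _).1 (fmem_mono r32 vz) r3 (le_refl r3).
have r42 := le_trans r43 r32.
have eu4 := feq_mono r43 eu.
have [xu _ _] := (fupairE _ _ _ _).1 (fupair_mono r42 ux).
have [_ yv _] := (fupairE _ _ _ _).1 (fupair_mono r42 vxy).
have [r5 r54 [x0 _ ex]] := (fmem_checkE _ _ _).1 (fmem_eqr eu4 xu) r4 (le_refl r4).
have [r6 r65 [y0 _ ey]] :=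
  (fmem_checkE _ _ _).1 (fmem_mono r54 (fmem_eqr ev yv)) r5 (le_refl r5).
have r64 := le_trans r65 r54; have r62 := le_trans r64 r42.
have ex6 := feq_mono r65 ex; have eu6 := feq_mono r64 eu4; have ev6 := feq_mono r64 ev.
exists r6; first exact: le_trans r62 (le_trans r21 r1q).
exists x0, y0; split=> //.
have /fupair_check -> := fupair_congr (feq_refl _ _) eu6 ev6 (fupair_mono r62 zuv).
have /fupair_check -> := fupair_congr eu6 ex6 ex6 (fupair_mono r62 ux).
by have /fupair_check -> := fupair_congr ev6 ex6 ey (fupair_mono r62 vxy).
Qed.

Lemma ftriple_check x y z p :
  ftriple (check (triple x y z)) (check x) (check y) (check z) p.
Proof.
apply: (fexI (s := check (opair x y))).
  by apply: mono_fand; exact: mono_fnot.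
by split; exact: fpair_check.
Qed.

Lemma ftriple_decode t c0 a x z p : feq t (check c0) p -> ftriple t a x z p ->
  dense_below (fun r => exists a0 x0 z0,
    c0 = triple a0 x0 z0 /\ feq a (check a0) r) p.
Proof.
move=> et /fexE h q qp; have [r1 r1q [w [h1 h2]]] := h q qp.
have r1p := le_trans r1q qp.
have [r2 r21 [w0 [A0 [-> ew _]]]] :=
  fpair_decode (fpair_congr (feq_mono r1p et) h2) (le_refl r1).
have h1' : fpair w a x r2 by have [m _] := regular_fex (fun u => fex (fun v =>
    fand (fupair u a a) (fand (fupair v a x) (fupair w u v)))); exact: m h1.
have [r3 r32 [a0 [x0 [-> ea _]]]] := fpair_decode (fpair_congr ew h1') (le_refl r2).
exists r3; first exact: le_trans r32 (le_trans r21 r1q).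
by exists a0, x0, A0.
Qed.

(** * The name for the set added by the first coordinates *)

Section GenericSet.
Variable S : name Q.
Hypothesis S_generic : forced (fgeneric_set le S).

Let in_generic xi : fprop Q := fex (fun t => fand (fmem t (Gdot Q))
  (fex (fun a => fex (fun x => fex (fun z => fand (ftriple t a x z) (fmem xi a)))))).

Lemma fmem_generic xi p : fmem xi S p <-> in_generic xi p.
Proof.
have [/fimpE h1 /fimpE h2] := S_generic p xi.
split=> h.
  apply: h1 => //; [by case: (regular_fmem xi S)|exact: regular_fex].
by apply: h2 => //; [exact: mono_fnot|exact: regular_fmem].
Qed.

Lemma generic_set_decode xi p : fmem xi S p ->
  dense_below (fun r => exists x0 c a x z, [/\ r <=Q c, el c = triple a x z, x0 ∈ a &
    feq xi (check x0) r]) p.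
Proof.
move=> /fmem_generic/fexE h q qp; have [r1 r1q [t [/fmem_GdotE tG /fexE h1]]] := h q qp.
have [r2 r21 [c r2c et]] := tG r1 (le_refl r1).
have [r3 r32 [a /fexE h2]] := h1 r2 r21.
have [r4 r43 [x /fexE h3]] := h2 r3 (le_refl r3).
have [r5 r54 [A [tr xa]]] := h3 r4 (le_refl r4).
have r52 := le_trans r54 (le_trans r43 r32).
have [r6 r65 [a0 [x0 [A0 [cE ea]]]]] := ftriple_decode (feq_mono r52 et) tr (le_refl r5).
have [r7 r76 [y ya ey]] :=
  (fmem_checkE _ _ _).1 (fmem_eqr ea (fmem_mono r65 xa)) r6 (le_refl r6).
have r72 := le_trans r76 (le_trans r65 r52).
exists r7; first exact: le_trans r72 (le_trans r21 r1q).
exists y, c, a0, x0, A0; split=> //; exact: le_trans r72 r2c.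
Qed.

Lemma generic_set_check p a x z xi : el p = triple a x z -> xi ∈ a ->
  fmem (check xi) S p.
Proof.
move=> pE xia; apply/fmem_generic.
have mex (B : name Q -> fprop Q) : mono (fex B) by exact: mono_fnot.
have mmem s t : mono (fmem s t) by case: (regular_fmem s t).
apply: (fexI (s := check (el p))); first by apply: mono_fand.
split.
  apply/fmem_GdotE => q qp; exists q => //; exists p => //; exact: feq_refl.
apply: (fexI (s := check a)) => //; apply: (fexI (s := check x)) => //.
apply: (fexI (s := check z)).
  by apply: mono_fand; [exact: mono_fnot|exact: mmem].
by split; [rewrite pE; exact: ftriple_check|exact/fmem_check].
Qed.
End GenericSet.

(** * Names for clubs *)

Section Clubs.
Variables (k : V) (D : name Q).

Lemma mono_fclub : mono (fclub le (check k) D).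
Proof.
apply: mono_fand => [p q qp h z|]; first exact: mono_fnot (h z).
by apply: mono_fand => p q qp h z; exact: mono_fnot (h z).
Qed.

Lemma club_unbounded p b : fclub le (check k) D p -> b ∈ k ->
  dense_below (fun r => exists c, [/\ c ∈ k, b ∈ c & fmem (check c) D r]) p.
Proof.
move=> [Dk [Du _]] bk q qp.
have mm s t : mono (fmem s t) by case: (regular_fmem s t).
have /fimpE h := Du (check b); have {h} /fexE h :
    fex (fun y => fand (fmem y D) (fmem (check b) y)) q.
  by apply: h => //; [exact: regular_fex|exact/fmem_check].
have [r rq [y [yD yb]]] := h q (le_refl q).
have yk : fmem y (check k) r.
  by have /fimpE hD := Dk y; apply: hD yD => //; [exact: regular_fmem|exact: le_trans qp].
have [r' rr [c ck e]] := (fmem_checkE _ _ _).1 yk r (le_refl r).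
exists r'; first exact: le_trans rq.
exists c; split=> //; last exact: fmem_eql e (fmem_mono rr yD).
by apply/(fmem_check _ _ r'); exact: fmem_eqr e (fmem_mono rr yb).
Qed.

(** The limit hypothesis speaks of check names and dense sets only, since a name forced into
    [check x] is densely equal to the check name of an element of [x]. *)
Lemma club_closed p q x : fclub le (check k) D p -> q <=Q p -> x ∈ k ->
  (exists b, b ∈ x) ->
  (forall b, b ∈ x -> dense_below (fun r =>
    exists c, [/\ c ∈ x, b ∈ c & fmem (check c) D r]) q) ->
  fmem (check x) D q.
Proof.
move=> [_ [_ Dc]] qp xk [b0 b0x] lim.
have mm s t : mono (fmem s t) by case: (regular_fmem s t).
have mlim : mono (flimit_point le D (check x)).
  by apply: mono_fand => [|r r' rr h z]; [exact: mono_fnot|exact: mono_fnot (h z)].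
have /fimpE h := Dc (check x).
have {}h : fimp (flimit_point le D (check x)) (fmem (check x) D) q.
  apply: h => //; last exact/fmem_check.
  by apply: regular_fimp.
move/fimpE: h; apply=> //; first exact: regular_fmem.
split; first by apply: (fexI (s := check b0)) => //; exact/fmem_check.
move=> z; apply/fimpE => //; first exact: regular_fex.
move=> q1 q1q /fmem_checkE zx; apply/fexE => q2 q21.
have [q3 q32 [b bx e]] := zx q2 q21.
have q3q := le_trans q32 (le_trans q21 q1q).
have [r r3 [c [cx bc cD]]] := lim b bx q3 q3q.
exists r; first exact: le_trans r3 q32.
exists (check c); split=> //; split; last exact/fmem_check.
by apply: fmem_eql (feq_sym (feq_mono r3 e)) _; exact/fmem_check.
Qed.
End Clubs.

Lemma stationary_intro (k : V) S :
  (forall s p, fmem s S p -> fmem s (check k) p) ->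
  (forall D p, fclub le (check k) D p ->
    exists2 q, q <=Q p & exists2 s, fmem s D q & fmem s S q) ->
  forced (fstationary le (check k) S).
Proof.
move=> Sk meet p.
have mm s t : mono (fmem s t) by case: (regular_fmem s t).
split=> [s|D]; apply/fimpE => //.
- exact: regular_fmem.
- by move=> q _; exact: Sk.
- exact: mono_fclub.
- exact: regular_fex.
- move=> q _ cD; apply/fexE => r rq.
  have [r' rr [s sD sS]] := meet _ _ (mono_fclub rq cD).
  by exists r' => //; exists s.
Qed.

End ForcingTheory.

Theorem proposition6p2
    (pi : V -> V) (Y : set V) (F : skolem_family) (Gamma : set V)
    (two_omega1 : [set a | a ⊆ omega1] #= elts omega2)
    (pi_bij : set_bij (elts omega2) (H omega2) pi)
    (Y_stationary : stationaryP (elts omega2) Y)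
    (Y_thin : forall b, b ∈ omega2 ->
       [set capV a (elts b) | a in Y] #<= elts omega1)
    (Y_initial : forall a b, Y a -> b ∈ omega2 -> Y (capV a (elts b)))
    (F_skolem : definable_skolem pi Y F)
    (Gamma_Lambda : Gamma `<=` Lambda F)
    (Gamma_stationary : stationary omega2 Gamma) :
  let P := poset F Y Gamma in
  strongly_proper_on_stationary P poset_le /\
  forall S : name P,
    forced (fgeneric_set poset_le S) ->
    forced (fstationary poset_le (check P omega2) S).
Proof.
move=> P; split.
  exact: (strongly_proper pi_bij Y_stationary Y_thin Y_initial F_skolem Gamma_Lambda
    Gamma_stationary).
move=> S S_gen.
have Y_sub := Y_stationary.1.
have mP := mem_poset Y_sub Gamma_Lambda.
have PH := poset_H Y_sub Gamma_Lambda Gamma_stationary.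
have elP (p : idx P) : el p ∈ P by exists p.
have idxP p : p ∈ P -> exists i : idx P, el i = p by [].
have le_refl p : p ∈ P -> poset_le p p.
  by move=> /mP[a [x [A [-> _]]]]; exists a, x, A, a, x, A; split=> //; split.
have le_trans r q p : poset_le r q -> poset_le q p -> poset_le r p.
  move=> [b [y [B [a [x [A [-> -> [ab xy AB]]]]]]]].
  move=> [a' [x' [A' [c [z [C [/triple_inj[<- <- <-] -> [ca zx CA]]]]]]]].
  exists b, y, B, c, z, C.
  by split=> //; split; [exact: subset_trans ab|exact: subset_trans xy|exact: subset_trans AB].
have lr (p : idx P) : poset_le (el p) (el p) by exact: le_refl.
have lt (r q p : idx P) : poset_le (el r) (el q) -> poset_le (el q) (el p) ->
    poset_le (el r) (el p) by exact: le_trans.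
apply: (stationary_intro lr lt).
  move=> s p sS; have [_ st] := regular_fmem lr lt s (check P omega2).
  apply: st => q qp; have [r rq [xi [c [a [x [A [rc cE xia e]]]]]]] :=
    generic_set_decode lr lt S_gen sS qp.
  exists r => //; apply: (fmem_eql lr lt (feq_sym e)); apply/(fmem_check lr lt).
  have /mP[a' [x' [A' [cE' cnd]]]] := elP c.
  move: cE'; rewrite cE => /triple_inj[aE _ _]; rewrite aE in xia.
  by have [_ h] := cond_a cnd; exact: (h _ xia).1.
move=> D p0 clD.
pose ext s b (rc : V * V) := [/\ rc.1 ∈ P, poset_le rc.1 s, poset_le rc.1 (el p0),
  rc.2 ∈ omega2 & b ∈ rc.2 /\
  exists i : idx P, el i = rc.1 /\ fmem poset_le (check P rc.2) D i].
(* The empty list puts the given condition into [N]; a condition and an ordinal call the search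
   [ext]. Since [D] is not an object of [N], this operation is all that [N] knows of it. *)
pose g (s : seq V) : set V := match s with
  | [::] => [set el p0]
  | [:: s; b] => if pselect (exists rc, ext s b rc) is left h
      then [set (sval (cid h)).1; (sval (cid h)).2] else set0
  | _ => set0 end.
have cg : countable_op (H omega2) g.
  move=> s _; split; last first.
    apply: finite_set_countable; case: s => [|s [|b [|]]] //.
      exact: finite_set1.
    rewrite /g; case: pselect => [h|?]; [exact: finite_set2|exact: finite_set0].
  case: s => [|s [|b [|]]] //= z; first by move=> ->; exact: PH.
  case: pselect => // h; case: cid => -[r c] /= [/PH Hr _ _ c2 _] [->|->] //.
  exact: H_ord.
have [M [N [gM NH Ng NS]]] := good_hull pi_bij Y_stationary F_skolem
  Gamma_Lambda Gamma_stationary (@subset_refl _ _) cg.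
have NE : elts N = Sk F (elts M).
  by rewrite -NS; apply/seteqP; split=> z // zN; [split=> //; case: NH => + _; apply|case: zN].
have Np0 : Sk F (elts M) (el p0) by rewrite -NE; apply: (Ng [::]).
have XM := good_X gM.
have [a [x [A [qP qp0 xia sg]]]] := good_extension pi_bij Y_stationary Y_thin Y_initial
  F_skolem Gamma_Lambda Gamma_stationary gM (elP p0) Np0.
have [q qE] := idxP _ qP; rewrite -qE in qP qp0 sg.
have xi2 : supO (elts M) ∈ omega2.
  exact: (supM_in2 Y_sub Gamma_Lambda Gamma_stationary XM).
have sup_lt m : m ∈ M -> m ∈ supO (elts M).
  exact: (good_sup_lt Y_sub F_skolem gM).
exists q => //; exists (check P (supO (elts M))); last first.
  exact: (generic_set_check lr lt S_gen qE xia).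
apply: (club_closed lr lt clD qp0 xi2).
  have [m mM] := good_nonempty gM.
  by exists m; exact: sup_lt.
(* It suffices to find a point of [D] above [m] that is in [N]: ordinals of [N] below [omega2] are
   in [M], hence below its supremum. *)
move=> b /(mem_supO _ (is_set_elts M))[m mM bm] q3 q3q.
have NP : elts N `&` elts P = Sk F (elts M) `&` elts P by rewrite NE.
(* Incompatibility with [el p0] makes [E] dense among all conditions of [N]; below [q], which
   extends [el p0], only the other alternative remains. *)
pose E := [set s | (elts N `&` elts P) s /\
  ((forall t, t ∈ P -> poset_le t s -> ~ poset_le t (el p0)) \/
   exists c, [/\ c ∈ N, c ∈ omega2, m ∈ c &
     exists i : idx P, el i = s /\ fmem poset_le (check P c) D i])].
have m2 := X_in2 Y_sub XM mM.
have dE : dense_in poset_le (elts N `&` elts P) E.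
  split=> [s []//|s [sN sP]].
  have [[t [tP ts tp]]|nt] := pselect (exists t, [/\ t ∈ P, poset_le t s & poset_le t (el p0)]);
    last first.
    exists s; last exact: le_refl.
    by split=> //; left=> t tP ts tp; apply: nt; exists t.
  have [i iE] := idxP _ tP; rewrite -iE in ts tp.
  have [r ri [c [c2 mc cD]]] := club_unbounded lr lt clD m2 tp.
  have : g [:: s; m] `<=` elts N.
    apply: Ng => z; rewrite !inE => /orP[] /eqP-> //.
    by rewrite NE; exact: sub_Sk.
  rewrite /g; case: pselect => [h|nh]; last first.
    case: nh; exists (el r, c); split=> //=; [exact: le_trans ri ts|exact: le_trans ri tp|].
    by split=> //; exists r.
  case: cid => -[r' c'] /= [r'P r's r'p c'2 [mc' [j [jE jD]]]] sub.
  have r'N : r' ∈ N by apply: sub; left.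
  have c'N : c' ∈ N by apply: sub; right.
  exists r' => //; split=> //; right; exists c'; split=> //; by exists j.
have [d [[dN dP] dc] [w [wP wd wq]]] := sg _ NP _ dE _ (elP q3) q3q.
have [i iE] := idxP _ wP; rewrite -iE in wP wd wq.
exists i => //; case: dc => [nd|[c [cN c2 mc [j [jE jD]]]]].
  by case: (nd _ wP wd); exact: le_trans wq (le_trans _ _ _ q3q qp0).
exists c; split.
- apply: sup_lt; apply: (Sk_X XM) => //.
  by rewrite -NE.
- exact: Ord_trans (Ord_in2 c2) bm mc.
- by apply: (fmem_mono lr lt _ jD); rewrite jE.
Qed.
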